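(* Let $N>2M\ge 2$ be integers, let $K$ be the $N$-gon, and let $z\in\mathbb{R}^N$ be a typical point such that $\mathrm{PH}_0(z)$ has exactly $M$ points. Let $P=(\mathrm{PH}_0(z),\mathrm{PH}_1(z))$ and $\mathbf{data}_P=\{w\in\mathbb{R}^N:\mathrm{PH}_0(w)=\mathrm{PH}_0(z),\ \mathrm{PH}_1(w)=\mathrm{PH}_1(z)\}$. Then the connected component of $\mathbf{data}_P$ containing $z$ is homeomorphic to the geometric realization of the poset $\mathbf{Str}(N,M)$.
   Context: The $N$-gon $K$ has vertices $\mathbb{Z}/N$ and edges $[i,i+1]$. For $w\in\mathbb{R}^N$, $K_r(w)$ is the subcomplex of vertices $i$ with $w_i\le r$ and edges with $\max\{w_i,w_{i+1}\}\le r$; $\mathrm{PH}_0(w),\mathrm{PH}_1(w)$ are the persistence diagrams (multisets of (birth, death) pairs) in degrees $0,1$ of the filtration $r\mapsto K_r(w)$. A point $z\in\mathbb{R}^N$ is typical if its coordinates are pairwise distinct. Circular cellular strings: a circular symbol string of length $N$ is $s=s_1\cdots s_N$ with each $s_i\in\{0,1,X\}$, indices read cyclically modulo $N$; $0,1$ are called bits. A block of $s$ is a maximal cyclic run of consecutive equal symbols. $s$ is a circular cellular string of rank $M$ if it has exactly $M$ blocks of symbol $0$, exactly $M$ blocks of symbol $1$, and every block of symbol $X$ is cyclically preceded and followed by blocks of different bits (one of symbol $0$ and one of symbol $1$). Its dimension is its number of symbols $X$. $\mathbf{Str}(N,M)$ is the set of such strings, partially ordered by $s'<s$ iff $s$ is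 obtained from $s'$ by replacing some (at least one) of the bits of $s'$ by $X$. The geometric realization of a poset is the geometric realization of its order complex (nerve). *)

(* Defs.v *)
From HB Require Import structures.
From mathcomp Require Import all_boot all_order all_algebra.
From mathcomp Require Import all_classical all_reals all_analysis.

Set Implicit Arguments.
Unset Strict Implicit.
Unset Printing Implicit Defensive.

Import Order.TTheory GRing.Theory Num.Theory.
Import numFieldNormedType.Exports.
Local Open Scope classical_set_scope.
Local Open Scope ring_scope.

(* The N-gon K: vertices 'I_N, edges e = [e, e+1 mod N] (also indexed *)
(* by 'I_N).  Chains with coefficients in the field rat:               *)
(* C_0(K) = C_1(K) = 'rV[rat]_N (row vectors).                         *)

Definition ngon_bd (N : nat) : 'M[rat]_N :=
  \matrix_(e < N, v < N) (((v == ordS e) : nat)%:R - ((v == e) : nat)%:R).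

Definition vval (R : realType) (N : nat) (w : 'rV[R]_N) (i : 'I_N) : R := w 0 i.
Definition eval_edge (R : realType) (N : nat) (w : 'rV[R]_N) (e : 'I_N) : R :=
  Num.max (w 0 e) (w 0 (ordS e)).

(* selection (projection) matrices onto the chains of the subcomplex
   consisting of the simplices whose value satisfies the level predicate P
   (P = (<= r) gives K_r(w); P = (< r) gives K_{r-eps}(w) for eps small) *)
Definition vsel (R : realType) (N : nat) (P : R -> bool) (w : 'rV[R]_N) : 'M[rat]_N :=
  diag_mx (\row_i ((P (vval w i) : nat)%:R)).
Definition esel (R : realType) (N : nat) (P : R -> bool) (w : 'rV[R]_N) : 'M[rat]_N :=
  diag_mx (\row_e ((P (eval_edge w e) : nat)%:R)).

(* cycles and boundaries of the subcomplex, as row spaces in C_k(K) *)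
Definition cycles (R : realType) (N : nat) (k : nat) (P : R -> bool) (w : 'rV[R]_N)
  : 'M[rat]_N :=
  match k with
  | 0 => vsel P w
  | 1 => (esel P w :&: kermx (ngon_bd N))%MS
  | _ => 0
  end.
Definition bounds (R : realType) (N : nat) (k : nat) (P : R -> bool) (w : 'rV[R]_N)
  : 'M[rat]_N :=
  match k with
  | 0 => esel P w *m ngon_bd N
  | _ => 0
  end.

(* rank of H_k(K_P(w)) -> H_k(K_Q(w)) (for P included in Q) *)
Definition pers_rank (R : realType) (N : nat) (k : nat) (w : 'rV[R]_N)
  (P Q : R -> bool) : nat :=
  (\rank (cycles k P w + bounds k Q w)%MS - \rank (bounds k Q w))%N.

Definition lev_le (R : realType) (r : R) : R -> bool := fun x => x <= r.
Definition lev_lt (R : realType) (r : R) : R -> bool := fun x => x < r.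

(* multiplicity of the point (b,d) in PH_k(w), via the inclusion-exclusion
   formula mu(b,d) = r(b,d-) - r(b-,d-) - r(b,d) + r(b-,d) (all terms are
   evaluated exactly since the filtration is finite); d = +oo for
   essential classes, using r(_, +oo) = rank into H_k(K). *)
Definition ph_mult (R : realType) (N : nat) (k : nat) (w : 'rV[R]_N)
  (b : R) (d : \bar R) : nat :=
  let pr := pers_rank k w in
  match d with
  | EFin d => if b < d then
      ((pr (lev_le b) (lev_lt d) + pr (lev_lt b) (lev_le d))
       - (pr (lev_lt b) (lev_lt d) + pr (lev_le b) (lev_le d)))%N
      else 0%N
  | EPInf => (pr (lev_le b) predT - pr (lev_lt b) predT)%N
  | ENInf => 0%N
  end.

Definition crit_vals (R : realType) (N : nat) (w : 'rV[R]_N) : seq R :=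
  undup [seq w 0 i | i <- enum 'I_N].

(* persistence diagram PH_k(w) as a multiset (seq up to permutation) of
   (birth, death) pairs; births and deaths can only occur at critical values *)
Definition PH (R : realType) (N : nat) (k : nat) (w : 'rV[R]_N) : seq (R * \bar R) :=
  flatten [seq nseq (ph_mult k w b d) (b, d)
          | b <- crit_vals w, d <- [seq (x%:E) | x <- crit_vals w] ++ [:: +oo%E]].

Definition typical (R : realType) (N : nat) (z : 'rV[R]_N) : Prop :=
  injective (fun i : 'I_N => z 0 i).

Definition dataP (R : realType) (N : nat) (z : 'rV[R]_N) : set 'rV[R]_N :=
  [set w | perm_eq (PH 0 w) (PH 0 z) /\ perm_eq (PH 1 w) (PH 1 z)].

Definition sym := 'I_3.
Definition S0 : sym := @Ordinal 3 0 isT.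
Definition S1 : sym := @Ordinal 3 1 isT.
Definition SX : sym := @Ordinal 3 2 isT.

Definition sat (N : nat) (s : N.-tuple sym) (k : nat) : sym := nth SX s (k %% N).

Definition nblocks (N : nat) (a : sym) (s : N.-tuple sym) : nat :=
  if all (pred1 a) s then 1%N
  else #|[pred i : 'I_N | (sat s i == a) && (sat s (i + N - 1) != a)]|.

(* every X-block is preceded and followed by (necessarily bit) blocks of
   different bits: the block at positions i..i+l (cyclically) *)
Definition xblocks_ok (N : nat) (s : N.-tuple sym) : bool :=
  ~~ all (pred1 SX) s &&
  [forall i : 'I_N, forall l : 'I_N,
     [&& sat s (i + N - 1) != SX,
         [forall k : 'I_N, (k <= l)%N ==> (sat s (i + k) == SX)]
       & sat s (i + l + 1) != SX]
     ==> (sat s (i + N - 1) != sat s (i + l + 1))].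

Definition cellular (N M : nat) (s : N.-tuple sym) : bool :=
  [&& nblocks S0 s == M, nblocks S1 s == M & xblocks_ok s].

Definition str_lt (N : nat) (s' s : N.-tuple sym) : bool :=
  [forall i : 'I_N, (tnth s' i == tnth s i) || ((tnth s' i != SX) && (tnth s i == SX))]
  && (s' != s).

Definition str_comparable (N : nat) (s t : N.-tuple sym) : bool :=
  [|| s == t, str_lt s t | str_lt t s].

(* geometric realization of the order complex of Str(N,M), embedded in
   R^{all strings}: nonnegative weights summing to 1 whose support is a
   chain of Str(N,M) *)
Definition str_realization (R : realType) (N M : nat)
  : set 'rV[R]_(#|{: N.-tuple sym}|) :=
  [set p | [/\ (forall i, 0 <= p 0 i),
               \sum_i p 0 i = 1,
               (forall i, p 0 i != 0 -> cellular M (enum_val i))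
             & (forall i j, p 0 i != 0 -> p 0 j != 0 ->
                  str_comparable (enum_val i) (enum_val j))]].

Definition homeomorphic (T U : topologicalType) (A : set T) (B : set U) : Prop :=
  exists (f : T -> U) (g : U -> T),
    {within A, continuous f} /\ {within B, continuous g} /\
    (forall x, A x -> B (f x)) /\ (forall y, B y -> A (g y)) /\
    (forall x, A x -> g (f x) = x) /\ (forall y, B y -> f (g y) = y).

(* Main.v *)
(** Write [w = zeta c \o phi], where [zeta c] is the zigzag function that is
    linear between integers and takes the values [c k] (local minima at even
    [k], local maxima at odd [k]) and [phi] is a monotone lift of a degree-[M]
    map from the polygon to the circle [R / 2M].  For typical [z] the circular
    word [c] of extremal values has [2M] distinct letters.

    Sliding vertices along the zigzag does not change the persistence diagrams,
    so the curve [A] of all [w] with the same [c] lies in [data_P].  Conversely,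
    the knots of any [w] in [data_P] are birth or death values, so [data_P] is
    contained in the union of [A] and finitely many compact sets disjoint from
    [A]; as [A] is compact and connected, it is the component of [z].

    The lifts that attain every integer are obtained from free monotone
    sequences of length [N - 2M] by merging in the integers.  Free sequences
    form a simplex times a line, on which the deck transformation acts by a
    rotation of the simplex; the square of the rotation is isotopic to the
    identity, so the homeomorphism type of [A] does not depend on the symmetry
    of [c], and [c] may be replaced by the word [-1, 1, -1, 1, ...].  For this
    word a point [w] of [A] has coordinates in [[-1, 1]], and recording which
    of them lie beyond a varying threshold gives a chain of cellular strings:
    these are the barycentric coordinates of the order complex. *)
Require Import Defs.
From HB Require Import structures.
From mathcomp Require Import all_boot all_order all_algebra.
From mathcomp Require Import all_classical all_reals all_analysis.
From mathcomp Require Import zify lra ring.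
Import Order.TTheory GRing.Theory Num.Theory.
Import numFieldNormedType.Exports.
Local Open Scope classical_set_scope.
Local Open Scope ring_scope.

Set Implicit Arguments.
Unset Strict Implicit.
Unset Printing Implicit Defensive.

(** The isotopy is what removes the symmetry of [c]. The even translations of lifts that preserve
    [c] are the multiples of [2M] for typical [z], but all even integers for the alternating word,
    so the two curves are mapping tori of different powers of the rotation. Only even powers occur,
    because a translation must match minima with minima. This matters: for an even number of free
    vertices a single rotation reverses the orientation of the simplex and is not isotopic to the
    identity. Linear maps that join the squared rotation to the identity need not preserve the
    simplex; rescaling them radially, by a gauge whose balls in the hyperplane of sum 0 are
    simplices, repairs this. Both curves then become quotients of one compact cylinder, the simplex
    times [0, 1], with the same fibres, and compactness turns equality of fibres into a
    homeomorphism. The inequality [2M < N] leaves at least one free vertex to parametrise the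
    lifts. *)

(** * Homeomorphisms and quotients of compact sets *)

Lemma homeomorphic_sym (T U : topologicalType) (A : set T) (B : set U) :
  homeomorphic A B -> homeomorphic B A.
Proof. by move=> [f [g [cf [cg [AB [BA [gf fg]]]]]]]; exists g, f. Qed.

Lemma within_continuous_comp (T U V : topologicalType) (A : set T) (B : set U)
    (f : T -> U) (g : U -> V) :
  (forall x, A x -> B (f x)) ->
  {within A, continuous f} -> {within B, continuous g} ->
  {within A, continuous (g \o f)}.
Proof.
move=> AB /subspace_continuousP cf /subspace_continuousP cg.
apply/subspace_continuousP => x Ax W /(cg _ (AB _ Ax)) gW.
have := cf x Ax _ gW; rewrite /within /=; rewrite !nbhs_simpl /=.
by apply: filterS => y fy Ay; apply: fy => //; exact: AB.
Qed.

Lemma homeomorphic_trans (T U V : topologicalType)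
    (A : set T) (B : set U) (C : set V) :
  homeomorphic A B -> homeomorphic B C -> homeomorphic A C.
Proof.
move=> [f [g [cf [cg [AB [BA [gf fg]]]]]]] [h [k [ch [ck [BC [CB [kh hk]]]]]]].
exists (h \o f), (g \o k); split; first exact: within_continuous_comp ch.
split; first exact: within_continuous_comp cg.
split; first by move=> x /AB /BC.
split; first by move=> x /CB /BA.
split=> x xA /=; first by rewrite kh ?gf//; exact: AB.
by rewrite fg ?hk//; exact: CB.
Qed.

(* The preimage of a closed set under the induced map is the image of a
   closed, hence compact, part of K: no inverse needs to be shown continuous. *)
Lemma homeomorphic_quotients (S T U : topologicalType)
    (x0 : S) (K : set S) (p : S -> T) (q : S -> U) :
  hausdorff_space T -> hausdorff_space U -> compact K ->
  {within K, continuous p} -> {within K, continuous q} ->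
  (forall x y, K x -> K y -> p x = p y <-> q x = q y) ->
  homeomorphic (p @` K) (q @` K).
Proof.
have key (T' U' : topologicalType) (p' : S -> T') (q' : S -> U') :
    hausdorff_space T' -> compact K ->
    {within K, continuous p'} -> {within K, continuous q'} ->
    (forall x y, K x -> K y -> p' x = p' y -> q' x = q' y) ->
    let f := fun t => q' (xget x0 [set x | K x /\ p' x = t]) in
    {within p' @` K, continuous f} /\ (forall x, K x -> f (p' x) = q' x).
  move=> hT cK cp cq pq f.
  have fp x : K x -> f (p' x) = q' x.
    move=> Kx; rewrite /f; case: xgetP => [y -> [Ky pyx]|]; first exact: pq.
    by move=> /(_ x)/= /not_andP[].
  split=> //; apply/continuous_closedP => C clC; apply/closed_subspaceP.
  exists (p' @` (K `&` q' @^-1` C)).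
    apply: compact_closed => //; apply: continuous_compact.
      by apply: continuous_subspaceW cp => x [].
    have /continuous_closedP/(_ _ clC)/closed_subspaceP[V clV VK] := cq.
    rewrite setIC -VK setIC; exact: compact_closedI.
  apply/seteqP; split=> [_ [[x [Kx Cx] <-] _]|t [Cft [x Kx ptx]]].
    by split; [change (C (f (p' x))); rewrite fp|exists x].
  rewrite -{t}ptx in Cft *.
  by split; exists x => //; split=> //; change (C (q' x)); rewrite -fp.
move=> hT hU cK cp cq pq.
have [cf fp] := key _ _ p q hT cK cp cq (fun x y Kx Ky => (pq x y Kx Ky).1).
have [cg gq] := key _ _ q p hU cK cq cp (fun x y Kx Ky => (pq x y Kx Ky).2).
exists (fun t => q (xget x0 [set x | K x /\ p x = t])).
exists (fun t => p (xget x0 [set x | K x /\ q x = t])).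
split=> //; split=> //.
split; first by move=> _ [x Kx <-]; exists x; rewrite ?fp.
split; first by move=> _ [x Kx <-]; exists x; rewrite ?gq.
split; first by move=> _ [x Kx <-]; rewrite fp// gq.
by move=> _ [x Kx <-]; rewrite gq// fp.
Qed.

(** * Induction over the integers and periodic sequences *)

Lemma int_step_ind (P : int -> Prop) (a : int) : P a ->
  (forall i, P i -> P (i + 1)) -> (forall i, P (i + 1) -> P i) -> forall i, P i.
Proof.
move=> Pa Pup Pdn i; have -> : i = a + (i - a) by lia.
elim: (i - a) => [|k IH|k IH]; first by rewrite addr0.
  by have := Pup _ IH; congr P; lia.
by apply: Pdn; move: IH; congr P; lia.
Qed.

Lemma int_up_ind (P : int -> Prop) (a : int) : P a ->
  (forall i, a <= i -> P i -> P (i + 1)) -> forall i, a <= i -> P i.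
Proof.
move=> Pa Pup i ai; have : exists k : nat, i = a + k%:Z.
  by exists (absz (i - a)); lia.
move=> [k ->] {i ai}; elim: k => [|k IH]; first by rewrite addr0.
have -> : a + k.+1%:Z = a + k + 1 by lia.
by apply: Pup => //; lia.
Qed.

(** Without a switch from false to true, [P] would propagate downwards as well as upwards and hold
    everywhere. *)
Lemma int_least (P : int -> Prop) :
  (forall i, P i -> P (i + 1)) -> (exists a, P a) -> (exists b, ~ P b) ->
  exists2 k, P k & ~ P (k - 1).
Proof.
move=> Pup [a Pa] [b nPb]; apply: contrapT => noleast.
suff Pall : forall i, P i by exact: nPb.
apply: (@int_step_ind _ a) => // i Pi1; apply: contrapT => nPi.
by apply: noleast; exists (i + 1) => //; rewrite addrK.
Qed.

Lemma int_mono_itv (R : realType) (f : int -> R) (a b : int) :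
  (forall i, a <= i -> i < b -> f i <= f (i + 1)) ->
  forall i j, a <= i -> i <= j -> j <= b -> f i <= f j.
Proof.
move=> fS i j ai ij.
apply: (@int_up_ind (fun j => j <= b -> f i <= f j) i _ _ j ij) => // l il IH lb.
by apply: le_trans (IH _) (fS _ _ _); lia.
Qed.

Lemma int_mono (R : realType) (f : int -> R) :
  (forall i, f i <= f (i + 1)) -> forall i j, i <= j -> f i <= f j.
Proof. by move=> fS i j ij; apply: (@int_mono_itv _ f i j). Qed.

Lemma int_sum_exists (step : int -> int) (a : int) :
  exists n : int -> int, n 0 = a /\ forall i, n (i + 1) = n i + step i.
Proof.
exists (fun i => match i with
  | Posz k => a + \sum_(l < k) step l%:Z
  | Negz k => a - \sum_(l < k.+1) step (Negz l) end).
split; first by rewrite /= big_ord0 addr0.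
case=> k; first by rewrite -PoszD addn1 /= big_ord_recr addrA.
case: k => [|k].
  have -> : Negz 0 + 1 = 0%:Z by [].
  by rewrite /= big_ord0 big_ord1 addr0 subrK.
have -> : Negz k.+1 + 1 = Negz k by lia.
by rewrite [in RHS]big_ord_recr /= opprD addrA subrK.
Qed.

Lemma periodic_mul (V : zmodType) (w : int -> V) (N : nat) (x : V) :
  (forall i, w (i + N%:Z) = w i + x) ->
  forall (a : nat) i, w (i + a%:Z * N%:Z) = w i + x *+ a.
Proof.
move=> wN; elim=> [|a IH] i; first by rewrite mul0r !addr0.
have -> : i + a.+1%:Z * N%:Z = i + a%:Z * N%:Z + N%:Z by lia.
by rewrite wN IH mulrSr addrA.
Qed.

(** * Lifts of circular sequences to the real line *)

(* The last condition says that every extremal value is attained at a vertex. *)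
Definition lift (R : realType) (N m : nat) (phi : int -> R) : Prop :=
  [/\ forall i, phi i <= phi (i + 1),
      forall i, phi (i + N%:Z) = phi i + m%:R
    & forall k : int, exists i, phi i = k%:~R].

Lemma lift_mono (R : realType) (N m : nat) (phi : int -> R) : lift N m phi ->
  forall i j, i <= j -> phi i <= phi j.
Proof. by move=> [? _ _]; exact: int_mono. Qed.

(** Some vertex sits exactly at the integer [k]; by monotonicity it comes after [i], so the step
    from [i] to [i + 1] cannot jump over [k]. *)
Lemma lift_skip (R : realType) (N m : nat) (phi : int -> R) : lift N m phi ->
  forall i k, phi i < k%:~R -> phi (i + 1) <= k%:~R.
Proof.
move=> lp i k phik; have [_ _ /(_ k) [j jk]] := lp.
rewrite -jk; apply: (lift_mono lp); rewrite leNgt; apply/negP => ji.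
by move: phik; rewrite ltNge -jk (lift_mono lp)//; lia.
Qed.

Lemma lift_floor_le (R : realType) (N m : nat) (phi : int -> R) : lift N m phi ->
  forall i, Num.floor (phi i) <= Num.floor (phi (i + 1)).
Proof. by move=> [? _ _] i; exact: le_floor. Qed.

Lemma lift_floor_lt (R : realType) (N m : nat) (phi : int -> R) : lift N m phi ->
  forall i, Num.floor (phi i) < Num.floor (phi (i + 1)) ->
  phi (i + 1) = (Num.floor (phi i) + 1)%:~R.
Proof.
move=> lp i flt; apply/eqP; rewrite eq_le; apply/andP; split.
  by apply: (lift_skip lp); case/andP: (floor_itv (phi i)).
by apply: le_trans (floor_le _); rewrite ler_int lezD1.
Qed.

Lemma lift_floorS (R : realType) (N m : nat) (phi : int -> R) : lift N m phi ->
  forall i, Num.floor (phi (i + 1)) <= Num.floor (phi i) + 1.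
Proof.
move=> lp i; have [le|lt] := leP (Num.floor (phi (i + 1))) (Num.floor (phi i)).
  by lia.
by rewrite (lift_floor_lt lp lt) intrKfloor.
Qed.

Lemma lift_first (R : realType) (N m : nat) (phi : int -> R) : lift N m phi ->
  forall k : int, exists2 i, phi i = k%:~R & phi (i - 1) < k%:~R.
Proof.
move=> lp k; have [_ _ ex] := lp.
have [| | |i ki /negP] := @int_least (fun i => k%:~R <= phi i).
- by move=> i ki; apply: le_trans ki _; case: lp.
- by have [i ik] := ex k; exists i; rewrite ik.
- have [i ik] := ex (k - 1); exists i; apply/negP; rewrite -ltNge ik ltr_int; lia.
rewrite -ltNge => ik; exists i => //; apply/eqP; rewrite eq_le ki andbT.
by have := lift_skip lp ik; rewrite subrK.
Qed.

Lemma lift_shift (R : realType) (N m : nat) (phi : int -> R) (k : int) :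
  lift N m phi -> lift N m (fun i => phi i + k%:~R).
Proof.
move=> [p1 p2 p3]; split=> [i|i|l]; first by rewrite lerD2r.
- by rewrite p2 addrAC.
- by have [i ip] := p3 (l - k); exists i; rewrite ip -intrD subrK.
Qed.

(** * Zigzag functions: uniqueness and existence of the lift *)

Definition zeta (R : realType) (c : int -> R) (x : R) : R :=
  c (Num.floor x) + (x - (Num.floor x)%:~R) * (c (Num.floor x + 1) - c (Num.floor x)).

Definition alternating (R : realType) (c : int -> R) : Prop :=
  forall k : int, c (2 * k) < c (2 * k + 1) /\ c (2 * k) < c (2 * k - 1).

Lemma zeta_int (R : realType) (c : int -> R) (k : int) : zeta c k%:~R = c k.
Proof. by rewrite /zeta intrKfloor subrr mul0r addr0. Qed.

Lemma zeta_itv (R : realType) (c : int -> R) (k : int) (x : R) :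
  k%:~R <= x <= (k + 1)%:~R -> zeta c x = c k + (x - k%:~R) * (c (k + 1) - c k).
Proof.
move=> /andP[kx]; rewrite le_eqVlt => /orP[/eqP->|xk].
  by rewrite zeta_int rmorphD /=; ring.
by rewrite /zeta (@floor_def _ _ k)// kx.
Qed.

Lemma zeta_incr (R : realType) (c : int -> R) (k : int) (x y : R) :
  alternating c -> (2 * k)%:~R <= x -> x < y -> y <= (2 * k + 1)%:~R ->
  zeta c x < zeta c y.
Proof.
move=> /(_ k) [ck _] kx xy yk.
rewrite (@zeta_itv _ _ (2 * k)) ?(ltW (le_lt_trans kx xy))// ?kx ?(ltW (lt_le_trans xy yk))//.
rewrite (@zeta_itv _ _ (2 * k)) ?yk ?(ltW (le_lt_trans kx xy))//.
by rewrite ltrD2l ltr_pM2r ?subr_gt0// ltrD2r.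
Qed.

Lemma zeta_decr (R : realType) (c : int -> R) (k : int) (x y : R) :
  alternating c -> (2 * k - 1)%:~R <= x -> x < y -> y <= (2 * k)%:~R ->
  zeta c y < zeta c x.
Proof.
move=> /(_ k) [_ ck] kx xy yk.
have e : 2 * k - 1 + 1 = 2 * k by lia.
rewrite (@zeta_itv _ _ (2 * k - 1)); last by rewrite e; lra.
rewrite (@zeta_itv _ _ (2 * k - 1)); last by rewrite e; lra.
by rewrite e ltrD2l ltr_nM2r ?subr_lt0// ltrD2r.
Qed.

(* A position on a plateau has the direction of the step that leaves the plateau. *)
Definition dir (R : realType) (w : int -> R) (i : int) : Prop :=
  exists j, [/\ i < j, w i < w j & forall l, i < l -> l < j -> w l = w i].

Lemma dir_up (R : realType) (w : int -> R) (i : int) : w i < w (i + 1) -> dir w i.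
Proof. by move=> wi; exists (i + 1); split=> // [|l]; lia. Qed.

Lemma dir_down (R : realType) (w : int -> R) (i : int) :
  w (i + 1) < w i -> ~ dir w i.
Proof.
move=> wi [j [ij wij wl]]; have [j1|j1] := eqVneq j (i + 1).
  by move: wij; rewrite j1; lra.
by move: wi; rewrite wl ?ltxx//; lia.
Qed.

Lemma dir_eq (R : realType) (w : int -> R) (i : int) :
  w i = w (i + 1) -> (dir w i <-> dir w (i + 1)).
Proof.
move=> wi; split=> -[j [ij wij wl]].
  exists j; split; last by move=> l il lj; rewrite -wi wl//; lia.
    have [//|j1] := ltP (i + 1) j.
    by have E : j = i + 1 by [lia]; move: wij; rewrite E wi ltxx.
  by rewrite -wi.
exists j; split; [lia|by rewrite wi|] => l il lj.
by have [->//|li] := eqVneq l (i + 1); rewrite wl//; lia.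
Qed.

Lemma dir_periodic (R : realType) (w : int -> R) (N : int) (i : int) :
  (forall i, w (i + N) = w i) -> (dir w (i + N) <-> dir w i).
Proof.
move=> wN; split=> -[j [ij wij wl]].
  have wN' l : w l = w (l - N) by rewrite -(wN (l - N)) subrK.
  exists (j - N); split; [lia|by rewrite -wN' -(wN i)|move=> l il lj].
  by rewrite -wN wl ?wN//; lia.
exists (j + N); split; [lia|by rewrite !wN|move=> l il lj].
have -> : l = l - N + N by lia.
by rewrite !wN wl//; lia.
Qed.

(** Let [j] be the first position with [phi i < phi j]. No integer is skipped, so [phi j] still lies
    in the closed unit interval of [phi i], where [zeta c] is strictly monotone: rising from an even
    floor, falling from an odd one. Hence the parity of the floor can be read off [w] alone. *)
Lemma dir_lift (R : realType) (N m : nat) (phi c w : int -> R) (i : int) :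
  lift N m phi -> alternating c -> (forall i, w i = zeta c (phi i)) ->
  (dir w i <-> (2 %| Num.floor (phi i))%Z).
Proof.
move=> lp ac wE; set k := Num.floor (phi i).
have /andP[ki ik] := floor_itv (phi i); rewrite -/k in ki ik.
have [| | |j ij /negP] := @int_least (fun j => phi i < phi j).
- by move=> j ij; apply: lt_le_trans ij _; case: lp.
- have [_ _ /(_ (k + 1)) [j jk]] := lp; by exists j; rewrite jk.
- by exists i; rewrite ltxx.
rewrite -leNgt => ji.
have i_j : i < j by rewrite ltNge; apply/negP => /(lift_mono lp); rewrite leNgt ij.
have const l : i <= l -> l < j -> phi l = phi i.
  move=> il lj; apply/eqP; rewrite eq_le; apply/andP; split; last exact: (lift_mono lp).
  by apply: le_trans ji; apply: (lift_mono lp); lia.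
have jk : phi j <= (k + 1)%:~R.
  by have := lift_skip lp (le_lt_trans ji ik); rewrite subrK.
split=> [[j' [ij' wij' wl]]|k2].
  apply: contrapT => k2; have [q kq] : exists q, k = 2 * q - 1.
    by exists ((k + 1) %/ 2)%Z; lia.
  have wj : w j < w i.
    rewrite !wE; apply: (@zeta_decr _ _ q) => //; first by rewrite -kq.
    by rewrite (le_trans jk)// ler_int; lia.
  have [jj'|] := ltP j j'; first by move: wj; rewrite wl ?ltxx.
  rewrite le_eqVlt => /orP[/eqP jj'|jj']; first by move: wij'; rewrite jj'; lra.
  by move: wij'; rewrite !wE (const j') ?ltxx//; lia.
exists j; split=> // [|l il lj]; last by rewrite !wE const//; lia.
rewrite !wE; apply: (@zeta_incr _ _ (k %/ 2)%Z) => //.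
  by apply: le_trans ki; rewrite ler_int; lia.
by rewrite (le_trans jk)// ler_int; lia.
Qed.

(** By [dir_lift] the two floors have equal parity at each position, and both advance by 0 or 1 per
    step, so their difference is a constant even integer. The knots then agree, and on each unit
    interval the common affine piece is injective. *)
Lemma lift_unique (R : realType) (N m N' m' : nat) (phi phi' c c' : int -> R) :
  lift N m phi -> lift N' m' phi' -> alternating c -> alternating c' ->
  (forall i, zeta c (phi i) = zeta c' (phi' i)) ->
  exists k : int, (forall i, phi' i = phi i + (2 * k)%:~R) /\
    (forall l, c' (l + 2 * k) = c l).
Proof.
move=> lp lp' ac ac' E.
have [f fE] : exists f, forall i, Num.floor (phi i) = f i by exists (fun i => Num.floor (phi i)).
have [f' fE'] : exists f, forall i, Num.floor (phi' i) = f i by exists (fun i => Num.floor (phi' i)).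
have par i : (2 %| f' i - f i)%Z.
  have H := @dir_lift _ _ _ _ _ (fun i => zeta c (phi i)) i lp ac (fun=> erefl).
  have H' := @dir_lift _ _ _ _ _ (fun i => zeta c (phi i)) i lp' ac' E.
  have [] := iff_trans (iff_sym H) H'; rewrite fE fE'.
  case: (boolP (2 %| f i)%Z) => e; case: (boolP (2 %| f' i)%Z) => e' h1 h2;
    [lia|by have := h1 isT|by have := h2 isT|lia].
have f1 i : f i <= f (i + 1) by rewrite -!fE (lift_floor_le lp).
have f2 (i : int) : f (i + 1) <= f i + 1 by rewrite -!fE (lift_floorS lp).
have f1' i : f' i <= f' (i + 1) by rewrite -!fE' (lift_floor_le lp').
have f2' (i : int) : f' (i + 1) <= f' i + 1 by rewrite -!fE' (lift_floorS lp').
have [k f0] : exists k : int, f' 0 = f 0 + 2 * k.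
  by have := par 0; move: (f 0) (f' 0) => a b; exists ((b - a) %/ 2)%Z; lia.
have fk i : f' i = f i + 2 * k.
  apply: (@int_step_ind (fun i => f' i = f i + 2 * k) 0 f0) => {}i;
    have := par i; have := par (i + 1);
    have := f1 i; have := f2 i; have := f1' i; have := f2' i;
    move: (f i) (f (i + 1)) (f' i) (f' (i + 1)) => *; lia.
(* At the first arrival of [phi] at [l] the other floor increases too, so [phi'] lands on an integer
   there and both sides are knot values. *)
have cc' l : c' (l + 2 * k) = c l.
  have [i il il1] := lift_first lp l.
  have fi : f i = l by rewrite -fE il intrKfloor.
  have fi1 : f (i - 1) < l.
    by rewrite -(ltr_int R) -fE (le_lt_trans (floor_le _)).
  have e : f (i - 1) + 1 = l by have := f2 (i - 1); rewrite subrK fi; lia.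
  have : Num.floor (phi' (i - 1)) < Num.floor (phi' (i - 1 + 1)).
    by rewrite !fE' !fk subrK fi; lia.
  move=> /(lift_floor_lt lp'); rewrite fE' fk subrK => phi'i.
  have := E i; rewrite il phi'i !zeta_int => ->; congr c'; lia.
exists k; split=> // i.
have := E i; rewrite /zeta fE fE' fk.
have -> : f i + 2 * k + 1 = f i + 1 + 2 * k by lia.
rewrite !cc' => /addrI /mulIf e.
have ne : c (f i + 1) - c (f i) != 0.
  rewrite subr_eq0; have [ev|od] := boolP (2 %| f i)%Z.
    have [+ _] := ac (f i %/ 2)%Z; have -> : 2 * (f i %/ 2)%Z = f i by lia.
    by move=> /lt_eqF; rewrite eq_sym => ->.
  have [_ +] := ac ((f i + 1) %/ 2)%Z; have -> : 2 * ((f i + 1) %/ 2)%Z = f i + 1 by lia.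
  by rewrite addrK => /lt_eqF ->.
by have := e ne; rewrite rmorphD /=; lra.
Qed.

Lemma lift_knots_periodic (R : realType) (N m : nat) (phi c w : int -> R) :
  lift N m phi -> (forall i, w (i + N%:Z) = w i) ->
  (forall i, w i = zeta c (phi i)) -> forall k, c (k + m%:Z) = c k.
Proof.
move=> lp wN wE k; have [_ pN /(_ k) [i ik]] := lp.
have := wE (i + N%:Z); rewrite wN pN ik wE ik zeta_int.
by rewrite -[m%:R]/(m%:Z%:~R) -intrD zeta_int.
Qed.

(* The integer part of the lift counts the changes of direction of w. *)
Lemma dir_count (R : realType) (w : int -> R) : exists n : int -> int,
  (forall i, (2 %| n i)%Z <-> dir w i) /\
  (forall i, n i <= n (i + 1) <= n i + 1).
Proof.
pose d i := `[< dir w i >].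
(* The initial term, 0 or 1, makes parity and direction agree at position 0; each change of
   direction then flips both. *)
have [n [n0 nS]] := int_sum_exists (fun i => (d i != d (i + 1) : nat)%:Z) (~~ d 0 : nat)%:Z.
exists n; split=> i; last by rewrite nS; case: (_ != _); lia.
suff /(_ i) -> : forall i, (2 %| n i)%Z = d i by split=> /asboolP.
apply: (@int_step_ind _ 0) => [|j|j]; first by rewrite n0; case: (d 0).
  by rewrite nS; move: (n j) => a; case: (d j); case: (d (j + 1)) => /=; lia.
by rewrite nS; move: (n j) => a; case: (d j); case: (d (j + 1)) => /=; lia.
Qed.

Lemma periodic_mono_const (R : realType) (w : int -> R) (N : nat) : (0 < N)%N ->
  (forall i, w (i + N%:Z) = w i) -> (forall i, w i <= w (i + 1)) ->
  forall i, w (i + 1) = w i.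
Proof.
move=> N0 wN wS i; apply/eqP; rewrite eq_le wS andbT.
by rewrite -(wN i); apply: (int_mono wS); lia.
Qed.

Lemma monotone_run (R : realType) (f : int -> R) (a b : int) :
  (forall i, a <= i -> i + 1 < b -> f i <= f (i + 1)) -> f (b - 1) < f b ->
  forall i, a <= i -> i < b -> f a <= f i < f b.
Proof.
move=> fS fb i ai ib; apply/andP; split.
  by apply: (@int_mono_itv _ f a (b - 1)) => //; [move=> j aj jb; apply: fS => //; lia|lia].
apply: le_lt_trans fb; apply: (@int_mono_itv _ f a (b - 1)) => //; last by lia.
by move=> j aj jb; apply: fS => //; lia.
Qed.

(** Both sequences advance by 0 or 1 and their difference stays even, so neither can advance without
    the other. *)
Lemma parity_step (a b a' b' u : int) :
  (2 %| b - a)%Z -> (2 %| b' - a')%Z -> a <= a' <= a + 1 -> b <= b' <= b + 1 ->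
  (b = a + u <-> b' = a' + u).
Proof. by move=> *; split; lia. Qed.

Lemma int_mul_unbounded (k K : int) : 0 < K -> exists a : nat, k <= K *+ a.
Proof.
move=> K0; exists (absz k); rewrite -mulr_natr natz.
have [k0|k0] := leP k 0; first by apply: (le_trans k0); rewrite mulr_ge0// ltW.
by rewrite gtz0_abs//; nia.
Qed.

(** The integer part of the lift is the direction count [n]; the knot [c k] is the value at the
    first position where [n] equals [k], and the fractional part is the relative height of [w i]
    between the knots [c (n i)] and [c (n i + 1)]. *)
Lemma lift_exists (R : realType) (N : nat) (w : int -> R) : (0 < N)%N ->
  (forall i, w (i + N%:Z) = w i) -> (exists i, w i != w (i + 1)) ->
  exists L c phi, [/\ (0 < L)%N, lift N (2 * L) phi, alternating c
    & forall i, w i = zeta c (phi i)].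
Proof.
move=> N0 wN [i0 wi0]; have [n [ndir nS]] := dir_count w.
have neqS (i : int) : n i = n (i + 1) -> if (2 %| n i)%Z then w i <= w (i + 1) else w (i + 1) <= w i.
  move=> nn; case: ifPn => [/ndir d|/negP nd].
    by rewrite leNgt; apply/negP => /dir_down.
  by rewrite leNgt; apply/negP => /dir_up /ndir.
have nltS (i : int) : n i < n (i + 1) -> if (2 %| n i)%Z then w i < w (i + 1) else w (i + 1) < w i.
  move=> nn; have /andP[] := nS i; move: nn; move E : (n i) => a; move E' : (n (i + 1)) => b ab _ ba.
  have {ba}ab : b = a + 1 by lia.
  case: ifPn => [a2|a2]; rewrite lt_neqAle.
    apply/andP; split; last first.
      by rewrite leNgt; apply/negP => /dir_down; apply; apply/ndir; rewrite E.
    apply/eqP => /dir_eq [+ _] => /(_ _)/ndir; rewrite E' ab.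
    by rewrite -ndir E => /(_ a2); lia.
  apply/andP; split; last first.
    by rewrite leNgt; apply/negP => /dir_up /ndir; rewrite E; apply/negP.
  apply/eqP => /esym/dir_eq [_ /(_ _)/ndir]; rewrite E -ndir E' ab => H.
  have o : (2 %| a + 1)%Z by lia.
  by have := H o; rewrite (negbTE a2).
have nmono (i j : int) : i <= j -> n i <= n j.
  move=> ij; apply: (@int_up_ind (fun j => n i <= n j) i _ _ j ij) => // l _ il.
  by have := nS l; lia.
have npar (i : int) : (2 %| n (i + N%:Z) - n i)%Z.
  have : (2 %| n (i + N%:Z))%Z = (2 %| n i)%Z.
    by apply/idP/idP; rewrite !ndir => /(dir_periodic i wN).
  by move: (n i) (n _) => a b; have [] := boolP (2 %| a)%Z; lia.
(* [K] counts the changes of direction in one turn around the polygon. *)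
have [K nK] : exists K : int, forall i : int, n (i + N%:Z) = n i + K.
  exists (n N%:Z - n 0).
  apply: (@int_step_ind (fun i => n (i + N%:Z) = n i + (n N%:Z - n 0)) 0) => [|i|i].
  - by rewrite add0r addrC subrK.
  - move=> IH; apply: (parity_step _ (npar i) (npar (i + 1)) (nS i) _).1 => //.
    by rewrite [i + 1 + _]addrAC nS.
  - move=> IH; apply: (parity_step _ (npar i) (npar (i + 1)) (nS i) _).2 => //.
    by rewrite [i + 1 + _]addrAC nS.
have K2 : (2 %| K)%Z.
  by have := npar 0; rewrite nK; move: (n 0) => a; lia.
(* With no change of direction in a turn, [w] would be monotone and periodic, hence constant. *)
have K0 : 0 < K.
  rewrite lt_neqAle; apply/andP; split; last first.
    by have : n 0 <= n (0 + N%:Z); [apply: nmono; lia|rewrite nK lerDl].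
  apply/eqP => K0; have n1 (i : int) : n (i + 1) = n i.
    have : n (i + 1) <= n (i + N%:Z) by apply: nmono; lia.
    by rewrite nK -K0 addr0; have := nS i; lia.
  have nc (i : int) : n i = n 0.
    by apply: (@int_step_ind (fun i => n i = n 0) 0) => // j; rewrite n1.
  have mono (i : int) : if (2 %| n 0)%Z then w i <= w (i + 1) else w (i + 1) <= w i.
    by have := neqS i; rewrite n1 nc; apply.
  case/negP: wi0; apply/eqP/esym; have [e|/negbTE e] := boolP (2 %| n 0)%Z.
    by apply: (@periodic_mono_const _ w N) => // i; have := mono i; rewrite e.
  apply: oppr_inj; apply: (@periodic_mono_const _ (fun i => - w i) N) => // i.
    by rewrite wN.
  by rewrite lerN2; have := mono i; rewrite e.
have nub (k : int) : exists2 i, n i = k & n (i - 1) = k - 1.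
  have [| | |i ki nki] := @int_least (fun i => k <= n i).
  - by move=> i ki; have := nS i; lia.
  - have [a ka] := int_mul_unbounded (k - n 0) K0.
    by exists (0 + a%:Z * N%:Z); rewrite (periodic_mul nK) -lerBlDl.
  - have [a ka] := int_mul_unbounded (n 0 - k + 1) K0.
    exists (- (a%:Z * N%:Z)) => kn.
    have := periodic_mul nK a (- (a%:Z * N%:Z)); rewrite addNr.
    by move: ka kn; move: (K *+ a) (n 0) (n (- _)) => x y z; lia.
  by exists i; have := nS (i - 1); rewrite subrK; lia.
have {}nub (k : int) : {i | n i = k & n (i - 1) = k - 1}.
  by apply: cid2; exact: nub.
pose iota (k : int) := s2val (nub k).
have iotaE (k : int) : n (iota k) = k by exact: (s2valP (nub k)).
have iotaP (k : int) : n (iota k - 1) = k - 1 by exact: (s2valP' (nub k)).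
have iota_ge (k i : int) : (k <= n i) = (iota k <= i).
  apply/idP/idP => [ki|/nmono]; last by rewrite iotaE.
  by rewrite leNgt; apply/negP => ik; have : n i <= n (iota k - 1) by [apply: nmono; lia]; rewrite iotaP; lia.
pose c (k : int) := w (iota k).
have iotaK (k : int) : iota (k + K) = iota k + N%:Z.
  apply/eqP; rewrite eq_le -!iota_ge nK iotaE lexx /=.
  have : k <= n (iota (k + K) - N%:Z).
    by have := nK (iota (k + K) - N%:Z); rewrite subrK iotaE; lia.
  rewrite iota_ge; lia.
have cK (k : int) : c (k + K) = c k by rewrite /c iotaK wN.
(* On a run of constant [n] the sequence is monotone, and the step that ends the run is strict; this
   excludes the far knot and keeps the fractional part below 1. *)
have runs (i : int) : if (2 %| n i)%Z then c (n i) <= w i < c (n i + 1)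
               else c (n i + 1) < w i <= c (n i).
  move E : (n i) => k.
  have ik : iota k <= i by rewrite -iota_ge E.
  have ik1 : i < iota (k + 1) by rewrite ltNge -iota_ge E; lia.
  have nk (j : int) : iota k <= j -> j < iota (k + 1) -> n j = k.
    by rewrite -iota_ge ltNge -iota_ge; lia.
  have last : n (iota (k + 1) - 1) = k by rewrite iotaP addrK.
  have := nltS (iota (k + 1) - 1); rewrite subrK iotaE last => /(_ _) wlast.
  case: ifP wlast => k2 wlast.
    apply: monotone_run ik ik1 => [j jk jk1|]; last by apply: wlast; lia.
    by have := neqS j; rewrite nk ?nk ?k2; [apply| | |..]; lia.
  have negS j : iota k <= j -> j + 1 < iota (k + 1) -> - w j <= - w (j + 1).
    by move=> jk jk1; rewrite lerN2; have := neqS j; rewrite nk ?nk ?k2; [apply| | |..]; lia.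
  have neglast : - w (iota (k + 1) - 1) < - w (iota (k + 1)).
    by rewrite ltrN2; apply: wlast; lia.
  have /andP[] := @monotone_run _ (fun j => - w j) _ _ negS neglast i ik ik1.
  by rewrite lerN2 ltrN2 -!/(c _) => -> ->.
exists (absz (K %/ 2)%Z), c, (fun i => (n i)%:~R + (w i - c (n i)) / (c (n i + 1) - c (n i))).
have frac (i : int) : 0 <= (w i - c (n i)) / (c (n i + 1) - c (n i)) < 1.
  have := runs i; case: ifP => _ /andP[lo hi].
    by rewrite divr_ge0 ?ltr_pdivrMr ?mul1r ?subr_gt0 ?subr_ge0 ?ltrD2r//; lra.
  rewrite -mulrNN -invrN !opprB.
  by rewrite divr_ge0 ?ltr_pdivrMr ?mul1r ?subr_gt0 ?subr_ge0 ?ltrD2l ?ltrN2//; lra.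
split; first lia.
- split=> [i|i|k]; last by exists (iota k); rewrite iotaE /c subrr mul0r addr0.
    have /andP[nn nn1] := nS i; have [nlt|] := ltP (n i) (n (i + 1)).
      have -> : n (i + 1) = n i + 1 by lia.
      have := frac i; have := frac (i + 1).
      have -> : n (i + 1) = n i + 1 by lia.
      by move: (_ / _) (_ / _) => x y; rewrite rmorphD /=; lra.
    move=> nle; have nE : n i = n (i + 1) by lia.
    have := neqS i nE; have := runs i; rewrite -nE lerD2l; case: ifP => _ /andP[lo hi] ww.
      by rewrite ler_pM2r ?invr_gt0 ?subr_gt0 ?lerD2r//; lra.
    by rewrite ler_nM2r ?invr_lt0 ?subr_lt0 ?lerD2r//; lra.
  rewrite wN nK [n i + K + 1]addrAC !cK rmorphD /= addrAC; congr (_ + _ + _).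
  by rewrite -[RHS]/((2 * _)%N%:Z%:~R); congr (_%:~R); lia.
- move=> k; have r1 := runs (iota (2 * k)); have r2 := runs (iota (2 * k - 1)).
  move: r1 r2; rewrite !iotaE; case: ifP => [_|]; last by lia.
  by case: ifP => [|_]; [lia|rewrite subrK; rewrite -!/(c _) => /andP[_ ->] /andP[]].
move=> i; rewrite (@zeta_itv _ _ (n i)); last first.
  by have := frac i; rewrite rmorphD /=; move: (_ / _) => x; lra.
rewrite [(n i)%:~R + _]addrC addrK divfK; first by rewrite addrC subrK.
have := runs i; rewrite subr_eq0; case: ifP => _ /andP[lo hi].
  by rewrite gt_eqF// (le_lt_trans lo).
by rewrite lt_eqF// (lt_le_trans lo).
Qed.

(** * The polygon unrolled to the integers *)

Definition cyc (N : nat) (i : int) : 'I_N.+1 := inord (absz (i %% N.+1%:Z)%Z).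

Definition unroll (R : realType) (N : nat) (w : 'rV[R]_N.+1) (i : int) : R :=
  w 0 (cyc N i).

Lemma cycE (N : nat) (i : int) : (cyc N i)%:Z = (i %% N.+1%:Z)%Z.
Proof.
rewrite /cyc inordK; last by rewrite -ltz_nat gez0_abs ?modz_ge0 ?ltz_pmod.
by rewrite gez0_abs ?modz_ge0.
Qed.

Lemma cyc_ord (N : nat) (i : 'I_N.+1) : cyc N i%:Z = i.
Proof. by apply/val_inj; apply/eqP; rewrite -eqz_nat /= cycE modz_small// ltz_nat ltn_ord. Qed.

Lemma cycP (N : nat) (i : int) : exists k, i = (cyc N i)%:Z + k * N.+1%:Z.
Proof. by exists (i %/ N.+1%:Z)%Z; rewrite cycE addrC -divz_eq. Qed.

Lemma cyc_addN (N : nat) (i : int) : cyc N (i + N.+1%:Z) = cyc N i.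
Proof. by apply/val_inj; apply/eqP; rewrite -eqz_nat /= !cycE modzDr. Qed.

Lemma cyc_eq (N : nat) (i j : int) : (i = j %[mod N.+1%:Z])%Z -> cyc N i = cyc N j.
Proof. by move=> ij; apply/val_inj; apply/eqP; rewrite -eqz_nat /= !cycE ij. Qed.

Lemma cyc_addM (N : nat) (i k : int) : cyc N (i + k * N.+1%:Z) = cyc N i.
Proof. by apply: cyc_eq; rewrite addrC modzMDl. Qed.

Lemma cyc_succ (N : nat) (i : int) : cyc N (i + 1) = ordS (cyc N i).
Proof.
apply/val_inj; apply/eqP; by rewrite -eqz_nat /= -modz_nat intS !cycE modzDmr addrC.
Qed.

Lemma unroll_ord (R : realType) (N : nat) (w : 'rV[R]_N.+1) (i : 'I_N.+1) :
  unroll w i%:Z = w 0 i.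
Proof. by rewrite /unroll cyc_ord. Qed.

Lemma unroll_periodic (R : realType) (N : nat) (w : 'rV[R]_N.+1) (i : int) :
  unroll w (i + N.+1%:Z) = unroll w i.
Proof. by rewrite /unroll cyc_addN. Qed.

(** Each first arrival at an even integer raises the floor of half the lift by one, nothing else
    does, and in a turn this quantity grows by [L]; the count telescopes. *)
Lemma lift_count_even (R : realType) (N L : nat) (phi : int -> R) (P : pred 'I_N.+1) :
  lift N.+1 (2 * L) phi ->
  (forall i, P i <-> phi (i%:Z - 1) < phi i%:Z /\ exists k : int, phi i%:Z = (2 * k)%:~R) ->
  #|P| = L.
Proof.
move=> lp PE; pose f (i : int) := Num.floor (phi i); pose e i := (f i %/ 2)%Z.
have PeE (i : 'I_N.+1) : (P i : nat)%:Z = e i - e (i%:Z - 1).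
  have := lift_floor_le lp (i%:Z - 1); have := lift_floorS lp (i%:Z - 1).
  have := @lift_floor_lt _ _ _ _ lp (i%:Z - 1); rewrite subrK /e -/(f i) -/(f (i%:Z - 1)).
  have [fE _ _ _|ne] := eqVneq (f i) (f (i%:Z - 1)).
    rewrite fE subrr; case: (boolP (P i)) => // /PE [lt [k ik]].
    have : f (i%:Z - 1) < 2 * k.
      by rewrite -(ltr_int R) -ik (le_lt_trans (floor_le _)).
    by rewrite -fE /f ik intrKfloor ltxx.
  move=> + le1 le2; have fE : f i = f (i%:Z - 1) + 1 by lia.
  move=> /(_ _) phiE; have {}phiE : phi i = (f i)%:~R by rewrite fE; apply: phiE; lia.
  have lt : phi (i%:Z - 1) < phi i.
    by rewrite phiE fE; case/andP: (floor_itv (phi (i%:Z - 1))).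
  have -> : P i = (2 %| f i)%Z.
    apply/idP/idP => [/PE [_ [k]]|f2].
      by rewrite phiE => /eqP; rewrite eqr_int => /eqP ->; lia.
    by apply/PE; split=> //; exists (f i %/ 2)%Z; rewrite phiE; congr (_%:~R); lia.
  by rewrite fE; move: (f _) => a; case: (boolP (2 %| a + 1)%Z) => /=; lia.
have sumE n : (n <= N.+1)%N ->
    (\sum_(i < n) (P (inord i) : nat))%N%:Z = e (n%:Z - 1) - e (-1).
  elim: n => [|n IH] nN; first by rewrite big_ord0 sub0r subrr.
  rewrite big_ord_recr /= PoszD IH ?(ltnW nN)// PeE inordK//.
  have -> : n.+1%:Z - 1 = n by lia.
  by rewrite addrC subrKA.
rewrite -sum1_card big_mkcond /=.
have -> : \sum_(i < N.+1) (if i \in P then 1 else 0)%N = \sum_(i < N.+1) (P (inord i) : nat)%N.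
  by apply: eq_bigr => i _; rewrite inord_val -topredE /=; case: (P i).
apply/eqP; rewrite -eqz_nat sumE//.
have -> : N.+1%:Z - 1 = -1 + N.+1%:Z by lia.
have [_ pN _] := lp.
have -> : e (-1 + N.+1%:Z) = e (-1) + L; last by rewrite addrAC subrr add0r.
rewrite /e /f pN -[(2 * L)%N%:R]/((2 * L)%N%:Z%:~R) floorDrz ?intr_int// intrKfloor.
by move: (Num.floor _) => a; lia.
Qed.

(** * Merging a free circular sequence with the integers *)

(* phi is the sorted union of psi and the integers: the i-th term of the union
   is [min_j max(psi j, i - j)]. *)
Definition merge (R : realType) (psi : int -> R) (i : int) : R :=
  xget 0 [set v : R | forall x, v <= x <-> exists2 j : int, psi j <= x & (i - j)%:~R <= x].

Definition free_seq (R : realType) (n m : nat) (psi : int -> R) : Prop :=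
  (forall i, psi i <= psi (i + 1)) /\ (forall i, psi (i + n%:Z) = psi i + m%:R).

Lemma ler_eqP (R : realType) (a b : R) : (forall x, a <= x <-> b <= x) -> a = b.
Proof.
by move=> H; apply/eqP; rewrite eq_le (H b).2 ?(H a).1.
Qed.

Lemma mulrn_unbounded (R : realType) (x y : R) : 0 < y -> exists a : nat, x <= y *+ a.
Proof.
move=> y0; exists (Num.bound `|x / y|); rewrite -mulr_natr mulrC -ler_pdivrMr//.
by apply: le_trans (ler_norm _) _; exact/ltW/archi_boundP/normr_ge0.
Qed.

Lemma drift_unbounded (R : realType) (f : int -> R) (N : nat) (y : R) : 0 < y ->
  (forall i, f (i + N%:Z) = f i + y) ->
  forall x, (exists j, x <= f j) /\ (exists j, f j <= x).
Proof.
move=> y0 fN x; split.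
  have [a xa] := mulrn_unbounded (x - f 0) y0.
  by exists (0 + a%:Z * N%:Z); rewrite (periodic_mul fN) -lerBlDl.
have [a xa] := mulrn_unbounded (f 0 - x) y0; exists (- (a%:Z * N%:Z)).
by have := periodic_mul fN a (- (a%:Z * N%:Z)); rewrite addNr; lra.
Qed.

(** [psi j] does not decrease in [j] and [i - j] decreases, so the minimum of their maximum sits at
    the crossing: at the first [j] with [i - j <= psi j] or just before it. For a free sequence the
    default value 0 in [merge] is therefore never taken by default. *)
Lemma mergeP (R : realType) (n m : nat) (psi : int -> R) : (0 < n)%N ->
  free_seq n m psi -> forall i x,
  merge psi i <= x <-> exists2 j : int, psi j <= x & (i - j)%:~R <= x.
Proof.
move=> n0 [psiS psiN] i x; have psi_mono := int_mono psiS.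
rewrite /merge; case: xgetP => [v _ /(_ x)//|none]; exfalso.
have [| | |j ij /negP nij] := @int_least (fun j => (i - j)%:~R <= psi j).
- move=> j ij; apply: le_trans (le_trans ij (psiS j)); rewrite ler_int; lia.
- exists (absz (i - Num.floor (psi 0))%R)%:Z; apply: le_trans (psi_mono 0 _ _); last by [].
  by apply: le_trans (floor_le _); rewrite ler_int; move: (Num.floor _) => a; lia.
- exists (- (absz (Num.floor (psi 0) - i + 1)%R)%:Z); apply/negP; rewrite -ltNge.
  apply: le_lt_trans (psi_mono _ 0 _) _; first lia.
  case/andP: (floor_itv (psi 0)) => _ /lt_le_trans; apply; rewrite ler_int.
  by move: (Num.floor _) => a; lia.
rewrite -ltNge in nij.
apply: (none (Num.min (psi j) (i - (j - 1))%:~R)) => y; rewrite ge_min.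
split=> [/orP[jy|jy]|[l ly ily]]; first by exists j => //; apply: le_trans jy.
  by exists (j - 1) => //; apply: ltW; apply: lt_le_trans jy.
have [jl|lj] := leP j l; first by rewrite (le_trans (psi_mono _ _ jl) ly).
by rewrite orbC (le_trans _ ily)//= ler_int; lia.
Qed.

Lemma merge_lift (R : realType) (n m : nat) (psi : int -> R) : (0 < n)%N -> (0 < m)%N ->
  free_seq n m psi -> lift (n + m) m (merge psi).
Proof.
move=> n0 m0 fr; have mP := mergeP n0 fr; have [psiS psiN] := fr.
have m0' : 0 < m%:R :> R by rewrite ltr0n.
have psi_mono := int_mono psiS.
have mm i j : i <= j -> merge psi i <= merge psi j.
  move=> ij; have [l lj il] := (mP j (merge psi j)).1 (lexx _).
  by apply/mP; exists l => //; apply: le_trans il; rewrite ler_int; lia.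
split=> [i|i|k]; first by apply: mm; lia.
  apply: ler_eqP => x; rewrite -lerBrDr; split=> /mP[j jx ijx]; apply/mP.
    exists (j - n%:Z).
      by rewrite lerBrDr -psiN subrK.
    rewrite lerBrDr (le_trans _ ijx)// -[m%:R]/(m%:Z%:~R) -intrD ler_int; lia.
  exists (j + n%:Z); first by rewrite psiN -lerBrDr.
  by move: ijx; rewrite lerBrDr => /(le_trans _); apply; rewrite -[m%:R]/(m%:Z%:~R) -intrD ler_int; lia.
have [| | |j kj /negP njk] := @int_least (fun j => k%:~R < psi j).
- by move=> j kj; apply: lt_le_trans kj _.
- have [j kj] := (drift_unbounded m0' psiN (k%:~R + 1)).1; exists j; lra.
- have [j kj] := (drift_unbounded m0' psiN k%:~R).2; exists j; lra.
rewrite -leNgt in njk.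
(* The terms of [psi] up to index [j - 1] are at most [k] and those from [j] on exceed it, so in the
   union the last term that is at most [k] has index [(j - 1) + k]. *)
exists (j - 1 + k); apply/eqP; rewrite eq_le; apply/andP; split.
  by apply/mP; exists (j - 1) => //; rewrite ler_int; lia.
have [l lx] := (mP (j - 1 + k) _).1 (lexx _); move: lx.
set v := merge psi _ => lv jlv; rewrite leNgt; apply/negP => vk.
have : (j - 1 + k - l)%:~R < (k%:~R : R) by exact: le_lt_trans vk.
rewrite ltr_int => jl; have : psi j <= psi l by apply: psi_mono; lia.
by move=> /(lt_le_trans kj); rewrite ltNge (le_trans lv (ltW vk)).
Qed.

(** Translating [psi] is matched by reindexing the integers, since the maximum of [psi (j + 1) + 1]
    and [i - j] is one more than that of [psi (j + 1)] and [i - (j + 1)]. This is how translation of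
    lifts by 1 acts on free sequences. *)
Lemma merge_shift (R : realType) (n m : nat) (psi : int -> R) : (0 < n)%N ->
  free_seq n m psi ->
  forall i, merge (fun j => psi (j + 1) + 1) i = merge psi i + 1.
Proof.
move=> n0 fr i; have fr' : free_seq n m (fun j => psi (j + 1) + 1).
  by case: fr => p1 p2; split=> j; rewrite ?lerD2r// [j + n + 1]addrAC p2 addrAC.
apply: ler_eqP => x; rewrite -lerBrDr; split.
  move=> /(mergeP n0 fr')[j jx ijx]; apply/(mergeP n0 fr).
  exists (j + 1); first by rewrite lerBrDr.
  by rewrite lerBrDr (le_trans _ ijx)// -[1]/(1%:~R) -intrD ler_int; lia.
move=> /(mergeP n0 fr)[j jx ijx]; apply/(mergeP n0 fr').
exists (j - 1); first by rewrite subrK -lerBrDr.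
by move: ijx; rewrite lerBrDr => /(le_trans _); apply; rewrite -[1]/(1%:~R) -intrD ler_int; lia.
Qed.

(** The terms of the union that are at most [x] are the integers up to [floor x] and the terms of
    [psi] up to [x]; counting them recovers [psi] from [merge psi]. *)
Lemma merge_inv (R : realType) (n m : nat) (psi : int -> R) : (0 < n)%N ->
  free_seq n m psi ->
  forall j x, psi j <= x <-> merge psi (j + Num.floor x) <= x.
Proof.
move=> n0 fr j x; split=> [jx|/(mergeP n0 fr)[l lx]].
  apply/(mergeP n0 fr); exists j => //.
  by have -> : j + Num.floor x - j = Num.floor x by [lia]; exact: floor_le.
rewrite -floor_ge_int => jl; apply: le_trans lx; apply: int_mono; first by case: fr.
by move: jl; move: (Num.floor x) => a; lia.
Qed.

Lemma merge_inj (R : realType) (n m : nat) (psi psi' : int -> R) : (0 < n)%N ->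
  free_seq n m psi -> free_seq n m psi' ->
  (forall i, merge psi i = merge psi' i) -> forall j, psi j = psi' j.
Proof.
move=> n0 fr fr' E j; apply: ler_eqP => x.
by rewrite (merge_inv n0 fr) (merge_inv n0 fr') E.
Qed.

Lemma merge_nonexpansive (R : realType) (n m : nat) (psi psi' : int -> R) (e : R) :
  (0 < n)%N -> free_seq n m psi -> free_seq n m psi' -> 0 <= e ->
  (forall j, psi' j <= psi j + e) -> forall i, merge psi' i <= merge psi i + e.
Proof.
move=> n0 fr fr' e0 pe i.
have [j jx ijx] := (mergeP n0 fr i (merge psi i)).1 (lexx _).
apply/(mergeP n0 fr'); exists j; first by apply: le_trans (pe j) _; rewrite lerD2r.
by apply: le_trans ijx _; rewrite lerDl.
Qed.

(** The equivalence of [merge_inv] dictates [psi]: its [j]-th term has to be the least [x] with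
    [phi (j + floor x) <= x]. *)
Lemma merge_surj (R : realType) (n m : nat) (phi : int -> R) : (0 < n)%N ->
  lift (n + m) m phi ->
  exists2 psi, free_seq n m psi & forall i, merge psi i = phi i.
Proof.
move=> n0 lp; have phi_mono := lift_mono lp; have [_ phiN _] := lp.
have stepQ j k : phi (j + k) < (k + 1)%:~R -> phi (j + (k + 1)) <= (k + 1)%:~R.
  by move=> jk; have := lift_skip lp jk; rewrite addrA.
(* The slope of [phi] is [m / (n + m)], which is less than 1, so [k + 1 - phi (j + k)] gains [n]
   every [n + m] steps and changes sign. *)
have defect (j k : int) : (k + (n + m)%N%:Z)%:~R + 1 - phi (j + (k + (n + m)%N%:Z)) =
    k%:~R + 1 - phi (j + k) + n%:R.
  rewrite addrA phiN rmorphD /= -[(n + m)%N%:~R]/((n + m)%:R) natrD; lra.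
have n0' : 0 < n%:R :> R by rewrite ltr0n.
have ex j : exists v : R, forall x, v <= x <-> phi (j + Num.floor x) <= x.
  have [| | |k jk /negP njk] := @int_least (fun k => phi (j + k) < (k + 1)%:~R).
  - by move=> k /stepQ /le_lt_trans; apply; rewrite ltr_int; lia.
  - have [k] := (drift_unbounded n0' (defect j) 1).1; exists k; rewrite rmorphD /=; lra.
  - have [k] := (drift_unbounded n0' (defect j) 0).2; exists k; apply/negP.
    by rewrite -leNgt rmorphD /=; lra.
  rewrite -leNgt in njk.
  (* In the unit intervals beyond the [k]-th the condition on [x] always holds, before it never, and
     in the [k]-th it reads [phi (j + k) <= x]. *)
  exists (Num.max k%:~R (phi (j + k))) => x; rewrite ge_max -floor_ge_int.
  move: (floor_itv x); move: (Num.floor x : int) => l /andP[lx xl].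
  split=> [/andP[kl jkx]|jlx].
    have [->//|ne] := eqVneq l k; apply: le_trans lx.
    have -> : l = l - 1 + 1 by rewrite subrK.
    have : k <= l - 1 by lia.
    move: (l - 1); apply: int_up_ind; first exact: stepQ.
    by move=> i _ /le_lt_trans H; apply: stepQ; apply: H; rewrite ltr_int; lia.
  have kl : k <= l.
    rewrite leNgt; apply/negP => lk; have : phi (j + (k - 1)) < (k - 1 + 1)%:~R.
      have : l <= k - 1 by lia.
      move: (k - 1); apply: int_up_ind; first exact: le_lt_trans xl.
      by move=> i _ /stepQ /le_lt_trans; apply; rewrite ltr_int; lia.
    by rewrite ltNge njk.
  by rewrite kl (le_trans _ jlx)//; apply: phi_mono; lia.
pose psi j := sval (cid (ex j)).
have psiP j x : psi j <= x <-> phi (j + Num.floor x) <= x by exact: (svalP (cid (ex j))).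
have fr : free_seq n m psi.
  split=> j.
    by apply/psiP; have := (psiP (j + 1) _).1 (lexx _); apply: le_trans; apply: phi_mono; lia.
  apply: ler_eqP => x; rewrite psiP -lerBrDr psiP.
  have -> : Num.floor (x - m%:R) = Num.floor x - m%:Z.
    by rewrite -[m%:R]/(m%:Z%:~R) -intrN floorDrz ?intr_int// intrKfloor.
  rewrite lerBrDr -phiN; suff -> : j + n%:Z + Num.floor x =
    j + (Num.floor x - m%:Z) + (n + m)%N%:Z by [].
  by move: (Num.floor x) => a; lia.
exists psi => // i; apply: ler_eqP => x; split.
  move=> /(mergeP n0 fr)[j /psiP jx]; rewrite -floor_ge_int => ij.
  by apply: le_trans jx; apply: phi_mono; move: ij; move: (Num.floor x) => a; lia.
move=> ix; apply/(mergeP n0 fr); exists (i - Num.floor x).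
  by apply/psiP; rewrite subrK.
by rewrite opprB addrC subrK; exact: floor_le.
Qed.

Lemma periodic_cyc (T : Type) (N : nat) (f : int -> T) :
  (forall i, f (i + N.+1%:Z) = f i) -> forall i, f (cyc N i) = f i.
Proof.
move=> fN i; have [k iE] := cycP N i.
suff : f ((cyc N i)%:Z + k * N.+1%:Z) = f (cyc N i) by rewrite -iE.
apply: (@int_step_ind (fun k => f ((cyc N i)%:Z + k * N.+1%:Z) = f (cyc N i)) 0).
- by rewrite mul0r addr0.
- by move=> l; rewrite mulrDl mul1r addrA fN.
- by move=> l; rewrite mulrDl mul1r addrA fN.
Qed.

Definition rot (R : realType) (n : nat) (y : 'rV[R]_n.+1) : 'rV[R]_n.+1 :=
  \row_j y 0 (ordS j).

(* A free sequence of slope [m / (n + 1)] and mean [c0] is recorded by its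
   deviation [y] from the arithmetic progression; [dev_simplex] is the simplex
   of admissible deviations. *)
Definition base_seq (R : realType) (n m : nat) (y : 'rV[R]_n.+1) (c0 : R) (j : int) : R :=
  m%:R / n.+1%:R * j%:~R + c0 + unroll y j.

Definition dev_simplex (R : realType) (n m : nat) : set 'rV[R]_n.+1 :=
  [set y | \sum_j y 0 j = 0 /\ forall j, y 0 j - y 0 (ordS j) <= m%:R / n.+1%:R].

Definition dev_lift (R : realType) (n m : nat) (y : 'rV[R]_n.+1) (c0 : R) : int -> R :=
  merge (base_seq m y c0).

Lemma unroll_rot (R : realType) (n : nat) (y : 'rV[R]_n.+1) (j : int) :
  unroll (rot y) j = unroll y (j + 1).
Proof. by rewrite /unroll mxE cyc_succ. Qed.

Lemma base_seq_free (R : realType) (n m : nat) (y : 'rV[R]_n.+1) (c0 : R) :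
  dev_simplex m y -> free_seq n.+1 m (base_seq m y c0).
Proof.
move=> [_ yS]; split=> j; rewrite /base_seq.
  have := yS (cyc n j); rewrite -cyc_succ -!/(unroll _ _) intrD mulrDr mulr1.
  by move: (m%:R / n.+1%:R) => q; lra.
rewrite unroll_periodic intrD -[n.+1%:~R]/(n.+1%:R) mulrDr divfK ?pnatr_eq0//.
by move: (m%:R / n.+1%:R) => q; lra.
Qed.

Lemma dev_lift_lift (R : realType) (n m : nat) (y : 'rV[R]_n.+1) (c0 : R) :
  (0 < m)%N -> dev_simplex m y -> lift (n.+1 + m) m (dev_lift m y c0).
Proof. by move=> m0 Dy; apply: merge_lift => //; exact: base_seq_free. Qed.

(** This is [merge_shift] in the coordinates deviation and mean: moving the index by one rotates the
    deviation and adds the slope [m / (n + 1)], and the translation adds 1 to the mean. *)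
Lemma dev_lift_rot (R : realType) (n m : nat) (y : 'rV[R]_n.+1) (c0 : R) (i : int) :
  dev_simplex m y ->
  dev_lift m (rot y) (c0 + (m%:R / n.+1%:R + 1)) i = dev_lift m y c0 i + 1.
Proof.
move=> Dy; rewrite -(@merge_shift _ n.+1 m)//; last exact: base_seq_free.
congr (merge _ _); apply/funext => j.
rewrite /base_seq unroll_rot intrD mulrDr mulr1.
by move: (m%:R / n.+1%:R) => q; lra.
Qed.

(** The merge determines the free sequence; its mean is recovered by summation because deviations
    have sum 0. *)
Lemma dev_lift_inj (R : realType) (n m : nat) (y y' : 'rV[R]_n.+1) (c0 c0' : R) :
  dev_simplex m y -> dev_simplex m y' ->
  (forall i, dev_lift m y c0 i = dev_lift m y' c0' i) -> y = y' /\ c0 = c0'.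
Proof.
move=> Dy Dy' E.
have {}E j : c0 + unroll y j = c0' + unroll y' j.
  have := merge_inj (ltn0Sn n) (base_seq_free c0 Dy) (base_seq_free c0' Dy') E j.
  by rewrite /base_seq -!addrA => /addrI.
have cc : c0 = c0'.
  have : \sum_(j < n.+1) (c0 + y 0 j) = \sum_(j < n.+1) (c0' + y' 0 j).
    by apply: eq_bigr => j _; have := E j; rewrite !unroll_ord.
  rewrite !big_split /= Dy.1 Dy'.1 !addr0 !sumr_const card_ord.
  by move=> /eqP; rewrite eqrMn2r => /eqP.
by split=> //; apply/rowP => j; have := E j; rewrite !unroll_ord cc => /addrI.
Qed.

Lemma dev_lift_surj (R : realType) (n m : nat) (phi : int -> R) :
  lift (n.+1 + m) m phi ->
  exists (y : 'rV[R]_n.+1) c0, dev_simplex m y /\ forall i, dev_lift m y c0 i = phi i.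
Proof.
move=> /(merge_surj (ltn0Sn n)) [psi [pS pN] pE].
have [q qE] : exists q : R, q = m%:R / n.+1%:R by exists (m%:R / n.+1%:R).
pose f (j : int) := psi j - q * j%:~R.
have fN j : f (j + n.+1%:Z) = f j.
  rewrite /f pN qE intrD -[n.+1%:~R]/(n.+1%:R) mulrDr divfK ?pnatr_eq0//.
  by rewrite -qE; lra.
pose c0 := (\sum_(j < n.+1) f j) / n.+1%:R.
have c0E : c0 *+ n.+1 = \sum_(j < n.+1) f j.
  by rewrite -[LHS]mulr_natr divfK ?pnatr_eq0.
pose y : 'rV[R]_n.+1 := \row_j (f j - c0).
have yE j : unroll y j = f j - c0 by rewrite /unroll mxE (periodic_cyc fN).
exists y, c0; split.
  split=> [|j].
    under eq_bigr do rewrite mxE.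
    by rewrite big_split /= sumr_const card_ord mulNrn c0E subrr.
  rewrite -[j]cyc_ord -cyc_succ -!/(unroll _ _) !yE /f intrD mulrDr mulr1 -qE.
  by have := pS j; lra.
move=> i; rewrite -pE; congr (merge _ _); apply/funext => j.
by rewrite /base_seq yE /f -qE; lra.
Qed.

(** Merging does not expand distances; one [e] accounts for the mean and one for the deviation. *)
Lemma dev_lift_dist (R : realType) (n m : nat) (y y' : 'rV[R]_n.+1) (c0 c0' e : R) (i : int) :
  dev_simplex m y -> dev_simplex m y' ->
  `|c0 - c0'| <= e -> (forall j, `|y 0 j - y' 0 j| <= e) ->
  `|dev_lift m y c0 i - dev_lift m y' c0' i| <= e + e.
Proof.
have key (x x' : 'rV[R]_n.+1) (a a' : R) : 0 <= e -> dev_simplex m x -> dev_simplex m x' ->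
    `|a - a'| <= e -> (forall j, `|x 0 j - x' 0 j| <= e) ->
    dev_lift m x' a' i <= dev_lift m x a i + (e + e).
  move=> e0 Dx Dx' ae xe; apply: (merge_nonexpansive (ltn0Sn n) (base_seq_free a Dx)
    (base_seq_free a' Dx')); first lra.
  move=> j; rewrite /base_seq; have := xe (cyc n j); rewrite -!/(unroll _ _).
  move: ae; rewrite !ler_distl => /andP[h1 h2] /andP[h3 h4].
  by move: (_ / _ * _) => s; lra.
move=> Dy Dy' ce ye; have e0 : 0 <= e by exact: le_trans ce.
rewrite ler_distl; apply/andP; split; first by have := key y y' c0 c0' e0 Dy Dy' ce ye; lra.
apply: key => //; first by rewrite distrC.
by move=> j; rewrite distrC.
Qed.

(** * An isotopy of the simplex from the identity to the squared rotation *)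

(** An asymmetric norm on all rows: the cyclic differences define the simplex, and the sum, which
    vanishes on the simplex, makes the gauge definite. On the hyperplane of sum 0 the ball of radius
    [m / (n + 1)] is [dev_simplex]. *)
Definition gauge (R : realType) (n : nat) (y : 'rV[R]_n.+1) : R :=
  \big[Num.max/`|\sum_j y 0 j|]_j (y 0 j - y 0 (ordS j)).

Lemma gauge_leP (R : realType) (n : nat) (y : 'rV[R]_n.+1) (r : R) :
  gauge y <= r <-> `|\sum_j y 0 j| <= r /\ forall j, y 0 j - y 0 (ordS j) <= r.
Proof.
split=> [/bigmax_leP[h1 h2]|[h1 h2]]; first by split=> // j; exact: h2.
by apply/bigmax_leP; split=> // j _; exact: h2.
Qed.

Lemma gauge_ge0 (R : realType) (n : nat) (y : 'rV[R]_n.+1) : 0 <= gauge y.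
Proof. by have /gauge_leP[+ _] := lexx (gauge y); exact: le_trans. Qed.

Lemma gaugeZ (R : realType) (n : nat) (a : R) (y : 'rV[R]_n.+1) : 0 <= a ->
  gauge (a *: y) = a * gauge y.
Proof.
move=> a0; have S : \sum_j (a *: y) 0 j = a * \sum_j y 0 j.
  by rewrite mulr_sumr; apply: eq_bigr => j _; rewrite mxE.
move: a0; rewrite le_eqVlt => /orP[/eqP a0|a0].
  rewrite -{}a0 in S *; rewrite mul0r in S; apply/eqP.
  rewrite mul0r eq_le gauge_ge0 andbT.
  by apply/gauge_leP; rewrite S normr0; split=> // j; rewrite !mxE !mul0r subrr.
apply: ler_eqP => x; rewrite -ler_pdivlMl// !gauge_leP S normrM gtr0_norm//.
rewrite ler_pdivlMl//; split=> -[h1 h2]; split=> // j; have := h2 j.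
  by rewrite !mxE -mulrBr ler_pdivlMl.
by rewrite !mxE -mulrBr ler_pdivlMl.
Qed.

Lemma sum_rot (V : nmodType) (n : nat) (f : 'I_n -> V) : \sum_j f (ordS j) = \sum_j f j.
Proof. by rewrite [RHS](reindex_inj (@ordS_inj n)). Qed.

Lemma gauge_rot (R : realType) (n : nat) (y : 'rV[R]_n.+1) : gauge (rot y) = gauge y.
Proof.
have S : \sum_j (rot y) 0 j = \sum_j y 0 j.
  by under eq_bigr do rewrite mxE; exact: (sum_rot (fun j => y 0 j)).
apply: ler_eqP => x; rewrite !gauge_leP S.
split=> -[h1 h2]; split=> // j; last by rewrite !mxE; exact: h2.
by have := h2 (ord_pred j); rewrite !mxE !ord_predK.
Qed.

(** The gauge bounds differences in one direction only, so the converse bounds come from walking on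
    around the cycle, at most [n + 1] steps. With [g] the gauge, averaging gives
    [(n + 1) |y j| <= g + (n + 1)^2 g], and dividing leaves at most [(n + 2) g]. *)
Lemma gauge_bound (R : realType) (n : nat) (y : 'rV[R]_n.+1) (j : 'I_n.+1) :
  `|y 0 j| <= n.+2%:R * gauge y.
Proof.
have [yS yD] := (gauge_leP y _).1 (lexx (gauge y)); set g := gauge y in yS yD *.
have g0 : 0 <= g := gauge_ge0 y.
have step (k : nat) (i : int) : unroll y i - unroll y (i + k%:Z) <= k%:R * g.
  elim: k => [|k IH]; first by rewrite addr0 subrr mul0r.
  have := yD (cyc n (i + k%:Z)); rewrite -cyc_succ -!/(unroll _ _).
  have -> : i + k%:Z + 1 = i + k.+1%:Z by lia.
  by rewrite -natr1 mulrDl mul1r; lra.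
have diff (a b : 'I_n.+1) : y 0 a - y 0 b <= n.+1%:R * g.
  pose k := if (a <= b)%N then (b - a)%N else (b + n.+1 - a)%N.
  have kn : (k <= n.+1)%N by rewrite /k; case: ifP; have := ltn_ord a; have := ltn_ord b; lia.
  have -> : y 0 b = unroll y (a%:Z + k%:Z).
    rewrite /k; case: ifP => ab; first by rewrite -PoszD subnKC// unroll_ord.
    have -> : a%:Z + (b + n.+1 - a)%N%:Z = b%:Z + n.+1%:Z by have := ltn_ord a; lia.
    by rewrite unroll_periodic unroll_ord.
  rewrite -unroll_ord (le_trans (step k _))// ler_wpM2r// ler_nat//.
have E : n.+1%:R * y 0 j = \sum_i y 0 i + \sum_(i < n.+1) (y 0 j - y 0 i).
  by rewrite sumrB sumr_const card_ord addrC subrK mulr_natl.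
have B : `|n.+1%:R * y 0 j| <= g + n.+1%:R * (n.+1%:R * g).
  rewrite E (le_trans (ler_normD _ _))// lerD// (le_trans (ler_norm_sum _ _ _))//.
  rewrite mulr_natl -[in leRHS](card_ord n.+1) -sumr_const; apply: ler_sum => i _.
  by rewrite card_ord ler_norml diff andbT lerNl opprB diff.
have n1 : 1 <= n.+1%:R :> R by rewrite ler1n.
move: B; rewrite normrM ger0_norm ?ler0n// -[n.+2]add1n natrD => B.
rewrite -(ler_pM2l (lt_le_trans ltr01 n1)) (le_trans B)//.
by move: (n.+1%:R) n1 => x x1; nra.
Qed.

Lemma gauge_eq0 (R : realType) (n : nat) (y : 'rV[R]_n.+1) : gauge y = 0 -> y = 0.
Proof.
move=> y0; apply/rowP => j; rewrite mxE; apply/eqP; rewrite -normr_le0.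
by rewrite (le_trans (gauge_bound y j))// y0 mulr0.
Qed.

Lemma gauge0 (R : realType) (n : nat) : gauge (0 : 'rV[R]_n.+1) = 0.
Proof. by have := @gaugeZ R n 0 0 (lexx 0); rewrite scale0r mul0r. Qed.

Lemma gauge_gt0 (R : realType) (n : nat) (y : 'rV[R]_n.+1) : y != 0 -> 0 < gauge y.
Proof.
move=> y0; rewrite lt_neqAle gauge_ge0 andbT eq_sym.
by apply: contraNN y0 => /eqP/gauge_eq0/eqP.
Qed.

Lemma dev_simplexE (R : realType) (n m : nat) (y : 'rV[R]_n.+1) :
  dev_simplex m y <-> \sum_j y 0 j = 0 /\ gauge y <= m%:R / n.+1%:R.
Proof.
rewrite gauge_leP; split=> [[h1 h2]|[h1 [_ h2]]]; split=> //; split=> //.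
by rewrite h1 normr0 divr_ge0.
Qed.

(** Rescaling [f y] to the gauge of [y] turns an invertible linear map into a bijection that
    preserves every gauge ball, hence also the simplex if the map preserves the sum of the
    coordinates. *)
Definition radial (R : realType) (n : nat) (f : 'rV[R]_n.+1 -> 'rV[R]_n.+1)
  (y : 'rV[R]_n.+1) : 'rV[R]_n.+1 := (gauge y / gauge (f y)) *: f y.

Lemma gauge_radial (R : realType) (n : nat) (f : 'rV[R]_n.+1 -> 'rV[R]_n.+1) (y : 'rV[R]_n.+1) :
  (f y = 0 -> y = 0) -> gauge (radial f y) = gauge y.
Proof.
move=> f0; rewrite /radial gaugeZ ?divr_ge0 ?gauge_ge0//.
have [fy|fy] := eqVneq (gauge (f y)) 0; last by rewrite divfK.
by rewrite fy mulr0 (f0 (gauge_eq0 fy)) gauge0.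
Qed.

Lemma radialK (R : realType) (n : nat) (f f' : 'rV[R]_n.+1 -> 'rV[R]_n.+1) :
  (forall a y, f' (a *: y) = a *: f' y) -> cancel f f' -> cancel (radial f) (radial f').
Proof.
move=> f'Z fK y; have f'0 : f' 0 = 0 by have := f'Z 0 0; rewrite !scale0r.
have f0 : f y = 0 -> y = 0 by move=> fy; rewrite -(fK y) fy f'0.
have [->|y0] := eqVneq y 0.
  by rewrite /radial gauge0 mul0r scale0r gauge0 mul0r scale0r.
rewrite {1}/radial gauge_radial//.
rewrite /radial f'Z fK; set s := gauge y / gauge (f y).
have gy := gauge_gt0 y0; have s0 : 0 < s.
  rewrite divr_gt0// gauge_gt0//; apply/eqP => fy.
  by move: y0; rewrite (f0 fy) eqxx.
rewrite gaugeZ ?ltW// scalerA.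
have -> : gauge y / (s * gauge y) * s = 1 by field; rewrite !gt_eqF.
by rewrite scale1r.
Qed.

(** For odd [n], up to scale, the coordinate along the eigenvector of [rot] with eigenvalue -1. *)
Definition alt_sum (R : realType) (n : nat) (y : 'rV[R]_n.+1) : R :=
  \sum_(j < n.+1) (-1) ^+ j * y 0 j.

(* [rot] has the eigenvalue -1 when n + 1 is even; the reflection in the
   corresponding eigenvector is then the involution to which [rot] is joined
   by a segment of invertible maps. *)
Definition alt_reflect (R : realType) (n : nat) (y : 'rV[R]_n.+1) : 'rV[R]_n.+1 :=
  if odd n then y - (2 / n.+1%:R * alt_sum y) *: \row_(j < n.+1) (-1) ^+ j else y.

Definition rot_path (R : realType) (n : nat) (t : R) (y : 'rV[R]_n.+1) : 'rV[R]_n.+1 :=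
  (1 - t) *: rot y + t *: alt_reflect y.

Lemma sign_ordS (R : realType) (n : nat) (j : 'I_n.+1) : odd n ->
  (-1) ^+ ordS j = - (-1) ^+ j :> R.
Proof.
move=> on; rewrite /= -[RHS]mulN1r -exprS -[LHS]signr_odd -[RHS]signr_odd; congr (_ ^+ _).
by rewrite odd_mod//= on.
Qed.

Lemma alt_sum_rot (R : realType) (n : nat) (y : 'rV[R]_n.+1) : odd n ->
  alt_sum (rot y) = - alt_sum y.
Proof.
move=> on; rewrite /alt_sum -[in RHS](sum_rot (fun j : 'I_n.+1 => (-1) ^+ j * y 0 j)) -sumrN.
by apply: eq_bigr => j _; rewrite mxE sign_ordS// mulNr opprK.
Qed.

Lemma sum_sign (R : realType) (n : nat) : odd n -> \sum_(j < n.+1) (-1) ^+ j = 0 :> R.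
Proof.
move=> on; have E : \sum_(j < n.+1) (-1) ^+ j = - \sum_(j < n.+1) (-1) ^+ j :> R.
  rewrite -[in LHS](sum_rot (fun j : 'I_n.+1 => (-1) ^+ j : R)) -sumrN.
  by apply: eq_bigr => j _; rewrite sign_ordS.
by move: E; lra.
Qed.

Lemma alt_sumD (R : realType) (n : nat) (a : R) (x y : 'rV[R]_n.+1) :
  alt_sum (a *: x + y) = a * alt_sum x + alt_sum y.
Proof.
rewrite /alt_sum mulr_sumr -big_split /=; apply: eq_bigr => j _.
by rewrite !mxE mulrDr mulrCA.
Qed.

Lemma alt_reflect_is_linear (R : realType) (n : nat) : linear (@alt_reflect R n).
Proof.
move=> a x y; rewrite /alt_reflect; case: ifP => // _; rewrite alt_sumD.
by apply/rowP => j; rewrite !mxE; move: (2 / _) => q; ring.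
Qed.

Lemma rot_path_is_linear (R : realType) (n : nat) (t : R) : linear (@rot_path R n t).
Proof.
move=> a x y; rewrite /rot_path alt_reflect_is_linear; apply/rowP => j.
by rewrite !mxE; ring.
Qed.

HB.instance Definition _ (R : realType) (n : nat) (t : R) :=
  GRing.isLinear.Build R 'rV[R]_n.+1 'rV[R]_n.+1 _ (@rot_path R n t) (@rot_path_is_linear R n t).

Lemma alt_sum_reflect (R : realType) (n : nat) (y : 'rV[R]_n.+1) : odd n ->
  alt_sum (alt_reflect y) = - alt_sum y.
Proof.
move=> on; rewrite /alt_reflect on -scaleNr addrC alt_sumD.
have -> : alt_sum (\row_(j < n.+1) (-1) ^+ j) = n.+1%:R :> R.
  rewrite /alt_sum (eq_bigr (fun=> 1)) ?sumr_const ?card_ord// => j _.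
  by rewrite mxE -expr2 sqrr_sign.
have n0 : n.+1%:R != 0 :> R by rewrite pnatr_eq0.
by move: (n.+1%:R) n0 => x x0; field.
Qed.

Lemma alt_reflectK (R : realType) (n : nat) : involutive (@alt_reflect R n).
Proof.
move=> y; have [on|/negbTE on] := boolP (odd n); last by rewrite /alt_reflect on.
rewrite {1}/alt_reflect on alt_sum_reflect// mulrN scaleNr opprK.
by rewrite /alt_reflect on subrK.
Qed.

Lemma sum_rot_path (R : realType) (n : nat) (t : R) (y : 'rV[R]_n.+1) :
  \sum_j rot_path t y 0 j = \sum_j y 0 j.
Proof.
have r : \sum_j rot y 0 j = \sum_j y 0 j.
  by under eq_bigr do rewrite mxE; exact: (sum_rot (fun j => y 0 j)).
have f : \sum_j alt_reflect y 0 j = \sum_j y 0 j.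
  rewrite /alt_reflect; case: ifP => // on.
  under eq_bigr do rewrite !mxE.
  by rewrite sumrB -mulr_sumr sum_sign// mulr0 subr0.
have comb a b (x z : 'rV[R]_n.+1) :
    \sum_j (a *: x + b *: z) 0 j = a * (\sum_j x 0 j) + b * (\sum_j z 0 j).
  by rewrite !mulr_sumr -big_split; apply: eq_bigr => j _; rewrite !mxE.
by rewrite /rot_path comb r f; ring.
Qed.

(** For odd [n] both ends of the segment reverse [alt_sum], so a kernel vector has alternating sum
    0; in all cases [alt_reflect] fixes it and it satisfies [(1 - t) y (i + 1) = - t y i]. One turn
    then gives [(1 - t)^(n + 1) = (- t)^(n + 1)] unless [y = 0]. This forces [n] odd and [t = 1/2],
    where [y] alternates in sign and vanishes with its alternating sum. *)
Lemma rot_path_eq0 (R : realType) (n : nat) (t : R) (y : 'rV[R]_n.+1) :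
  0 <= t <= 1 -> rot_path t y = 0 -> y = 0.
Proof.
move=> /andP[t0 t1] Wy.
have y_alt : odd n -> alt_sum y = 0.
  move=> on; have := congr1 (@alt_sum R n) Wy.
  rewrite /rot_path alt_sumD alt_sum_rot// -[t *: _]addr0 alt_sumD alt_sum_reflect//.
  have -> : alt_sum (0 : 'rV[R]_n.+1) = 0.
    by rewrite /alt_sum big1// => j _; rewrite mxE mulr0.
  by lra.
have yE : alt_reflect y = y.
  rewrite /alt_reflect; case: ifP => // on.
  by rewrite y_alt// mulr0 scale0r subr0.
have step (i : int) : (1 - t) * unroll y (i + 1) = - t * unroll y i.
  have := congr1 (fun x : 'rV[R]_n.+1 => x 0 (cyc n i)) Wy.
  rewrite /rot_path yE !mxE /unroll cyc_succ; lra.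
have iter (k : nat) (i : int) : (1 - t) ^+ k * unroll y (i + k%:Z) = (- t) ^+ k * unroll y i.
  elim: k => [|k IH]; first by rewrite addr0 !expr0 !mul1r.
  have -> : i + k.+1%:Z = i + k%:Z + 1 by lia.
  by rewrite exprSr -mulrA step mulrCA IH mulrA -exprS.
have loop i : ((1 - t) ^+ n.+1 - (- t) ^+ n.+1) * unroll y i = 0.
  by rewrite mulrBl -iter unroll_periodic subrr.
apply/rowP => j; rewrite mxE -unroll_ord.
have /eqP := loop j%:Z; rewrite mulf_eq0 subr_eq0 => /orP[|/eqP//].
have [on|on] := boolP (odd n); last first.
  rewrite exprNn -signr_odd /= on mulN1r => /eqP E.
  have : 0 < (1 - t) ^+ n.+1 + t ^+ n.+1.
    have [->|tn] := eqVneq t 1; first by rewrite subrr expr0n expr1n /= add0r.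
    by rewrite ltr_pwDl ?exprn_gt0 ?exprn_ge0// subr_gt0 lt_neqAle tn.
  by rewrite E addNr ltxx.
rewrite exprNn -signr_odd /= on mul1r eqrXn2// ?subr_ge0// => /eqP t2.
have alt (k : nat) : unroll y k%:Z = (-1) ^+ k * unroll y 0.
  elim: k => [|k IH]; first by rewrite mul1r.
  have := step k%:Z; have -> : k%:Z + 1 = k.+1%:Z by lia.
  rewrite t2 exprS mulN1r mulNr -IH.
  have : t != 0 by apply/eqP; lra.
  by move=> tn /eqP; rewrite mulNr -mulrN => /eqP /(mulfI tn).
have : n.+1%:R * unroll y 0 = 0.
  rewrite -(y_alt on) /alt_sum (eq_bigr (fun=> unroll y 0)).
    by rewrite sumr_const card_ord mulr_natl.
  by move=> i _; rewrite -unroll_ord alt mulrA -expr2 sqrr_sign mul1r.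
by move=> /eqP; rewrite mulf_eq0 pnatr_eq0 /= => /eqP y0; rewrite alt y0 mulr0.
Qed.

Lemma rV_continuous (T : topologicalType) (R : realType) (n : nat) (f : T -> 'rV[R]_n) (x : T) :
  (forall j, {for x, continuous (fun k => f k 0 j)}) -> {for x, continuous f}.
Proof.
move=> fc A [P PN PA]; have H j : \near x, P 0 j (f x 0 j) -> True by near=> y.
suff: \forall k \near x, forall j, P 0 j (f k 0 j).
  by apply: filterS => k Pk; apply: PA => i j; rewrite ord1; exact: Pk.
by apply: filter_forall => j; exact: (fc j _ (PN 0 j)).
Unshelve. all: by end_near.
Qed.

Lemma sum_continuous (T : topologicalType) (R : realType) (I : finType) (f : I -> T -> R) (x : T) :
  (forall i, {for x, continuous (f i)}) -> {for x, continuous (fun k => \sum_i f i k)}.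
Proof. by move=> fc; apply: cvg_big => // [|i _]; [exact: add_continuous|exact: fc]. Qed.

Lemma gauge_continuous (R : realType) (n : nat) : continuous (@gauge R n).
Proof.
have coord j : continuous (fun y : 'rV[R]_n.+1 => y 0 j) by exact: coord_continuous.
move=> y; rewrite /gauge /continuous_at.
have bigmax_cvg (f : 'I_n.+1 -> 'rV[R]_n.+1 -> R) (g : 'rV[R]_n.+1 -> R) (s : seq 'I_n.+1) :
    (forall i, {for y, continuous (f i)}) -> {for y, continuous g} ->
    {for y, continuous (fun k => \big[Num.max/g k]_(i <- s) f i k)}.
  move=> fc gc; elim: s => [|i s IH].
    by rewrite (_ : (fun _ => _) = g)//; apply/funext => k; rewrite big_nil.
  rewrite (_ : (fun _ => _) = f i \max (fun k => \big[Num.max/g k]_(i <- s) f i k)).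
    exact: continuous_max (fc i) IH.
  by apply/funext => k; rewrite big_cons.
apply: bigmax_cvg => [j|].
  exact: cvgB (coord j y) (coord (ordS j) y).
exact: cvg_norm (sum_continuous (fun j => coord j y)).
Qed.

Lemma rot_path_inv (R : realType) (n : nat) (t : R) : 0 <= t <= 1 ->
  exists W : 'rV[R]_n.+1 -> 'rV[R]_n.+1, [/\ forall a y, W (a *: y) = a *: W y,
    cancel (rot_path t) W & cancel W (rot_path t)].
Proof.
move=> t01; pose A := lin1_mx (@rot_path R n t).
have AE y : y *m A = rot_path t y by exact: mul_rV_lin1.
have Au : A \in unitmx.
  rewrite -row_free_unit; apply/inj_row_free => v; rewrite AE; exact: rot_path_eq0.
exists (fun y => y *m invmx A); split=> [a y|y|y]; first by rewrite scalemxAl.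
  by rewrite -AE mulmxK.
by rewrite -AE mulmxKV.
Qed.

(** Applying the path twice makes both ends right: [alt_reflect] is an involution, so time 0 gives
    the identity, and time 1 gives [rot] twice. *)
Definition isotopy (R : realType) (n : nat) (t : R) (y : 'rV[R]_n.+1) : 'rV[R]_n.+1 :=
  radial (rot_path (1 - t)) (radial (rot_path (1 - t)) y).

Lemma isotopy0 (R : realType) (n : nat) (y : 'rV[R]_n.+1) : isotopy 0 y = y.
Proof.
have -> : isotopy 0 y = radial (@alt_reflect R n) (radial (@alt_reflect R n) y).
  rewrite /isotopy; have -> // : rot_path (1 - 0) = @alt_reflect R n.
  by apply/funext => x; rewrite /rot_path subr0 subrr scale0r add0r scale1r.
apply: radialK (@alt_reflectK R n) _ => a x.
by rewrite -[a *: x]addr0 alt_reflect_is_linear {2}/alt_reflect /alt_sum big1 ?mulr0 ?scale0r ?subrr ?if_same ?addr0// => j _; rewrite mxE mulr0.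
Qed.

Lemma isotopy1 (R : realType) (n : nat) (y : 'rV[R]_n.+1) : isotopy 1 y = rot (rot y).
Proof.
have W0 x : rot_path (1 - 1) x = rot x :> 'rV[R]_n.+1.
  by rewrite /rot_path subrr subr0 scale0r scale1r addr0.
have r x : radial (rot_path (1 - 1)) x = rot x :> 'rV[R]_n.+1.
  rewrite /radial W0 gauge_rot; have [->|x0] := eqVneq x 0.
    by rewrite gauge0 mul0r scale0r; apply/rowP => j; rewrite !mxE.
  by rewrite mulfV ?scale1r// gt_eqF// gauge_gt0.
by rewrite /isotopy !r.
Qed.

Lemma sum_radial (R : realType) (n : nat) (t : R) (y : 'rV[R]_n.+1) :
  \sum_j y 0 j = 0 -> \sum_j radial (rot_path t) y 0 j = 0.
Proof.
move=> y0; under eq_bigr do rewrite mxE.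
by rewrite -mulr_sumr sum_rot_path y0 mulr0.
Qed.

Lemma isotopy_simplex (R : realType) (n m : nat) (t : R) (y : 'rV[R]_n.+1) : 0 <= t <= 1 ->
  dev_simplex m y -> dev_simplex m (isotopy t y).
Proof.
move=> t01; rewrite !dev_simplexE => -[y0 yg]; split.
  by do 2!apply: sum_radial.
have t01' : 0 <= 1 - t <= 1 by lra.
by rewrite /isotopy !gauge_radial//; exact: rot_path_eq0.
Qed.

Lemma isotopy_inj (R : realType) (n : nat) (t : R) : 0 <= t <= 1 ->
  injective (@isotopy R n t).
Proof.
move=> t01; have t01' : 0 <= 1 - t <= 1 by lra.
have [W [WZ WK _]] := @rot_path_inv R n _ t01'.
by have := can_inj (radialK WZ WK) => inj x y /inj /inj.
Qed.

Lemma isotopy_surj (R : realType) (n m : nat) (t : R) (z : 'rV[R]_n.+1) : 0 <= t <= 1 ->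
  dev_simplex m z -> exists2 y, dev_simplex m y & isotopy t y = z.
Proof.
move=> t01; have t01' : 0 <= 1 - t <= 1 by lra.
have [W [WZ WK KW]] := @rot_path_inv R n _ t01'.
have linZ a x : rot_path (1 - t) (a *: x) = a *: rot_path (1 - t) x :> 'rV[R]_n.+1.
  exact: linearZ.
have K := radialK linZ KW; rewrite dev_simplexE => -[z0 zg].
have sW x : \sum_j W x 0 j = \sum_j x 0 j by rewrite -{2}(KW x) sum_rot_path.
have sr (x : 'rV[R]_n.+1) : \sum_j x 0 j = 0 -> \sum_j radial W x 0 j = 0.
  by move=> x0; under eq_bigr do rewrite mxE; rewrite -mulr_sumr sW x0 mulr0.
have W0 x : W x = 0 -> x = 0 by move=> Wx; rewrite -(KW x) Wx linear0.
exists (radial W (radial W z)); last by rewrite /isotopy !K.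
have gr x : gauge (radial W x) = gauge x := gauge_radial (@W0 x).
by rewrite dev_simplexE !gr; split=> //; exact: sr _ (sr _ z0).
Qed.

(** Away from 0 this is a quotient with nonzero denominator. At 0 the scaling factor has no limit in
    general; there the bound of each coordinate by the gauge forces the limit 0. *)
Lemma radial_rot_path_continuous (R : realType) (n : nat) (k : 'rV[R]_n.+1 * R) :
  0 <= k.2 <= 1 ->
  {for k, continuous (fun k : 'rV[R]_n.+1 * R => radial (rot_path k.2) k.1)}.
Proof.
move=> k01; set h := (h in {for k, continuous h}).
have fstc : {for k, continuous (@fst 'rV[R]_n.+1 R)} by exact: cvg_fst.
have sndc : {for k, continuous (@snd 'rV[R]_n.+1 R)} by exact: cvg_snd.
have gc : {for k, continuous (fun k : 'rV[R]_n.+1 * R => gauge k.1)}.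
  exact: continuous_comp fstc (@gauge_continuous _ _ _).
have coord j : {for k, continuous (fun k : 'rV[R]_n.+1 * R => k.1 0 j)}.
  exact: continuous_comp fstc (@coord_continuous _ _ _ _ _ _).
have Wc j : {for k, continuous (fun k : 'rV[R]_n.+1 * R => rot_path k.2 k.1 0 j)}.
  have rc : {for k, continuous (fun l : 'rV[R]_n.+1 * R => alt_reflect l.1 0 j)}.
    rewrite /alt_reflect; case: (odd n) => //.
    rewrite (_ : (fun _ => _) = fun l : 'rV[R]_n.+1 * R =>
      l.1 0 j - (2 / n.+1%:R * alt_sum l.1) * (-1) ^+ j); last first.
      by apply/funext => l; rewrite !mxE.
    apply: (cvgB (coord j)); apply: cvgMr_tmp; apply: cvgMl_tmp; apply: sum_continuous => i.
    exact: cvgMl_tmp (coord i).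
  rewrite (_ : (fun _ => _) = fun l : 'rV[R]_n.+1 * R =>
    (1 - l.2) * l.1 0 (ordS j) + l.2 * alt_reflect l.1 0 j); last first.
    by apply/funext => l; rewrite !mxE.
  apply: cvgD; last exact: cvgM sndc rc.
  by apply: cvgM (coord _); apply: cvgB sndc; exact: cvg_cst.
have [k10|k10] := eqVneq k.1 0; last first.
  apply: rV_continuous => j; rewrite (_ : (fun _ => _) = fun l : 'rV[R]_n.+1 * R =>
    gauge l.1 / gauge (rot_path l.2 l.1) * rot_path l.2 l.1 0 j); last first.
    by apply/funext => l; rewrite mxE.
  have gWc : {for k, continuous (fun l : 'rV[R]_n.+1 * R => gauge (rot_path l.2 l.1))}.
    exact: continuous_comp (rV_continuous Wc) (@gauge_continuous _ _ _).
  apply: cvgM (Wc j); apply: cvgM gc _; apply: cvgV gWc.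
  by rewrite gt_eqF// gauge_gt0//; apply/eqP => /(rot_path_eq0 k01)/eqP; apply/negP.
have hb l j : `|h l 0 j| <= n.+2%:R * gauge l.1.
  apply: (le_trans (gauge_bound _ _)); rewrite ler_wpM2l ?ler0n// /h /radial.
  rewrite gaugeZ ?divr_ge0 ?gauge_ge0//.
  by have [->|ne] := eqVneq (gauge (rot_path l.2 l.1)) 0; rewrite ?mulr0 ?gauge_ge0// divfK.
apply: rV_continuous => j; change (h l 0 j @[l --> k] --> h k 0 j).
have -> : h k 0 j = 0 by rewrite /h /radial k10 gauge0 mul0r scale0r mxE.
have lim0 : n.+2%:R * gauge l.1 @[l --> k] --> (0 : R).
  rewrite -[X in _ --> X](mulr0 (n.+2%:R)) -(gauge0 R n) -k10.
  exact: cvgMl_tmp gc.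
apply: (@squeeze_cvgr _ _ _ _ (fun l => - (n.+2%:R * gauge l.1)) (fun l => n.+2%:R * gauge l.1)) => //.
  by near=> l; rewrite -ler_norml.
by rewrite -oppr0; apply: cvgN.
Unshelve. all: by end_near.
Qed.

Lemma isotopy_continuous (R : realType) (n : nat) (k : 'rV[R]_n.+1 * R) :
  0 <= k.2 <= 1 ->
  {for k, continuous (fun k : 'rV[R]_n.+1 * R => isotopy k.2 k.1)}.
Proof.
move=> k01; have k01' : 0 <= 1 - k.2 <= 1 by lra.
pose h (l : 'rV[R]_n.+1 * R) := (radial (rot_path l.2) l.1, l.2).
pose r (l : 'rV[R]_n.+1 * R) := (l.1, 1 - l.2).
have fstc l : {for l, continuous (@fst 'rV[R]_n.+1 R)} by exact: cvg_fst.
have sndc l : {for l, continuous (@snd 'rV[R]_n.+1 R)} by exact: cvg_snd.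
have rc : {for k, continuous r}.
  have sc : {for k, continuous (fun l : 'rV[R]_n.+1 * R => 1 - l.2)}.
    by apply: cvgB (sndc k); exact: cvg_cst.
  exact: cvg_pair (fstc k) sc.
have hc l : 0 <= l.2 <= 1 -> {for l, continuous h}.
  by move=> l01; exact: cvg_pair (radial_rot_path_continuous l01) (sndc l).
have rhc : {for k, continuous (h \o r)} by apply: continuous_comp rc _; exact: hc.
have rhhc : {for k, continuous (h \o (h \o r))}.
  by apply: continuous_comp rhc _; exact: hc.
exact: continuous_comp rhhc (fstc _).
Qed.

(** * Circular curves as images of the cylinder over the simplex *)

Opaque isotopy dev_lift.

Lemma zeta_continuous (R : realType) (c : int -> R) : continuous (zeta c).
Proof.
move=> x; set k := Num.floor x; have /andP[kx xk] := floor_itv x; rewrite -/k in kx xk.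
(* The floor jumps when [x] is an integer, so the zigzag is replaced near [x] by [g], which is
   written with maxima and is valid on both sides of the knot [k]. *)
pose g (y : R) := c k + Num.max (y - k%:~R) 0 * (c (k + 1) - c k)
  + Num.max (k%:~R - y) 0 * (c (k - 1) - c k).
have gE y : (k - 1)%:~R <= y <= (k + 1)%:~R -> zeta c y = g y.
  move=> /andP[y1 y2]; rewrite /g; have [ky|yk] := leP k%:~R y.
    rewrite (@zeta_itv _ c k) ?ky// max_l ?subr_ge0// max_r ?subr_le0//.
    by rewrite mul0r addr0.
  rewrite (@zeta_itv _ c (k - 1)) ?subrK ?y1 ?(ltW yk)// max_r ?subr_le0 ?ltW//.
  by rewrite max_l ?subr_ge0 ?ltW// mul0r addr0 rmorphB /=; ring.
have gc : {for x, continuous g}.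
  have mc (h : R -> R) : {for x, continuous h} -> {for x, continuous (fun y => Num.max (h y) 0)}.
    by move=> hc; apply: (@continuous_max _ _ h (fun=> 0)) => //; exact: cvg_cst.
  apply: cvgD; last by apply: cvgMr_tmp; apply: mc; apply: cvgB; [exact: cvg_cst|exact: cvg_id].
  apply: cvgD; first exact: cvg_cst.
  by apply: cvgMr_tmp; apply: mc; apply: cvgB; [exact: cvg_id|exact: cvg_cst].
have zg : zeta c x = g x by apply: gE; rewrite (ltW xk) andbT (le_trans _ kx)// ler_int; lia.
rewrite /continuous_at zg; apply: cvg_trans gc; apply: near_eq_cvg.
have k1x : (k - 1)%:~R < x by apply: lt_le_trans kx; rewrite ltr_int; lia.
near=> y; rewrite gE//; apply/andP; split; near: y.
  exact: lt_le_nbhsr k1x.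
exact: lt_le_nbhsl xk.
Unshelve. all: by end_near.
Qed.

Definition curve_set (R : realType) (N m : nat) (c : int -> R) : set 'rV[R]_N.+1 :=
  [set w | exists2 phi, lift N.+1 m phi & forall i, unroll w i = zeta c (phi i)].

Definition cylinder (R : realType) (n m : nat) : set ('rV[R]_n.+1 * R) :=
  [set k | dev_simplex m k.1 /\ 0 <= k.2 <= 1].

(** Translating a lift by [2 * r] rotates the deviation [2 * r] times; [r] copies of the isotopy
    lead from the identity to that rotation along the cylinder. *)
Definition twist (R : realType) (n r : nat) (k : 'rV[R]_n.+1 * R) : 'rV[R]_n.+1 :=
  iter r (isotopy k.2) k.1.

(** Over the length of the cylinder the mean travels by [2 r (m / (n + 1) + 1)], the amount by which
    translation by [2 * r] moves it according to [dev_lift_rots]. *)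
Definition cyl_lift (R : realType) (n m r : nat) (k : 'rV[R]_n.+1 * R) : int -> R :=
  dev_lift m (twist r k) (k.2 * ((2 * r)%:R * (m%:R / n.+1%:R + 1))).

Definition cyl_map (R : realType) (n m r : nat) (c : int -> R) (k : 'rV[R]_n.+1 * R)
  : 'rV[R]_(n + m).+1 := \row_i zeta c (cyl_lift m r k i%:Z).

Lemma cyl_mapE (R : realType) (n m r : nat) (c : int -> R) (k : 'rV[R]_n.+1 * R) i :
  cyl_map m r c k 0 i = zeta c (cyl_lift m r k i%:Z).
Proof. by rewrite mxE. Qed.

Lemma cyl_map_ext (R : realType) (n m r : nat) (c : int -> R) (k k' : 'rV[R]_n.+1 * R) :
  (forall i, zeta c (cyl_lift m r k i) = zeta c (cyl_lift m r k' i)) ->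
  cyl_map m r c k = cyl_map m r c k'.
Proof.
move=> E; apply/rowP => i; apply: etrans (@cyl_mapE R n m r c k i) _.
by apply: etrans (E i%:Z) _; exact: esym (@cyl_mapE R n m r c k' i).
Qed.

Lemma zeta_translate (R : realType) (c : int -> R) (r : int) (x : R) :
  zeta c (x + r%:~R) = zeta (fun l => c (l + r)) x.
Proof.
rewrite /zeta floorDrz ?intr_int// intrKfloor.
by rewrite [_ + r + 1]addrAC rmorphD /= opprD addrACA subrr addr0.
Qed.

Lemma zeta_shift (R : realType) (c : int -> R) (r : int) :
  (forall k, c (k + r) = c k) -> forall x, zeta c (x + r%:~R) = zeta c x.
Proof. by move=> cr x; rewrite zeta_translate; congr (zeta _ x); exact/funext. Qed.

Lemma twist_simplex (R : realType) (n m r : nat) (k : 'rV[R]_n.+1 * R) :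
  cylinder m k -> dev_simplex m (twist r k).
Proof.
by move=> [Dk k01]; elim: r => //= r IH; exact: isotopy_simplex.
Qed.

Lemma twist_inj (R : realType) (n r : nat) (t : R) (y y' : 'rV[R]_n.+1) : 0 <= t <= 1 ->
  twist r (y, t) = twist r (y', t) -> y = y'.
Proof. by move=> t01; elim: r => //= r IH /(isotopy_inj t01). Qed.

Lemma twist_surj (R : realType) (n m r : nat) (t : R) (z : 'rV[R]_n.+1) : 0 <= t <= 1 ->
  dev_simplex m z -> exists2 y, dev_simplex m y & twist r (y, t) = z.
Proof.
move=> t01; elim: r z => [|r IH] z Dz; first by exists z.
by have [x Dx <-] := isotopy_surj t01 Dz; have [y Dy <-] := IH x Dx; exists y.
Qed.

Lemma twist0 (R : realType) (n r : nat) (y : 'rV[R]_n.+1) : twist r (y, 0) = y.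
Proof. by elim: r => //= r IH; rewrite /twist /= isotopy0. Qed.

Lemma twist1 (R : realType) (n r : nat) (y : 'rV[R]_n.+1) :
  twist r (y, 1) = iter (2 * r) (@rot R n) y.
Proof.
elim: r => [|r IH]; first by rewrite muln0.
rewrite -[LHS]/(isotopy 1 (twist r (y, 1))) IH isotopy1 mulnS.
by rewrite iterD.
Qed.

Lemma twist_continuous (R : realType) (n r : nat) (k : 'rV[R]_n.+1 * R) : 0 <= k.2 <= 1 ->
  {for k, continuous (@twist R n r)}.
Proof.
move=> k01; elim: r => [|r IH]; first exact: cvg_fst.
have sndc : {for k, continuous (@snd 'rV[R]_n.+1 R)} by exact: cvg_snd.
have pc : {for k, continuous (fun l => (twist r l, l.2))} by exact: cvg_pair IH sndc.
have c : {for (twist r k, k.2), continuous (fun l : 'rV[R]_n.+1 * R => isotopy l.2 l.1)}.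
  exact: isotopy_continuous.
exact: continuous_comp pc c.
Qed.

Opaque twist.

Lemma rot_simplex (R : realType) (n m k : nat) (y : 'rV[R]_n.+1) :
  dev_simplex m y -> dev_simplex m (iter k (@rot R n) y).
Proof.
move=> Dy; elim: k => //= k; rewrite !dev_simplexE gauge_rot => -[s0 g]; split=> //.
rewrite -[RHS]s0 -[RHS](sum_rot (fun j => (iter k (@rot R n) y) 0 j)).
by apply: eq_bigr => j _; rewrite mxE.
Qed.

Lemma rot_inj (R : realType) (n k : nat) : injective (iter k (@rot R n)).
Proof.
elim: k => //= k IH y y' E; apply: IH; apply/rowP => j.
by have /rowP/(_ (ord_pred j)) := E; rewrite !mxE ord_predK.
Qed.

Lemma dev_lift_rots (R : realType) (n m k : nat) (y : 'rV[R]_n.+1) (c0 : R) (i : int) :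
  dev_simplex m y ->
  dev_lift m (iter k (@rot R n) y) (c0 + k%:R * (m%:R / n.+1%:R + 1)) i = dev_lift m y c0 i + k%:R.
Proof.
move=> Dy; elim: k => [|k IH]; first by rewrite mul0r !addr0.
rewrite -natr1 mulrDl mul1r addrA /= dev_lift_rot ?IH -?addrA//.
exact: rot_simplex.
Qed.

Lemma dev_lift_shift (R : realType) (n m : nat) (y y' : 'rV[R]_n.+1) (c0 c0' : R) (k : int) :
  dev_simplex m y -> dev_simplex m y' ->
  (forall i, dev_lift m y' c0' i = dev_lift m y c0 i + k%:~R) ->
  c0' = c0 + k%:~R * (m%:R / n.+1%:R + 1).
Proof.
move=> Dy Dy'; case: k => k E.
  have E' i : dev_lift m y' c0' i = dev_lift m (iter k (@rot R n) y) (c0 + k%:R * (m%:R / n.+1%:R + 1)) i.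
    by rewrite E dev_lift_rots.
  by have [_ ->] := dev_lift_inj Dy' (rot_simplex k Dy) E'.
have E' i : dev_lift m y c0 i = dev_lift m (iter k.+1 (@rot R n) y') (c0' + k.+1%:R * (m%:R / n.+1%:R + 1)) i.
  by rewrite dev_lift_rots// E NegzE rmorphN /= subrK.
have [_ ->] := dev_lift_inj Dy (rot_simplex k.+1 Dy') E'.
by rewrite NegzE rmorphN /= mulNr addrK.
Qed.

Lemma cyl_lift0 (R : realType) (n m r : nat) (y : 'rV[R]_n.+1) :
  cyl_lift m r (y, 0) = dev_lift m y 0.
Proof. by rewrite /cyl_lift twist0 mul0r. Qed.

Lemma cyl_lift1 (R : realType) (n m r : nat) (y : 'rV[R]_n.+1) :
  cyl_lift m r (y, 1) =
  dev_lift m (iter (2 * r) (@rot R n) y) ((2 * r)%:R * (m%:R / n.+1%:R + 1)).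
Proof. by rewrite /cyl_lift twist1 mul1r. Qed.

(** The twist reaches the [2 * r]-fold rotation exactly when the mean has travelled the matching
    distance, so the two ends of the cylinder are glued by the identity of the simplex. *)
Lemma cyl_lift_loop (R : realType) (n m r : nat) (y : 'rV[R]_n.+1) (i : int) :
  dev_simplex m y -> cyl_lift m r (y, 1) i = cyl_lift m r (y, 0) i + (2 * r)%:R.
Proof.
move=> Dy; set s : R := (2 * r)%:R * (m%:R / n.+1%:R + 1).
transitivity (dev_lift m (iter (2 * r) (@rot R n) y) (0 + s) i).
  by rewrite cyl_lift1 add0r.
rewrite dev_lift_rots//; congr (_ + _).
by rewrite cyl_lift0.
Qed.

Lemma curve_periodic (R : realType) (N m : nat) (phi c : int -> R) :
  lift N m phi -> (forall k, c (k + m%:Z) = c k) ->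
  forall i, zeta c (phi (i + N%:Z)) = zeta c (phi i).
Proof. by move=> [_ pN _] cm i; rewrite pN (@zeta_shift _ _ m%:Z). Qed.

Lemma cyl_lift_lift (R : realType) (n m r : nat) (k : 'rV[R]_n.+1 * R) :
  (0 < m)%N -> cylinder m k -> lift (n + m).+1 m (cyl_lift m r k).
Proof. by move=> m0 Kk; apply: dev_lift_lift => //; exact: twist_simplex. Qed.

Lemma unroll_cyl_map (R : realType) (n m r : nat) (c : int -> R) (k : 'rV[R]_n.+1 * R) :
  (0 < m)%N -> (forall k, c (k + m%:Z) = c k) -> cylinder m k ->
  forall i, unroll (cyl_map m r c k) i = zeta c (cyl_lift m r k i).
Proof.
move=> m0 cm Kk i; have cp := curve_periodic (cyl_lift_lift r m0 Kk) cm.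
by rewrite /unroll cyl_mapE (periodic_cyc cp).
Qed.

Opaque cyl_map.

Lemma cyl_map_curve (R : realType) (n m r : nat) (c : int -> R) (k : 'rV[R]_n.+1 * R) :
  (0 < m)%N -> (forall k, c (k + m%:Z) = c k) -> cylinder m k ->
  curve_set m c (cyl_map m r c k).
Proof.
move=> m0 cm Kk; exists (cyl_lift m r k); first exact: cyl_lift_lift.
exact: unroll_cyl_map.
Qed.

Lemma cyl_map_surj (R : realType) (n m r : nat) (c : int -> R) (w : 'rV[R]_(n + m).+1) :
  (0 < m)%N -> (0 < r)%N -> (forall k, c (k + m%:Z) = c k) ->
  (forall k, c (k + (2 * r)%N%:Z) = c k) -> curve_set m c w ->
  exists2 k, cylinder m k & cyl_map m r c k = w.
Proof.
move=> m0 r0 cm cr [phi lp wE]; set s : R := m%:R / n.+1%:R + 1.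
have s0 : 0 < s by rewrite ltr_wpDl ?divr_ge0.
have r20 : 0 < (2 * r)%:R :> R by rewrite ltr0n muln_gt0.
have [y [c0 [Dy phiE]]] := dev_lift_surj lp.
(* Translating by [- q] times [2 * r], which [c] does not see, brings the mean into the range
   travelled along the cylinder. *)
pose q := Num.floor (c0 / ((2 * r)%:R * s)).
pose phi' i := phi i + (- q * (2 * r)%N%:Z)%:~R.
have lp' : lift (n.+1 + m) m phi' by exact: lift_shift.
have [y' [c0' [Dy' phiE']]] := dev_lift_surj lp'.
have c0E : c0' = c0 + (- q * (2 * r)%N%:Z)%:~R * s.
  by apply: dev_lift_shift Dy Dy' _ => i; rewrite phiE' phiE.
pose t := c0' / ((2 * r)%:R * s).
have t01 : 0 <= t <= 1.
  have -> : t = c0 / ((2 * r)%:R * s) - q%:~R.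
    rewrite /t c0E mulrDl intrM -[(2 * r)%N%:~R]/((2 * r)%:R) rmorphN /= -mulrA mulfK//.
    by rewrite mulf_neq0 ?gt_eqF.
  have := floor_itv (c0 / ((2 * r)%:R * s)); rewrite -/q rmorphD /=.
  by move=> /andP[h1 h2]; lra.
have [x Dx xE] := twist_surj r t01 Dy'.
have Kx : cylinder m (x, t) by [].
exists (x, t) => //; apply/rowP => i; rewrite -!unroll_ord unroll_cyl_map// wE.
rewrite /cyl_lift xE /= -/s divfK ?mulf_neq0 ?gt_eqF// phiE' /phi'.
apply: zeta_shift => k; apply: (@int_step_ind (fun q => c (k + q * (2 * r)%N%:Z) = c k) 0) => [|j|j].
- by rewrite mul0r addr0.
- by rewrite mulrDl mul1r addrA cr.
- by rewrite mulrDl mul1r addrA cr.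
Qed.

(** By [lift_unique] and the minimality of [r], two parameters of one point have lifts that differ
    by [q] times [2 * r] for some integer [q]. Their second coordinates then differ by [q], so [q]
    is -1, 0 or 1. The resulting description of the fibres involves neither [c] nor [r]. *)
Lemma cyl_map_fibre (R : realType) (n m r : nat) (c : int -> R) (k k' : 'rV[R]_n.+1 * R) :
  (0 < m)%N -> (0 < r)%N -> alternating c -> (forall k, c (k + m%:Z) = c k) ->
  (forall k, c (k + (2 * r)%N%:Z) = c k) ->
  (forall j : int, (forall l, c (l + 2 * j) = c l) -> (r%:Z %| j)%Z) ->
  cylinder m k -> cylinder m k' ->
  cyl_map m r c k = cyl_map m r c k' <->
  k = k' \/ k.1 = k'.1 /\ (k.2 = 0 /\ k'.2 = 1 \/ k.2 = 1 /\ k'.2 = 0).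
Proof.
move=> m0 r0 ac cm cr crP Kk Kk'; set s : R := m%:R / n.+1%:R + 1.
have s0 : 0 < s by rewrite ltr_wpDl ?divr_ge0.
have r20 : 0 < (2 * r)%:R :> R by rewrite ltr0n muln_gt0.
have loop (y : 'rV[R]_n.+1) : dev_simplex m y -> cyl_map m r c (y, 0) = cyl_map m r c (y, 1).
  move=> Dy; apply: cyl_map_ext => i; symmetry.
  apply: etrans (congr1 (zeta c) (cyl_lift_loop r i Dy)) _.
  exact: (@zeta_shift _ _ (2 * r)%N%:Z).
split=> [E|]; last first.
  case: k k' Kk Kk' => [y t] [y' t'] [/= Dy _] [/= Dy' _].
  move=> [[-> ->]//|[/= -> [[-> ->]|[-> ->]]]]; first exact: loop.
  by symmetry; exact: loop.
have [|j [jE cj]] := lift_unique (cyl_lift_lift r m0 Kk) (cyl_lift_lift r m0 Kk') ac ac.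
  move=> i; exact: etrans (esym (unroll_cyl_map r m0 cm Kk i))
    (etrans (congr1 (fun w => unroll w i) E) (unroll_cyl_map r m0 cm Kk' i)).
have /dvdzP[q jq] := crP j cj.
have step (x x' : 'rV[R]_n.+1 * R) (a : nat) : cylinder m x -> cylinder m x' ->
    (forall i, cyl_lift m r x' i = cyl_lift m r x i + (a * (2 * r))%:R) ->
    twist r x' = iter (a * (2 * r)) (@rot R n) (twist r x) /\ x'.2 = x.2 + a%:R.
  move=> Kx Kx' xE; have Tx := twist_simplex r Kx; have Tx' := twist_simplex r Kx'.
  have E' i : dev_lift m (twist r x') (x'.2 * ((2 * r)%:R * s)) i =
      dev_lift m (iter (a * (2 * r)) (@rot R n) (twist r x))
        (x.2 * ((2 * r)%:R * s) + (a * (2 * r))%:R * s) i.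
    exact: etrans (xE i) (esym (dev_lift_rots _ _ _ Tx)).
  have [-> ] := dev_lift_inj Tx' (rot_simplex (a * (2 * r)) Tx) E'.
  rewrite [(a * _)%:R]natrM -[a%:R * _ * s]mulrA -mulrDl => /mulIf H.
  split; [reflexivity|apply: H].
  by rewrite mulf_neq0 ?gt_eqF.
have fin (x x' : 'rV[R]_n.+1 * R) (a : nat) : cylinder m x -> cylinder m x' ->
    (forall i, cyl_lift m r x' i = cyl_lift m r x i + (a * (2 * r))%:R) ->
    x = x' \/ x.1 = x'.1 /\ x.2 = 0 /\ x'.2 = 1.
  move=> Kx Kx' xE; have [] := step x x' a Kx Kx' xE.
  case: x x' Kx Kx' {xE} => [y t] [y' t'] [/= Dy t01] [/= Dy' t01'].
  case: a => [|[|a]] /= T tE; last by move: tE t01 t01'; rewrite -addn2 natrD; have := ler0n R a; lra.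
    move: T; rewrite tE addr0 => /(twist_inj t01) ->; left.
    by [].
  right; have t0 : t = 0 by move: tE t01 t01'; lra.
  have t1 : t' = 1 by move: tE t01 t01'; lra.
  have T1 := congr1 (fun u => twist r (y', u)) t1.
  have T0 := congr1 (fun u => iter (1 * (2 * r)) (@rot R n) (twist r (y, u))) t0.
  have := etrans (esym T1) (etrans T T0); rewrite mul1n => {}T.
  split; last by clear T; split; [exact: t0|exact: t1].
  symmetry; apply: (@rot_inj _ _ (2 * r)).
  apply: etrans (esym (twist1 r y')) _; apply: etrans T _.
  exact: congr1 (twist0 r y).
have phiE i : cyl_lift m r k' i = cyl_lift m r k i + (q * (2 * r)%N%:Z)%:~R.
  by rewrite jE jq; congr (_ + _%:~R); lia.
case: q jq phiE => a _ phiE.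
  have H i : cyl_lift m r k' i = cyl_lift m r k i + (a * (2 * r))%:R.
    by rewrite phiE -PoszM.
  case: (fin k k' a Kk Kk' H) => [e|[e1 [e2 e3]]]; first exact: (or_introl e).
  exact: (or_intror (conj e1 (or_introl (conj e2 e3)))).
have H i : cyl_lift m r k i = cyl_lift m r k' i + (a.+1 * (2 * r))%:R.
  by rewrite phiE NegzE mulNr rmorphN /= -PoszM subrK.
case: (fin k' k a.+1 Kk' Kk H) => [e|[e1 [e2 e3]]]; first exact: (or_introl (esym e)).
exact: (or_intror (conj (esym e1) (or_intror (conj e3 e2)))).
Qed.

Lemma cyl_map_continuous (R : realType) (n m r : nat) (c : int -> R) :
  {within cylinder m, continuous (@cyl_map R n m r c)}.
Proof.
apply/subspace_continuousP => k Kk.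
have lc i : cyl_lift m r l i @[l --> within (cylinder m) (nbhs k)] --> cyl_lift m r k i.
  set s : R := (2 * r)%:R * (m%:R / n.+1%:R + 1).
  apply/cvgrPdist_le => e e0; have e20 : 0 < e / 2 by rewrite divr_gt0.
  have tc := @twist_continuous R n r k Kk.2.
  have sc : {for k, continuous (fun l : 'rV[R]_n.+1 * R => l.2 * s)}.
    by apply: cvgMr_tmp; exact: cvg_snd.
  have jc j : {for k, continuous (fun l => twist r l 0 j)}.
    exact: continuous_comp tc (@coord_continuous _ _ _ _ _ _).
  have H1 : \forall l \near k, `|k.2 * s - l.2 * s| <= e / 2.
    by move/cvgrPdist_le : sc; apply.
  have H2 : \forall l \near k, forall j, `|twist r k 0 j - twist r l 0 j| <= e / 2.
    by apply: (@filter_forall _ _ _ (nbhs k)) => j; move/cvgrPdist_le : (jc j); apply.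
  rewrite near_withinE; near=> l => Kl; rewrite (splitr e); apply: dev_lift_dist.
  - exact: twist_simplex.
  - exact: twist_simplex.
  - by near: l.
  - by near: l.
move=> A [P PN PA]; rewrite nbhs_simpl /=.
suff : \forall l \near within (cylinder m) (nbhs k), forall j, P 0 j (cyl_map m r c l 0 j).
  apply: (@filterS _ (within (cylinder m) (nbhs k))) => l Pl.
  by apply: PA => i j; rewrite ord1; exact: Pl.
apply: (@filter_forall _ _ _ (within (cylinder m) (nbhs k))) => j.
have zc : zeta c (cyl_lift m r l j%:Z) @[l --> within (cylinder m) (nbhs k)] -->
    zeta c (cyl_lift m r k j%:Z).
  exact: cvg_comp (lc j%:Z) (@zeta_continuous _ c _).
have PNj : nbhs (zeta c (cyl_lift m r k j%:Z)) (P 0 j) by rewrite -cyl_mapE; exact: PN.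
apply: (@filterS _ (within (cylinder m) (nbhs k)) _ _ _ _ (zc _ PNj)) => l /=.
by rewrite cyl_mapE.
Unshelve. all: by end_near.
Qed.

Lemma cylinder_compact (R : realType) (n m : nat) : compact (@cylinder R n m).
Proof.
have -> : @cylinder R n m = (@dev_simplex R n m `*` `[0, 1]%classic).
  by apply/seteqP; split=> -[y t] /= [Dy]; rewrite ?in_itv.
apply: compact_setX; last exact: segment_compact.
apply: bounded_closed_compact.
  exists (n.+2%:R * (m%:R / n.+1%:R)); split; first exact: num_real.
  move=> M HM y /dev_simplexE[_ gy] /=; rewrite [leLHS]/Num.norm /= mx_normrE; apply: bigmax_le.
    by rewrite (le_trans _ (ltW HM))// mulr_ge0 ?divr_ge0.
  move=> [i j] _ /=; rewrite ord1 (le_trans (gauge_bound _ _))// (le_trans _ (ltW HM))//.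
  by rewrite ler_wpM2l.
have coord (j : 'I_n.+1) : continuous (fun y : 'rV[R]_n.+1 => y 0 j) by exact: coord_continuous.
have -> : @dev_simplex R n m = (fun y : 'rV[R]_n.+1 => \sum_j y 0 j) @^-1` [set 0] `&`
    \bigcap_(j in [set: 'I_n.+1]) (fun y : 'rV[R]_n.+1 => y 0 j - y 0 (ordS j)) @^-1` [set x | x <= m%:R / n.+1%:R].
  by apply/seteqP; split=> y [y0 yj]; split=> // j; [move=> _; exact: yj|exact: (yj j I)].
apply: closedI.
  apply: preimage_closed; last exact: closed_eq.
  by move=> y _; apply: sum_continuous => j; exact: (coord j y).
apply: closed_bigI => j _; apply: preimage_closed; last exact: closed_le.
by move=> y _; exact: cvgB (coord j y) (coord (ordS j) y).
Qed.

Lemma cylinder_connected (R : realType) (n m : nat) : connected (@cylinder R n m).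
Proof.
(* The cylinder is star-shaped about [(0, 0)]. *)
pose ray (k : 'rV[R]_n.+1 * R) (s : R) := (s *: k.1, s * k.2).
have -> : @cylinder R n m = \bigcup_(k in cylinder m) (ray k @` `[0, 1]%classic).
  apply/seteqP; split=> [[y t] K|k [[y t] [/= [y0 yj] t01]] [s /= s01 <-]].
    by exists (y, t) => //; exists 1; rewrite /= ?in_itv /= ?ler01 ?lexx// /ray /= scale1r mul1r.
  rewrite in_itv /= in s01; split=> /=.
    split=> [|j]; first by under eq_bigr do rewrite mxE; rewrite -mulr_sumr y0 mulr0.
    rewrite !mxE -mulrBr; have := yj j; have : 0 <= m%:R / n.+1%:R :> R by rewrite divr_ge0.
    by move: (m%:R / _) => q; nra.
  by nra.
apply: bigcup_connected.
  exists (0, 0) => k Kk; exists 0; first by rewrite /= in_itv /= lexx ler01.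
  by rewrite /ray scale0r mul0r.
move=> k _; apply: connected_continuous_connected; first exact: segment_connected.
apply: continuous_subspaceT => s.
have idc : {for s, continuous (@id R)} by exact: cvg_id.
have c1 : {for s, continuous (fun u : R => u *: k.1)} by exact: (cvgZr_tmp idc).
have c2 : {for s, continuous (fun u : R => u * k.2)} by exact: (cvgMr_tmp idc).
exact: cvg_pair c1 c2.
Qed.

(** * Cellular strings as lifts with half-integral values *)

Definition alt (R : realType) (k : int) : R := if (2 %| k)%Z then -1 else 1.

Lemma alt_even (R : realType) (k : int) : alt R (2 * k) = -1.
Proof. by rewrite /alt dvdz_mulr. Qed.

Lemma alt_odd (R : realType) (k : int) : alt R (2 * k + 1) = 1.
Proof. by rewrite /alt; case: ifP => //; lia. Qed.

Lemma altS (R : realType) (k : int) : alt R (k + 1) = - alt R k.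
Proof.
by rewrite /alt; case: ifP => h1; case: ifP => h2; rewrite ?opprK//; move: h1 h2; lia.
Qed.

Lemma alt_alternating (R : realType) : alternating (@alt R).
Proof.
by move=> k; rewrite alt_even alt_odd (_ : 2 * k - 1 = 2 * (k - 1) + 1) ?alt_odd; [split; lra|lia].
Qed.

Lemma alt_periodic (R : realType) (k l : int) : alt R (k + 2 * l) = alt R k.
Proof.
by rewrite /alt; case: ifP => h1; case: ifP => h2 //; move: h1 h2; lia.
Qed.

Lemma zeta_altE (R : realType) (x : R) :
  zeta (@alt R) x = alt R (Num.floor x) * (1 - 2 * (x - (Num.floor x)%:~R)).
Proof. by rewrite /zeta altS; ring. Qed.

(** For the alternating word the knots are the extreme values -1 and 1, attained only at integers of
    the matching parity. *)
Lemma zeta_alt_int (R : realType) (x : R) (k : int) :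
  zeta (@alt R) x = alt R k -> exists2 l : int, x = l%:~R & (2 %| l - k)%Z.
Proof.
rewrite zeta_altE; have := floor_itv x; move: (Num.floor x) => l; rewrite rmorphD /=.
move=> /andP[lx xl]; have [le|ne] := boolP (2 %| l - k)%Z.
  have -> : alt R l = alt R k.
    by rewrite -(alt_periodic R k ((l - k) %/ 2)%Z); congr alt; lia.
  have : alt R k != 0 by rewrite /alt; case: ifP => _; rewrite ?oppr_eq0 oner_eq0.
  move=> a0 /eqP; rewrite -[X in _ == X]mulr1 => /eqP /(mulfI a0) E.
  by exists l => //; lra.
have -> : alt R l = - alt R k.
  by rewrite -(alt_periodic R l ((k + 1 - l) %/ 2)%Z) -altS; congr alt; lia.
move=> E; have : alt R k != 0 by rewrite /alt; case: ifP => _; rewrite ?oppr_eq0 oner_eq0.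
move=> a0; have : alt R k * (2 * (x - l%:~R) - 1) = alt R k * 1 by rewrite mulr1 -[RHS]E; ring.
by move=> /(mulfI a0); lra.
Qed.

(** Bits are placed at the two extreme heights and [X] at mid-height, so that a cellular string
    becomes a point of the curve whose lift is integral at bits and half-integral at [X]. *)
Definition sym_val (R : realType) (a : sym) : R :=
  if a == S0 then -1 else if a == S1 then 1 else 0.

Definition str_vec (R : realType) (N : nat) (s : N.+1.-tuple sym) : 'rV[R]_N.+1 :=
  \row_i sym_val R (tnth s i).

Definition sym_at (N : nat) (s : N.+1.-tuple sym) (i : int) : sym := tnth s (cyc N i).

Lemma symP (a : sym) : [\/ a = S0, a = S1 | a = SX].
Proof.
by case: a => -[|[|[|//]]] a3; [apply: Or31|apply: Or32|apply: Or33]; apply: val_inj.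
Qed.

Lemma sym_val_inj (R : realType) : injective (@sym_val R).
Proof.
by move=> a b; case: (symP a) => ->; case: (symP b) => -> //; rewrite /sym_val /= => ?; exfalso; lra.
Qed.

Lemma unroll_str_vec (R : realType) (N : nat) (s : N.+1.-tuple sym) (i : int) :
  unroll (str_vec R s) i = sym_val R (sym_at s i).
Proof. by rewrite /unroll mxE. Qed.

Lemma satE (N : nat) (s : N.+1.-tuple sym) (k : nat) : sat s k = sym_at s k%:Z.
Proof.
rewrite /sat /sym_at (tnth_nth SX); congr nth; apply/eqP.
by rewrite -eqz_nat cycE modz_nat.
Qed.

Lemma sat_pred (N : nat) (s : N.+1.-tuple sym) (k : nat) :
  sat s (k + N.+1 - 1) = sym_at s (k%:Z - 1).
Proof.
have e : (k + N.+1 - 1)%N%:Z = k%:Z - 1 + N.+1%:Z by lia.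
by rewrite satE e /sym_at cyc_addN.
Qed.

Lemma all_sym_at (N : nat) (s : N.+1.-tuple sym) (a : sym) :
  all (pred1 a) s -> forall i, sym_at s i = a.
Proof. by move=> /all_tnthP sa i; apply/eqP; exact: sa. Qed.

Lemma lift_even_pred (R : realType) (N L : nat) (phi : int -> R) (i k : int) :
  lift N L phi -> phi i = (2 * k)%:~R ->
  (phi (i - 1) < phi i <-> ~ exists l : int, phi (i - 1) = (2 * l)%:~R).
Proof.
move=> lp ik; split=> [lt [l il]|ne].
  have : phi (i - 1) < (2 * k - 1)%:~R.
    by move: lt; rewrite il ik !ltr_int; lia.
  by move=> /(lift_skip lp); rewrite subrK ik ler_int; lia.
rewrite lt_neqAle (lift_mono lp) ?andbT; last lia.
by apply/eqP => e; apply: ne; exists k; rewrite e.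
Qed.

(** A block of [a] starts exactly where the lift first arrives at an even integer: between two
    different even values an odd one would be attained, so consecutive symbols [a] lie on one
    plateau. *)
Lemma nblocks_lift (R : realType) (N L : nat) (s : N.+1.-tuple sym) (a : sym) (phi : int -> R) :
  lift N.+1 (2 * L) phi ->
  (forall i, sym_at s i = a <-> exists k : int, phi i = (2 * k)%:~R) ->
  (exists i, sym_at s i != a) -> nblocks a s = L.
Proof.
move=> lp sE [i0 si0]; rewrite /nblocks; case: ifP => [/all_sym_at sa|_].
  by move: si0; rewrite sa eqxx.
apply: (lift_count_even lp) => i; rewrite inE /= satE sat_pred; split.
  move=> /andP[/eqP si /eqP si1]; have [k ik] := (sE _).1 si.
  by split; [apply/(lift_even_pred lp ik) => /sE|exists k].
move=> [lt [k ik]]; apply/andP; split; first by apply/eqP/sE; exists k.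
by apply/eqP => /sE; apply/(lift_even_pred lp ik).
Qed.

Lemma sym_val_alt (R : realType) (a : sym) (k : int) :
  sym_val R a = alt R k <-> a = if (2 %| k)%Z then S0 else S1.
Proof.
have -> : alt R k = sym_val R (if (2 %| k)%Z then S0 else S1).
  by rewrite /alt; case: ifP; rewrite /sym_val.
by split=> [/sym_val_inj|->].
Qed.

Lemma str_lift_bit (R : realType) (N : nat) (s : N.+1.-tuple sym) (phi : int -> R) (i k : int) :
  (forall i, unroll (str_vec R s) i = zeta (@alt R) (phi i)) ->
  phi i = k%:~R -> sym_at s i = if (2 %| k)%Z then S0 else S1.
Proof.
by move=> sE ik; apply/(sym_val_alt R); rewrite -unroll_str_vec sE ik zeta_int.
Qed.

Lemma str_lift_int (R : realType) (N : nat) (s : N.+1.-tuple sym) (phi : int -> R) (i : int) :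
  (forall i, unroll (str_vec R s) i = zeta (@alt R) (phi i)) ->
  sym_at s i != SX -> exists2 k : int, phi i = k%:~R &
    sym_at s i = if (2 %| k)%Z then S0 else S1.
Proof.
move=> sE; have := sE i; rewrite unroll_str_vec => e sX.
have [k kE] : exists k : int, sym_at s i = if (2 %| k)%Z then S0 else S1.
  by case: (symP (sym_at s i)) sX => -> // _; [exists 0|exists 1].
have ek : zeta (@alt R) (phi i) = alt R k by rewrite -e; apply/sym_val_alt.
have [l il _] := zeta_alt_int ek; exists l => //; exact: str_lift_bit sE il.
Qed.

Lemma str_lift_even (R : realType) (N : nat) (s : N.+1.-tuple sym) (phi : int -> R) (i : int) :
  (forall i, unroll (str_vec R s) i = zeta (@alt R) (phi i)) ->
  sym_at s i = S0 <-> exists k : int, phi i = (2 * k)%:~R.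
Proof.
move=> sE; split=> [s0|[k ik]].
  have [|l il] := str_lift_int (i := i) sE; first by rewrite s0.
  rewrite s0; case: ifP => // l2 _; exists (l %/ 2)%Z; rewrite il; congr _%:~R; lia.
by rewrite (str_lift_bit sE ik) dvdz_mulr.
Qed.

Lemma str_lift_odd (R : realType) (N : nat) (s : N.+1.-tuple sym) (phi : int -> R) (i : int) :
  (forall i, unroll (str_vec R s) i = zeta (@alt R) (phi i)) ->
  sym_at s i = S1 <-> exists k : int, phi i + 1 = (2 * k)%:~R.
Proof.
move=> sE; split=> [s0|[k ik]].
  have [|l il] := str_lift_int (i := i) sE; first by rewrite s0.
  rewrite s0; case: ifP => // l2 _; exists ((l + 1) %/ 2)%Z.
  by rewrite il -[1]/(1%:~R) -intrD; congr _%:~R; lia.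
have il : phi i = (2 * k - 1)%:~R by move: ik; rewrite rmorphB /=; lra.
by rewrite (str_lift_bit sE il); case: ifP => //; lia.
Qed.

Lemma lift_nblocks (R : realType) (N M : nat) (s : N.+1.-tuple sym) (phi : int -> R) :
  lift N.+1 (2 * M) phi ->
  (forall i, unroll (str_vec R s) i = zeta (@alt R) (phi i)) ->
  nblocks S0 s = M /\ nblocks S1 s = M.
Proof.
move=> lp sE; split.
  apply: (nblocks_lift lp (fun i => str_lift_even i sE)).
  have [_ _ /(_ 1) [i i1]] := lp; exists i.
  by rewrite (str_lift_bit sE i1).
(* Translation by 1 turns odd integers into even ones, so the same count applies to the blocks of
   symbol 1. *)
apply: (nblocks_lift (lift_shift 1 lp) (fun i => str_lift_odd i sE)).
have [_ _ /(_ 0) [i i0]] := lp; exists i.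
by rewrite (str_lift_bit sE i0).
Qed.

(** Where the lift is an integer the symbol is a bit, so along an [X]-block the lift is trapped
    strictly between consecutive integers [p] and [p + 1]; the neighbouring bits sit at these two
    and differ. *)
Lemma lift_cellular (R : realType) (N M : nat) (s : N.+1.-tuple sym) (phi : int -> R) :
  lift N.+1 (2 * M) phi ->
  (forall i, unroll (str_vec R s) i = zeta (@alt R) (phi i)) -> cellular M s.
Proof.
move=> lp sE; have [n0 n1] := lift_nblocks lp sE.
rewrite /cellular n0 n1 eqxx /=; apply/andP; split.
  apply/negP => /all_sym_at sX; have [_ _ /(_ 0) [i i0]] := lp.
  by have := sX i; rewrite (str_lift_bit sE i0).
apply/forallP => i; apply/forallP => l; apply/implyP => /and3P[].
rewrite sat_pred satE => spred /forallP smid ssucc.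
have {}smid (k : nat) : (k <= l)%N -> sym_at s (i%:Z + k%:Z) = SX.
  move=> kl; have kN : (k < N.+1)%N by apply: leq_ltn_trans (ltn_ord l).
  by have /implyP/(_ kl)/eqP := smid (Ordinal kN); rewrite satE PoszD.
have [p ip sp] := str_lift_int sE spred.
have mid (k : nat) : (k <= l)%N -> p%:~R < phi (i%:Z + k%:Z) < (p + 1)%:~R.
  move=> kl; rewrite -(rwP andP); split.
    rewrite lt_neqAle -ip (lift_mono lp) ?andbT; last lia.
    apply/eqP => e; have := smid k kl; rewrite (str_lift_bit sE (esym (etrans (esym ip) e))).
    by case: ifP.
  have : phi (i%:Z + k%:Z) <= (p + 1)%:~R.
    elim: k kl => [|k IH] kl.
      have := @lift_skip _ _ _ _ lp (i%:Z - 1) (p + 1).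
      by rewrite subrK addr0 ip; apply; rewrite ltr_int; lia.
    have -> : i%:Z + k.+1%:Z = i%:Z + k%:Z + 1 by lia.
    apply: (lift_skip lp); rewrite lt_neqAle IH ?andbT; last by lia.
    apply/eqP => e; have := smid k (ltnW kl); rewrite (str_lift_bit sE e).
    by case: ifP.
  rewrite le_eqVlt => /orP[/eqP e|//].
  by have := smid k kl; rewrite (str_lift_bit sE e); case: ifP.
have [q iq sq] := str_lift_int sE ssucc; rewrite sq.
have e : (i + l + 1)%N%:Z = i%:Z + l%:Z + 1 by lia.
have /andP[pl lp1] := mid l (leqnn l).
have qp : q <= p + 1.
  by rewrite -(ler_int R) -iq e; exact: lift_skip lp _ _ lp1.
have pq : p < q.
  rewrite -(ltr_int R) (lt_le_trans pl)// -iq e; apply: (lift_mono lp); lia.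
have -> : q = p + 1 by lia.
by rewrite sp; case: ifP => h1; case: ifP => h2 //; move: h1 h2; lia.
Qed.

Lemma xblocks_neighbours (N : nat) (s : N.+1.-tuple sym) (a b : int) :
  xblocks_ok s -> a < b -> b <= a + N.+1%:Z ->
  sym_at s (a - 1) != SX -> sym_at s b != SX ->
  (forall i, a <= i -> i < b -> sym_at s i = SX) -> sym_at s (a - 1) != sym_at s b.
Proof.
move=> /andP[_ /forallP ok] ab bN sa sb mid.
have [l bE] : exists l : nat, b = a + (l%:Z + 1) by exists (absz (b - 1 - a)%R); lia.
have lN : (l < N.+1)%N by lia.
have /forallP/(_ (Ordinal lN))/implyP := ok (cyc N a).
have e (k : int) : sym_at s ((cyc N a)%:Z + k) = sym_at s (a + k).
  have [q aE] := cycP N a; rewrite /sym_at [in RHS]aE addrAC.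
  by rewrite cyc_addM.
rewrite sat_pred !satE /= !PoszD -!addrA !e -bE.
apply; rewrite sa sb /= andbT; apply/forallP => k; apply/implyP => kl.
rewrite satE PoszD e mid//; lia.
Qed.

Lemma str_const_X (N : nat) (s : N.+1.-tuple sym) : (exists i, sym_at s i != sym_at s (i + 1)) \/
  forall i, sym_at s i = sym_at s 0.
Proof.
have [?|ne] := pselect (exists i, sym_at s i != sym_at s (i + 1)); [by left|right].
have E i : sym_at s i = sym_at s (i + 1).
  by apply/eqP/negPn/negP => si; apply: ne; exists i.
by apply: (@int_step_ind _ 0) => // i; rewrite -E.
Qed.

Lemma nblocks_const (N : nat) (s : N.+1.-tuple sym) (a b : sym) :
  (forall i, sym_at s i = a) -> a != b -> nblocks b s = 0%N.
Proof.
move=> sa ab; rewrite /nblocks; case: ifP => [/all_sym_at/(_ 0)|_].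
  by rewrite sa => e; move: ab; rewrite e eqxx.
by apply: eq_card0 => i; rewrite inE /= satE sa (negbTE ab).
Qed.

(** A lift with some word [c] exists because the string is not constant. A knot of height 0 would be
    an [X]-block between two equal bits, so all knots are -1 or 1 and [c] is [alt]; counting blocks
    then gives [L = M]. *)
Lemma cellular_lift (R : realType) (N M : nat) (s : N.+1.-tuple sym) : (0 < M)%N ->
  cellular M s -> exists2 phi, lift N.+1 (2 * M) phi &
    forall i, unroll (str_vec R s) i = zeta (@alt R) (phi i).
Proof.
move=> M0 /and3P[/eqP n0 /eqP n1 ok].
set w := unroll (str_vec R s).
have [|L [c [phi [L0 lp ac wE]]]] := @lift_exists R N.+1 w isT (unroll_periodic _).
  have [[i ne]|const] := str_const_X s.
    by exists i; rewrite /w !unroll_str_vec; apply: contraNneq ne => /sym_val_inj ->.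
  case: (symP (sym_at s 0)) => e.
  - by move: M0; rewrite -n1 (@nblocks_const _ s S0) // => i; rewrite const e.
  - by move: M0; rewrite -n0 (@nblocks_const _ s S1) // => i; rewrite const e.
  - by move: M0; rewrite -n0 (@nblocks_const _ s SX) // => i; rewrite const e.
have wval i : [\/ w i = -1, w i = 1 | w i = 0].
  rewrite /w unroll_str_vec; case: (symP (sym_at s i)) => ->; rewrite /sym_val /=;
  by [apply: Or31|apply: Or32|apply: Or33].
have cval k : [\/ c k = -1, c k = 1 | c k = 0].
  by have [_ _ /(_ k) [i ik]] := lp; rewrite -zeta_int -ik -wE.
have w0 i : w i = 0 -> sym_at s i = SX.
  rewrite /w unroll_str_vec -[0]/(sym_val R SX) => /sym_val_inj //.
have c_ne0 k : c k <> 0.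
  move=> ck; have [a ak ak1] := lift_first lp k.
  have [| | |b kb /negP nkb] := @int_least (fun j => k%:~R < phi j).
  - by move=> j jk; apply: lt_le_trans jk _; case: lp.
  - by have [_ _ /(_ (k + 1)) [j jk]] := lp; exists j; rewrite jk ltr_int; lia.
  - by exists a; rewrite ak ltxx.
  rewrite -leNgt in nkb.
  have ab : a < b by rewrite ltNge; apply/negP => /(lift_mono lp); rewrite ak leNgt kb.
  have bk1 : phi b <= (k + 1)%:~R.
    by have := @lift_skip _ _ _ _ lp (b - 1) (k + 1); rewrite subrK; apply;
      apply: le_lt_trans nkb _; rewrite ltr_int; lia.
  have ak2 : (k - 1)%:~R <= phi (a - 1).
    rewrite leNgt; apply/negP => /(lift_skip lp); rewrite subrK ak ler_int; lia.
  (* The vertices on either side of the plateau of an extremal value 0 lie on the same side of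
     it. *)
  have signs : 0 < w b /\ 0 < w (a - 1) \/ w b < 0 /\ w (a - 1) < 0.
    have [k2|k2] := boolP (2 %| k)%Z; [left|right].
      have kE : 2 * (k %/ 2)%Z = k by lia.
      split; rewrite wE -ck -(zeta_int c k).
        by apply: (@zeta_incr _ _ (k %/ 2)%Z) => //; rewrite kE.
      by apply: (@zeta_decr _ _ (k %/ 2)%Z) => //; rewrite kE.
    have kE : 2 * ((k + 1) %/ 2)%Z = k + 1 by lia.
    have kE' : 2 * (k %/ 2)%Z = k - 1 by lia.
    split; rewrite wE -ck -(zeta_int c k).
      by apply: (@zeta_decr _ _ ((k + 1) %/ 2)%Z) => //; rewrite kE ?addrK.
    by apply: (@zeta_incr _ _ (k %/ 2)%Z) => //; rewrite kE' ?subrK.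
  have nX i : w i <> 0 -> sym_at s i != SX.
    by move=> wi; apply/eqP => e; apply: wi; rewrite /w unroll_str_vec e.
  have : sym_at s (a - 1) != sym_at s b.
    apply: xblocks_neighbours => //.
    - rewrite leNgt; apply/negP => baN.
      have : phi (a + N.+1%:Z) <= phi (b - 1) by apply: (lift_mono lp); lia.
      have [_ pN _] := lp; rewrite pN ak => /le_trans /(_ nkb).
      by rewrite gerDl leNgt ltr0n muln_gt0 L0.
    - by apply: nX; case: signs => -[]; lra.
    - by apply: nX; case: signs => -[]; lra.
    - move=> i ai ib; apply: w0; rewrite wE.
      have -> : phi i = k%:~R; last by rewrite zeta_int.
      apply/eqP; rewrite eq_le -{2}ak (lift_mono lp)// andbT.
      by apply: le_trans nkb; apply: (lift_mono lp); lia.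
  move/negP; apply; apply/eqP; apply: (@sym_val_inj R).
  rewrite -!unroll_str_vec -/w.
  by case: signs => -[l1 l2]; move: l1 l2; case: (wval b) => ->; case: (wval (a - 1)) => -> //; lra.
have cE : c = @alt R.
  apply/funext => k; have [k2|k2] := boolP (2 %| k)%Z.
    have [l1 _] := ac (k %/ 2)%Z; have kE : 2 * (k %/ 2)%Z = k by lia.
    rewrite kE in l1; rewrite /alt k2; have := c_ne0 k.
    by case: (cval k) l1 => -> //; case: (cval (k + 1)) => -> //; lra.
  have [_ l1] := ac ((k + 1) %/ 2)%Z; have kE : 2 * ((k + 1) %/ 2)%Z = k + 1 by lia.
  rewrite kE addrK in l1; rewrite /alt (negbTE k2); have := c_ne0 k.
  by case: (cval k) l1 => -> //; case: (cval (k + 1)) => -> //; lra.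
rewrite cE in wE; exists phi => //.
by have [e _] := lift_nblocks lp wE; rewrite -n0 e.
Qed.

(** * Comparable strings and compatible lifts *)

Definition refines (N : nat) (s' s : N.+1.-tuple sym) : Prop :=
  forall i, tnth s i != SX -> tnth s' i = tnth s i.

Lemma refinesP (N : nat) (s' s : N.+1.-tuple sym) :
  refines s' s <-> s' == s \/ str_lt s' s.
Proof.
split=> [r|[/eqP -> //|/andP[/forallP lt _] i si]]; last first.
  by have /orP[/eqP//|/andP[_ sX]] := lt i; rewrite sX in si.
have [?|ne] := eqVneq s' s; [by left|right; rewrite /str_lt ne andbT].
apply/forallP => i; have [//|e /=] := eqVneq (tnth s' i) (tnth s i).
have sX : tnth s i = SX by apply/eqP/negPn/negP => /r si; rewrite si eqxx in e.
by rewrite sX eqxx andbT -sX.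
Qed.

Lemma str_comparableP (N : nat) (s t : N.+1.-tuple sym) :
  str_comparable s t <-> refines s t \/ refines t s.
Proof.
rewrite !refinesP /str_comparable; split=> [/or3P[]|[[]|[]]].
- by left; left.
- by left; right.
- by right; right.
- by move=> ->.
- by move=> ->; rewrite orbT.
- by rewrite eq_sym => ->.
- by move=> ->; rewrite !orbT.
Qed.

Lemma refines_at (N : nat) (s' s : N.+1.-tuple sym) (i : int) : refines s' s ->
  sym_at s i != SX -> sym_at s' i = sym_at s i.
Proof. by move=> r; exact: r. Qed.

Lemma lift_addM (R : realType) (N m : nat) (phi : int -> R) (i : int) (a : nat) : lift N m phi ->
  phi (i + a%:Z * N%:Z) = phi i + m%:R *+ a.
Proof. by move=> [_ pN _]; exact: periodic_mul. Qed.

(** Once [phi0] is translated to agree with [phi] at one vertex, the bounds spread outwards. Where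
    [phi] reaches [k], [s] has a bit that [s'] shares, so [phi'] is an integer of the parity of [k]
    there; being at least [k - 1] it is at least [k], and symmetrically to the left. *)
Lemma chain_lift (R : realType) (N M : nat) (s' s : N.+1.-tuple sym) (phi phi0 : int -> R) :
  refines s' s ->
  lift N.+1 (2 * M) phi -> (forall i, unroll (str_vec R s) i = zeta (@alt R) (phi i)) ->
  lift N.+1 (2 * M) phi0 -> (forall i, unroll (str_vec R s') i = zeta (@alt R) (phi0 i)) ->
  exists phi', [/\ lift N.+1 (2 * M) phi',
    forall i, unroll (str_vec R s') i = zeta (@alt R) (phi' i) &
    forall i (k : int), (k%:~R <= phi i -> k%:~R <= phi' i) /\ (phi i <= k%:~R -> phi' i <= k%:~R)].
Proof.
move=> r lp sE lp0 sE0.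
have bit (psi : int -> R) (i k : int) :
    (forall i, unroll (str_vec R s') i = zeta (@alt R) (psi i)) -> phi i = k%:~R ->
    exists2 l : int, psi i = l%:~R & (2 %| l - k)%Z.
  move=> psiE ik; apply: zeta_alt_int; rewrite -psiE unroll_str_vec.
  have sk := str_lift_bit sE ik; rewrite (refines_at r); last by rewrite sk; case: ifP.
  by apply/sym_val_alt.
have [_ _ /(_ 0) [i0 i00]] := lp.
have [l il l2] := bit phi0 i0 0 sE0 i00.
pose phi' i := phi0 i + (- l)%:~R.
have lp' : lift N.+1 (2 * M) phi' by exact: lift_shift.
have sE' i : unroll (str_vec R s') i = zeta (@alt R) (phi' i).
  rewrite sE0 /phi' zeta_shift// => k.
  by rewrite -(alt_periodic R k (- l %/ 2)%Z); congr alt; lia.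
have i00' : phi' i0 = 0 by rewrite /phi' il rmorphN /= subrr.
have up i : i0 <= i -> forall k : int, k%:~R <= phi i -> k%:~R <= phi' i.
  apply: (@int_up_ind (fun i => forall k : int, k%:~R <= phi i -> k%:~R <= phi' i)).
    by move=> k; rewrite i00' i00.
  move=> j _ IH k kj.
  have [kj'|jk] := leP k%:~R (phi j); first by rewrite (le_trans (IH k kj'))//; apply: (lift_mono lp'); lia.
  have k1j : (k - 1)%:~R <= phi j.
    by rewrite leNgt; apply/negP => /(lift_skip lp) /(le_trans kj); rewrite ler_int; lia.
  have jk' : phi (j + 1) = k%:~R by apply/eqP; rewrite eq_le kj (lift_skip lp).
  have [q jq q2] := bit phi' (j + 1) k sE' jk'.
  have : (k - 1)%:~R <= phi' (j + 1).
    by rewrite (le_trans (IH _ k1j))//; apply: (lift_mono lp'); lia.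
  by rewrite jq !ler_int; lia.
have dn i : i <= i0 -> forall k : int, phi i <= k%:~R -> phi' i <= k%:~R.
  move=> ii0; have : - i0 <= - i by lia.
  rewrite -{2 3}(opprK i).
  move: (- i); apply: (@int_up_ind (fun i => forall k : int, phi (- i) <= k%:~R -> phi' (- i) <= k%:~R)).
    by move=> k; rewrite opprK i00' i00.
  move=> j _ IH k jk; set i1 := - (j + 1).
  have ji1 : - j = i1 + 1 by rewrite /i1; lia.
  rewrite ji1 in IH; rewrite -/i1 in jk.
  have [jk'|kj] := leP (phi (i1 + 1)) k%:~R.
    by rewrite (le_trans _ (IH k jk'))//; apply: (lift_mono lp'); lia.
  have jk1 : phi i1 = k%:~R.
    apply/eqP; rewrite eq_le jk /=; have [_ _ /(_ k) [a ak]] := lp.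
    rewrite -ak; apply: (lift_mono lp); have [//|a1] := leP a i1.
    by move: kj; rewrite -ak ltNge (lift_mono lp)//; lia.
  have jk2 : phi (i1 + 1) <= (k + 1)%:~R.
    by apply: (lift_skip lp); rewrite jk1 ltr_int; lia.
  have [q jq q2] := bit phi' i1 k sE' jk1.
  have : phi' i1 <= (k + 1)%:~R.
    by rewrite (le_trans _ (IH _ jk2))//; apply: (lift_mono lp'); lia.
  by rewrite jq !ler_int; lia.
(* Lower bounds were obtained to the right of [i0] and upper bounds to the left; whole turns move
   any position to the required side. *)
have far (i : int) : exists a : nat, `|i - i0| <= a%:Z * N.+1%:Z.
  exists `|i - i0|%N; rewrite -[X in X <= _]mulr1 abszE ler_pM//.
exists phi'; split=> // i k; have [a ia] := far i.
pose S : int := (2 * M)%N%:Z * a%:Z.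
have SE : S%:~R = (2 * M)%:R *+ a :> R by rewrite /S intrM -mulr_natr.
split=> ik.
  have := up (i + a%:Z * N.+1%:Z) _ (k + S).
  rewrite (lift_addM _ _ lp) (lift_addM _ _ lp') rmorphD /= SE !lerD2r.
  by apply => //; lia.
have := dn (i - a%:Z * N.+1%:Z) _ (k - S).
have := lift_addM (i - a%:Z * N.+1%:Z) a lp; have := lift_addM (i - a%:Z * N.+1%:Z) a lp'.
rewrite subrK -SE rmorphB /= => e1 e2 H.
have : phi' (i - a%:Z * N.+1%:Z) <= k%:~R - S%:~R.
  by apply: H; [lia|move: e2; lra].
by move: e1; lra.
Qed.

(** * The realization of the string poset as a space of curves *)

Definition str_point (R : realType) (N : nat) (p : 'rV[R]_#|{: N.+1.-tuple sym}|) : 'rV[R]_N.+1 :=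
  \row_i \sum_j p 0 j * sym_val R (tnth (enum_val j) i).

Lemma unroll_str_point (R : realType) (N : nat) (p : 'rV[R]_#|{: N.+1.-tuple sym}|) (i : int) :
  unroll (str_point p) i = \sum_j p 0 j * sym_val R (sym_at (enum_val j) i).
Proof. by rewrite /unroll mxE. Qed.

Definition num_X (N : nat) (s : N.+1.-tuple sym) : nat :=
  #|[pred i | tnth s i == SX]|.

Lemma refines_num_X (N : nat) (s t : N.+1.-tuple sym) : refines s t ->
  (num_X s <= num_X t)%N /\ ((num_X t <= num_X s)%N -> s = t).
Proof.
move=> r; have sub : [pred i | tnth s i == SX] \subset [pred i | tnth t i == SX].
  apply/fintype.subsetP => i; rewrite !inE => /eqP si; apply/negPn/negP => ti.
  by move: (ti); rewrite -(r i ti) si eqxx.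
split=> [|le]; first exact: subset_leq_card.
have E : [pred i | tnth s i == SX] =i [pred i | tnth t i == SX].
  by apply/subset_cardP => //; apply/eqP; rewrite eqn_leq subset_leq_card.
apply: eq_from_tnth => i; have := E i; rewrite !inE.
have [->|ti _] := eqVneq (tnth t i) SX; first by move/eqP.
exact: r.
Qed.

Lemma realization_top (R : realType) (N M : nat) (p : 'rV[R]_#|{: N.+1.-tuple sym}|) :
  str_realization M p -> exists2 j, p 0 j != 0 &
  forall l, p 0 l != 0 -> refines (enum_val l) (enum_val j).
Proof.
move=> [p0 p1 _ pc]; have [j0 pj0] : exists j, p 0 j != 0.
  apply: contrapT => no; move/eqP: p1; rewrite big1 ?(eq_sym 0) ?oner_eq0// => j _.
  by apply/eqP/negPn/negP => pj; apply: no; exists j.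
have [j pj jmax] := @arg_maxnP 'I_#|{: N.+1.-tuple sym}| j0 (fun j => p 0 j != 0)
  (fun j => num_X (enum_val j : N.+1.-tuple sym)) pj0.
exists j => // l pl; have /str_comparableP[//|jl] := pc l j pl pj.
have [_ /(_ (jmax l pl)) ->] := refines_num_X jl.
by [].
Qed.

Lemma sum_weights (R : realType) (I : finType) (p : I -> R) (x : R) (f : I -> R) :
  \sum_j p j = 1 -> (forall j, p j != 0 -> f j = x) -> \sum_j p j * f j = x.
Proof.
move=> p1 fx; rewrite -[RHS]mul1r -p1 mulr_suml; apply: eq_bigr => j _.
by have [->|/fx ->//] := eqVneq (p j) 0; rewrite !mul0r.
Qed.

(** Compatible with the lift of the largest string in the support, the lifts of all strings share a
    unit interval at each vertex. There the zigzag is affine, so the convex combination of the lifts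
    is a lift of [str_point p]. *)
Lemma str_point_curve (R : realType) (N M : nat) (p : 'rV[R]_#|{: N.+1.-tuple sym}|) :
  (0 < M)%N -> str_realization M p -> curve_set (2 * M) (@alt R) (str_point p).
Proof.
move=> M0 B; have [p0 p1 pcell _] := B; have [j pj jtop] := realization_top B.
have [phi lp sE] := cellular_lift R M0 (pcell j pj).
have /choice[psi psiP] l : exists psi, [/\ lift N.+1 (2 * M) psi,
    p 0 l != 0 -> forall i, unroll (str_vec R (enum_val l)) i = zeta (@alt R) (psi i) &
    forall i (k : int), (k%:~R <= phi i -> k%:~R <= psi i) /\ (phi i <= k%:~R -> psi i <= k%:~R)].
  have [_|pl] := eqVneq (p 0 l) 0; first by exists phi.
  have [phi0 lp0 sE0] := cellular_lift R M0 (pcell l pl).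
  by have [psi [h1 h2 h3]] := chain_lift (jtop l pl) lp sE lp0 sE0; exists psi.
have mono (a b : 'I_#|{: N.+1.-tuple sym}| -> R) : (forall l, a l <= b l) ->
    \sum_l p 0 l * a l <= \sum_l p 0 l * b l.
  by move=> ab; apply: ler_sum => l _; rewrite ler_wpM2l.
have cst x : \sum_l p 0 l * x = x by apply: sum_weights.
exists (fun i => \sum_l p 0 l * psi l i).
  split=> [i|i|k].
  - by apply: mono => l; have [[]] := psiP l.
  - rewrite -(cst (2 * M)%:R) -big_split /=; apply: eq_bigr => l _.
    by have [[_ pN _] _ _] := psiP l; rewrite pN mulrDr.
  have [_ _ /(_ k) [i ik]] := lp; exists i; apply: sum_weights => // l _.
  have [_ _ /(_ i k) [h1 h2]] := psiP l.
  by apply/eqP; rewrite eq_le h1 ?h2// ik.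
move=> i; pose k := Num.floor (phi i); have /andP[ki ik] := floor_itv (phi i).
have psik l : k%:~R <= psi l i <= (k + 1)%:~R.
  have [_ _ h] := psiP l; have [h1 _] := h i k; have [_ h2] := h i (k + 1).
  by rewrite h1// h2// ltW.
rewrite (@zeta_itv _ _ k); last first.
  by rewrite -(cst k%:~R) -(cst (k + 1)%:~R) !mono// => l; have /andP[] := psik l.
have affine (A K d : R) (f : 'I_#|{: N.+1.-tuple sym}| -> R) :
    \sum_l p 0 l * (A + (f l - K) * d) = A + (\sum_l p 0 l * f l - K) * d.
  rewrite (eq_bigr (fun l => p 0 l * (A - K * d) + p 0 l * f l * d)).
    by rewrite big_split /= cst -mulr_suml; ring.
  by move=> l _; ring.
rewrite unroll_str_point -affine; apply: eq_bigr => l _.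
have [->|pl] := eqVneq (p 0 l) 0; first by rewrite !mul0r.
have [_ /(_ pl i) + _] := psiP l; rewrite unroll_str_vec => ->.
by rewrite (zeta_itv _ (psik l)).
Qed.

Lemma sym_val_norm (R : realType) (a : sym) : `|sym_val R a| = (a != SX)%:R.
Proof. by case: (symP a) => ->; rewrite /sym_val /= ?normrN1 ?normr1 ?normr0. Qed.

(** Comparable strings never carry different bits at the same position, so the contributions at a
    vertex do not cancel. *)
Lemma str_point_bit (R : realType) (N M : nat) (p : 'rV[R]_#|{: N.+1.-tuple sym}|) i a :
  str_realization M p -> p 0 a != 0 -> tnth (enum_val a) i != SX ->
  str_point p 0 i = (\sum_(j | tnth (enum_val j) i != SX) p 0 j) * sym_val R (tnth (enum_val a) i).
Proof.
move=> [p0 p1 _ pc] pa sa; rewrite mxE mulr_suml [RHS]big_mkcond /=.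
apply: eq_bigr => j _; case: ifPn => [sj|/negPn/eqP ->]; last by rewrite /sym_val /= mulr0.
have [->|pj] := eqVneq (p 0 j) 0; first by rewrite !mul0r.
congr (_ * sym_val _ _); have /str_comparableP[r|r] := pc a j pa pj; last exact: r.
by rewrite r.
Qed.

Lemma str_point_norm (R : realType) (N M : nat) (p : 'rV[R]_#|{: N.+1.-tuple sym}|) i :
  str_realization M p ->
  `|str_point p 0 i| = \sum_(j | tnth (enum_val j) i != SX) p 0 j.
Proof.
move=> B; have [p0 p1 _ pc] := B.
have [[a [pa sa]]|no] := pselect (exists a, p 0 a != 0 /\ tnth (enum_val a) i != SX).
  by rewrite (str_point_bit B pa sa) normrM sym_val_norm sa mulr1 ger0_norm// sumr_ge0.
rewrite mxE !big1 ?normr0// => j sj; last first.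
  by rewrite /sym_val; have [->|pj] := eqVneq (p 0 j) 0; rewrite ?mul0r//;
    case: (symP (tnth (enum_val j) i)) => e; rewrite e ?mulr0//; exfalso; apply: no; exists j; rewrite e.
by apply: contrapT => /eqP pj; apply: no; exists j.
Qed.

(** * Recovering the weights from the curve by thresholds *)

Definition threshold (R : realType) (N : nat) (t : R) (u : 'rV[R]_N.+1) : N.+1.-tuple sym :=
  [tuple (if t <= `|u 0 i| then if u 0 i < 0 then S0 else S1 else SX) | i < N.+1].

Lemma threshold_refines (R : realType) (N : nat) (t t' : R) (u : 'rV[R]_N.+1) : t <= t' ->
  refines (threshold t u) (threshold t' u).
Proof.
move=> tt i; rewrite !tnth_mktuple; case: ifPn => [tu|/negPf //] _.
by rewrite (le_trans tt tu).
Qed.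

(* Rounding away the part of each unit interval at distance less than t/2 from its midpoint. *)
Definition snap (R : realType) (t x : R) : R :=
  let k := (Num.floor x)%:~R in
  if x - k <= (1 - t) / 2 then k else if (1 + t) / 2 <= x - k then k + 1 else k + 2^-1.

Lemma snap_itv (R : realType) (t x : R) : 0 < t <= 1 ->
  (Num.floor x)%:~R <= snap t x <= (Num.floor x)%:~R + 1.
Proof. by rewrite /snap; case: ifP => // _; [|case: ifP => // _]; lra. Qed.

Lemma snap_mono (R : realType) (t x y : R) : 0 < t <= 1 -> x <= y -> snap t x <= snap t y.
Proof.
move=> t01 xy; have := le_floor xy; rewrite le_eqVlt => /orP[/eqP e|].
  rewrite /snap e; move: (Num.floor y) => k.
  case: (leP (x - k%:~R)) => h1; case: (leP (y - k%:~R)) => h2;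
  case: (leP ((1 + t) / 2) (x - k%:~R)) => h3; case: (leP ((1 + t) / 2) (y - k%:~R)) => h4; lra.
rewrite -lezD1 -(ler_int R) rmorphD /=.
by have := snap_itv x t01; have := snap_itv y t01; lra.
Qed.

Lemma snap_int (R : realType) (t : R) (k : int) : 0 < t <= 1 -> snap t k%:~R = k%:~R.
Proof. by move=> t01; rewrite /snap intrKfloor subrr; case: ifP => //; lra. Qed.

Lemma snap_addM (R : realType) (t x : R) (m : nat) : snap t (x + m%:R) = snap t x + m%:R.
Proof.
have -> : m%:R = m%:Z%:~R :> R by [].
rewrite /snap floorDrz ?intr_int// intrKfloor rmorphD /=.
have -> : x + m%:~R - ((Num.floor x)%:~R + m%:~R) = x - (Num.floor x)%:~R by ring.
by case: ifP => // _; case: ifP => // _; ring.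
Qed.

(** On a unit interval the absolute height is twice the distance to the midpoint, so thresholding at
    [t] amounts to rounding the lift by [snap t], and the rounded lift is again a lift. *)
Lemma threshold_cellular (R : realType) (N M : nat) (t : R) (u : 'rV[R]_N.+1) :
  0 < t <= 1 -> curve_set (2 * M) (@alt R) u -> cellular M (threshold t u).
Proof.
move=> t01 [phi lp uE]; apply: (@lift_cellular R _ _ _ (fun i => snap t (phi i))).
  split=> [i|i|k]; first by apply: snap_mono => //; case: lp.
    by have [_ -> _] := lp; rewrite snap_addM.
  by have [_ _ /(_ k) [i ik]] := lp; exists i; rewrite ik snap_int.
move=> i; rewrite unroll_str_vec /sym_at tnth_mktuple -/(unroll u i) uE.
rewrite (@zeta_itv _ _ (Num.floor (phi i)) (snap t (phi i))); last first.
  by rewrite intrD; exact: snap_itv.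
rewrite zeta_altE altS /snap; have := floor_itv (phi i); rewrite rmorphD /=.
move: (Num.floor (phi i)) => k; move: (phi i) => x kx.
set q := 1 - 2 * (x - k%:~R).
have [a [aE an]] : exists a : R, alt R k = a /\ (a = 1 \/ a = -1).
  by exists (alt R k); split=> //; rewrite /alt; case: ifP; [right|left].
have {an}[an a1] : `|a| = 1 /\ (a = 1 \/ a = -1) by split=> //; case: an => ->; rewrite ?normrN1 ?normr1.
rewrite aE normrM an mul1r.
have [h1|h1] := leP (x - k%:~R) ((1 - t) / 2).
  have qt : t <= q by rewrite /q; lra.
  have q0 : 0 < q by lra.
  rewrite ger0_norm ?(ltW q0)// qt.
  case: a1 => ->; rewrite ?mul1r ?mulN1r; last by rewrite oppr_lt0 q0 /sym_val /=; lra.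
  by rewrite ltNge ltW//= /sym_val /=; lra.
have [h2|h2] := leP ((1 + t) / 2) (x - k%:~R).
  have qt : q <= - t by rewrite /q; lra.
  have q0 : q < 0 by lra.
  have nq : t <= - q by lra.
  rewrite ler0_norm ?(ltW q0)// nq.
  case: a1 => ->; rewrite ?mul1r ?mulN1r; first by rewrite q0 /sym_val /=; lra.
  by rewrite oppr_lt0 ltNge ltW//= /sym_val /=; lra.
have qt : `|q| < t by rewrite ltr_norml /q; lra.
by rewrite leNgt qt /= /sym_val /=; case: a1 => ->; lra.
Qed.

(** On a chain the number of [X] separates the strings, so these are the partial sums of the weights
    in the order of the chain. *)
Definition cum_weight (R : realType) (N : nat) (p : 'rV[R]_#|{: N.+1.-tuple sym}|) (x : nat) : R :=
  \sum_(j | (num_X (enum_val j : N.+1.-tuple sym) < x)%N) p 0 j.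

(* The support of a point of the realization is read off the thresholds of its curve. *)
Lemma cum_weight_threshold (R : realType) (N M : nat) (p : 'rV[R]_#|{: N.+1.-tuple sym}|) (t : R) :
  str_realization M p -> 0 < t <= 1 ->
  exists j, [/\ p 0 j != 0, threshold t (str_point p) = enum_val j &
    cum_weight p (num_X (enum_val j : N.+1.-tuple sym)) < t <=
    cum_weight p (num_X (enum_val j : N.+1.-tuple sym)).+1].
Proof.
move=> B /andP[t0 t1]; have [p0 p1 _ pc] := B.
pose h (j : 'I_#|{: N.+1.-tuple sym}|) := num_X (enum_val j : N.+1.-tuple sym).
(* The level [t] lies between two consecutive partial sums; as they differ, some string of the
   support has the dimension in question. *)
have [|x tx xmin] := @ex_minnP (fun x => t <= cum_weight p x).
  exists (\max_j h j).+1; rewrite (le_trans t1)// -p1 /cum_weight.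
  rewrite [leRHS]big_mkcond /=; apply: ler_sum => j _.
  by rewrite (_ : (h j < _)%N) // ltnS; exact: leq_bigmax.
case: x tx xmin => [|x] tx xmin.
  by move: tx; rewrite /cum_weight big_pred0// leNgt t0.
have lt : cum_weight p x < t.
  by rewrite ltNge; apply/negP => /xmin; rewrite ltnn.
have [j pj hj] : exists2 j, p 0 j != 0 & h j = x.
  apply: contrapT => no; move: lt; rewrite ltNge => /negP; apply.
  apply: (le_trans tx); rewrite /cum_weight [leLHS]big_mkcond [leRHS]big_mkcond /=.
  apply: ler_sum => j _; rewrite ltnS leq_eqVlt; case: eqP => [hj|_] //=.
  have [->|pj] := eqVneq (p 0 j) 0; first by case: ifP.
  by exfalso; apply: no; exists j.
exists j; rewrite -/(h j) hj lt; split=> //.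
apply: eq_from_tnth => i; rewrite tnth_mktuple (str_point_norm _ B).
have [sX|sb] := eqVneq (tnth (enum_val j) i) SX.
  rewrite sX leNgt (le_lt_trans _ lt)// /cum_weight [leLHS]big_mkcond [leRHS]big_mkcond /=.
  apply: ler_sum => l _; case: ifPn => sl; last by case: ifP.
  have [->|pl] := eqVneq (p 0 l) 0; first by case: ifP.
  have /str_comparableP[r|r] := pc l j pl pj; last first.
    by move: (sl); rewrite -(r i sl) sX eqxx.
  have [le eq] := refines_num_X r; rewrite -hj ifT// ltn_neqAle le andbT.
  apply/eqP => e; have lj : enum_val l = enum_val j by apply: eq; rewrite e.
  by move: sl; rewrite lj sX eqxx.
have tl : t <= \sum_(l | tnth (enum_val l) i != SX) p 0 l.
  apply: (le_trans tx); rewrite /cum_weight [leLHS]big_mkcond [leRHS]big_mkcond /=.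
  apply: ler_sum => l _; case: ifPn => hl; last by case: ifP.
  have [->|pl] := eqVneq (p 0 l) 0; first by case: ifP.
  have r : refines (enum_val l) (enum_val j).
    have /str_comparableP[//|r] := pc l j pl pj.
    have [le eq] := refines_num_X r; have <- : enum_val j = enum_val l :> N.+1.-tuple sym by apply: eq; rewrite -/(h j) hj -ltnS.
    by [].
  by rewrite r// sb.
rewrite tl (str_point_bit B pj sb).
have S0 : 0 < \sum_(l | tnth (enum_val l) i != SX) p 0 l by exact: lt_le_trans tl.
rewrite pmulr_rlt0//; case: (symP (tnth (enum_val j) i)) sb => -> //; rewrite /sym_val /=.
  by rewrite ltrN10.
by rewrite ltNge ler01.
Qed.

Lemma realization_num_X_inj (R : realType) (N M : nat) (p : 'rV[R]_#|{: N.+1.-tuple sym}|) j l :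
  str_realization M p -> p 0 j != 0 -> p 0 l != 0 ->
  num_X (enum_val j : N.+1.-tuple sym) = num_X (enum_val l : N.+1.-tuple sym) -> j = l.
Proof.
move=> [_ _ _ pc] pj pl e; apply: enum_val_inj.
have /str_comparableP[r|r] := pc j l pj pl.
  by have [_ ->] := refines_num_X r; rewrite ?e.
by have [_ ->] := refines_num_X r; rewrite ?e.
Qed.

Lemma cum_weightS (R : realType) (N M : nat) (p : 'rV[R]_#|{: N.+1.-tuple sym}|) j :
  str_realization M p -> p 0 j != 0 ->
  cum_weight p (num_X (enum_val j : N.+1.-tuple sym)).+1 =
  cum_weight p (num_X (enum_val j : N.+1.-tuple sym)) + p 0 j.
Proof.
move=> B pj; rewrite /cum_weight (bigD1 j) ?ltnSn//= addrC; congr (_ + _).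
rewrite [LHS]big_mkcond [RHS]big_mkcond /=; apply: eq_bigr => l _.
rewrite ltnS leq_eqVlt; have [->|lj] := eqVneq l j; first by rewrite andbF ltnn.
rewrite andbT; case: eqP => [e|_ //]; rewrite e ltnn /=.
by apply/eqP/negPn/negP => pl; move/eqP: lj; apply; exact: realization_num_X_inj B pl pj e.
Qed.

Lemma cum_weight_mono (R : realType) (N : nat) (p : 'rV[R]_#|{: N.+1.-tuple sym}|) (x y : nat) :
  (forall j, 0 <= p 0 j) -> (x <= y)%N -> cum_weight p x <= cum_weight p y.
Proof.
move=> p0 xy; rewrite /cum_weight [leLHS]big_mkcond [leRHS]big_mkcond /=.
apply: ler_sum => j _; case: ifPn => [jx|_]; last by case: ifP.
by rewrite (leq_trans jx xy).
Qed.

Lemma cum_weight_skip (R : realType) (N : nat) (p : 'rV[R]_#|{: N.+1.-tuple sym}|) (x : nat) :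
  (forall j, p 0 j != 0 -> num_X (enum_val j : N.+1.-tuple sym) <> x) ->
  cum_weight p x.+1 = cum_weight p x.
Proof.
move=> no; rewrite /cum_weight [LHS]big_mkcond [RHS]big_mkcond /=.
apply: eq_bigr => j _; have [->|/no jx] := eqVneq (p 0 j) 0; first by rewrite !if_same.
by rewrite ltnS leq_eqVlt; case: eqP jx.
Qed.

(** At the level where the weight interval of a supported string ends, the threshold string is this
    very string. Thresholds depend on the curve point only, so [p] and [p'] have the same support
    and the same partial sums. *)
Lemma str_point_inj (R : realType) (N M : nat) (p p' : 'rV[R]_#|{: N.+1.-tuple sym}|) :
  str_realization M p -> str_realization M p' -> str_point p = str_point p' -> p = p'.
Proof.
move=> B B' E.
have half (q q' : 'rV[R]_#|{: N.+1.-tuple sym}|) j : str_realization M q -> str_realization M q' ->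
    str_point q = str_point q' -> q 0 j != 0 -> q' 0 j != 0 /\
    cum_weight q (num_X (enum_val j : N.+1.-tuple sym)).+1 <=
    cum_weight q' (num_X (enum_val j : N.+1.-tuple sym)).+1.
  move=> Q Q' qq qj; have [q0 q1 _ _] := Q.
  have tE := cum_weightS Q qj; set t := cum_weight q _.+1 in tE *.
  have qj0 : 0 < q 0 j by rewrite lt_neqAle eq_sym qj q0.
  have t01 : 0 < t <= 1.
    rewrite tE ltr_wpDl ?sumr_ge0//= -tE -q1 /t /cum_weight [leLHS]big_mkcond /=.
    by apply: ler_sum => l _; case: ifP.
  have [j1 [qj1 th1 /andP[c1 c2]]] := cum_weight_threshold Q t01.
  have j1j : j1 = j.
    apply: realization_num_X_inj Q qj1 qj _; apply/eqP; rewrite eqn_leq; apply/andP; split.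
      by rewrite -ltnS ltnNge; apply/negP => /(cum_weight_mono q0); rewrite leNgt c1.
    rewrite leqNgt; apply/negP => /(cum_weight_mono q0) le.
    by move: (le_trans c2 le); rewrite tE gerDl leNgt qj0.
  have [j2 [qj2 th2 /andP[_ c3]]] := cum_weight_threshold Q' t01.
  by have j2j : j2 = j by [apply: enum_val_inj; rewrite -th2 -qq th1 j1j]; rewrite -j2j.
have cE x : cum_weight p x = cum_weight p' x.
  elim: x => [|x IH]; first by rewrite /cum_weight !big_pred0.
  have [[j [pj <-]]|no] := pselect (exists j, p 0 j != 0 /\ num_X (enum_val j : N.+1.-tuple sym) = x).
    have [pj' c1] := half p p' j B B' E pj; have [_ c2] := half p' p j B' B (esym E) pj'.
    by apply/eqP; rewrite eq_le c1 c2.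
  rewrite !cum_weight_skip// => j pj e; apply: no; exists j; split=> //.
  by have [] := half p' p j B' B (esym E) pj.
apply/rowP => j; have [pj|pj] := eqVneq (p 0 j) 0.
  rewrite pj; apply/eqP; rewrite eq_sym; apply/negPn/negP => pj'.
  by have [] := half p' p j B' B (esym E) pj'; rewrite pj eqxx.
have [pj' _] := half p p' j B B' E pj.
by apply: (@addrI _ (cum_weight p (num_X (enum_val j : N.+1.-tuple sym)))); rewrite -(cum_weightS B pj) !cE -(cum_weightS B' pj').
Qed.

(** The Riemann sum with right endpoints over the partition [x :: s]: the exact integral of a
    function that is constant on each half-open interval [(a, b]] between consecutive points. *)
Fixpoint level_sum (R : realType) (f : R -> R) (x : R) (s : seq R) : R :=
  if s is y :: s' then (y - x) * f y + level_sum f y s' else 0.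

Lemma level_sum_sum (R : realType) (I : finType) (f : I -> R -> R) (x : R) (s : seq R) :
  \sum_i level_sum (f i) x s = level_sum (fun t => \sum_i f i t) x s.
Proof.
elim: s x => [|y s IH] x /=; first by rewrite big1.
by rewrite big_split /= IH mulr_sumr.
Qed.

Lemma eq_level_sum (R : realType) (f g : R -> R) (x : R) (s : seq R) :
  {in s, f =1 g} -> level_sum f x s = level_sum g x s.
Proof.
elim: s x => //= y s IH x fg; rewrite fg ?mem_head// IH// => z zs.
by rewrite fg// in_cons zs orbT.
Qed.

Lemma level_sum1 (R : realType) (x : R) (s : seq R) :
  level_sum (fun=> 1) x s = last x s - x.
Proof. by elim: s x => [|y s IH] x /=; rewrite ?subrr// IH; ring. Qed.

Lemma level_sum0 (R : realType) (x : R) (s : seq R) : level_sum (fun=> 0) x s = 0.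
Proof. by elim: s x => [|y s IH] x //=; rewrite IH mulr0 addr0. Qed.

Lemma level_sumZ (R : realType) (a : R) (f : R -> R) (x : R) (s : seq R) :
  level_sum (fun t => f t * a) x s = level_sum f x s * a.
Proof. by elim: s x => [|y s IH] x /=; rewrite ?mul0r// IH; ring. Qed.

Lemma level_sum_ge0 (R : realType) (f : R -> R) (x : R) (s : seq R) :
  path <=%R x s -> (forall t, 0 <= f t) -> 0 <= level_sum f x s.
Proof.
by elim: s x => //= y s IH x /andP[xy ys] f0; rewrite addr_ge0 ?mulr_ge0 ?subr_ge0// IH.
Qed.

Lemma level_sum_le (R : realType) (x v : R) (s : seq R) :
  path <%R x s -> v \in x :: s -> level_sum (fun t : R => (t <= v)%R%:R) x s = v - x.
Proof.
elim: s x => [|y s IH] x /=; first by rewrite inE => _ /eqP ->; rewrite subrr.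
move=> /andP[xy ys]; rewrite inE => /orP[/eqP ->|vs].
  rewrite subrr leNgt xy mulr0 add0r (@eq_level_sum _ _ (fun=> 0)) ?level_sum0// => t ts.
  by rewrite leNgt (lt_trans xy)//; have /allP/(_ t ts) := order_path_min lt_trans ys.
rewrite IH//; have -> : y <= v.
  move: vs; rewrite inE => /orP[/eqP ->//|vs].
  by apply/ltW; have /allP/(_ v vs) := order_path_min lt_trans ys.
by rewrite /= mulr1; ring.
Qed.

Lemma level_sum_neq0 (R : realType) (f : R -> R) (x : R) (s : seq R) :
  level_sum f x s != 0 -> exists2 t, t \in s & f t != 0.
Proof.
move=> ne; apply: contrapT => no; move/eqP: ne; apply.
rewrite (@eq_level_sum _ _ (fun=> 0)) ?level_sum0// => t ts.
by apply: contrapT => /eqP ft; apply: no; exists t.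
Qed.

Lemma path_le_last (R : realType) (x v : R) (s : seq R) :
  path <%R x s -> v \in s -> v <= last x s.
Proof.
elim: s x => //= y s IH x /andP[_ ys]; rewrite in_cons => /orP[/eqP ->|]; last exact: IH.
have := mem_last y s; rewrite in_cons => /orP[/eqP ->//|ls].
by apply: ltW; have /allP/(_ _ ls) := order_path_min lt_trans ys.
Qed.

(** Layer-cake formula: each coordinate of [u] is its sign times the integral over [t] in [(0, 1]]
    of the indicator of [t <= |u i|]. Integrating the point mass at the threshold string over [t]
    gives the weights. *)
Lemma str_point_surj (R : realType) (N M : nat) (u : 'rV[R]_N.+1) :
  curve_set (2 * M) (@alt R) u ->
  exists2 p : 'rV[R]_#|{: N.+1.-tuple sym}|, str_realization M p & str_point p = u.
Proof.
move=> Cu; have [phi lp uE] := Cu.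
have u1 i : `|u 0 i| <= 1.
  rewrite -unroll_ord uE zeta_altE normrM.
  have -> : `|alt R (Num.floor (phi i))| = 1 by rewrite /alt; case: ifP; rewrite ?normrN1 ?normr1.
  have := floor_itv (phi i); rewrite rmorphD /= mul1r ler_norml; lra.
(* The threshold string changes only at the positive values [|u i|]; the last of them is 1 because
   the knot 1 is attained at a vertex. *)
pose s := [seq x <- sort <=%R (undup [seq `|u 0 i| | i <- enum 'I_N.+1]) | 0 < x].
have sP x : (x \in s) = (0 < x) && [exists i, x == `|u 0 i|].
  rewrite mem_filter mem_sort mem_undup; congr (_ && _); apply/mapP/existsP.
    by move=> [i _ ->]; exists i.
  by move=> [i /eqP ->]; exists i => //; rewrite mem_enum.
have spath : path <%R 0 s.
  rewrite path_min_sorted; last by apply/allP => x; rewrite sP => /andP[].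
  apply: sorted_filter; first exact: lt_trans.
  by rewrite sort_lt_sorted undup_uniq.
have s1 : last 0 s = 1.
  apply/eqP; rewrite eq_le; apply/andP; split.
    have := mem_last 0 s; rewrite in_cons => /orP[/eqP ->//|].
    by rewrite sP => /andP[_ /existsP[i /eqP ->]].
  apply: path_le_last spath _; rewrite sP ltr01 /=.
  have [_ _ /(_ 1) [i i1]] := lp; apply/existsP; exists (cyc N i).
  by rewrite -/(unroll u i) uE i1 zeta_int /alt /= normr1.
have s01 t : t \in s -> 0 < t <= 1.
  by rewrite sP => /andP[-> /existsP[i /eqP ->]] /=.
pose p : 'rV[R]_#|{: N.+1.-tuple sym}| :=
  \row_j level_sum (fun t => (threshold t u == enum_val j)%:R) 0 s.
have pne j : p 0 j != 0 -> exists2 t, t \in s & threshold t u = enum_val j.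
  rewrite mxE => /level_sum_neq0[t ts]; have [e _|_] := eqVneq (threshold t u) (enum_val j).
    by exists t.
  by rewrite eqxx.
have sumE (f : N.+1.-tuple sym -> R) t :
    \sum_(j < #|{: N.+1.-tuple sym}|) (threshold t u == enum_val j)%:R * f (enum_val j) = f (threshold t u).
  rewrite (bigD1 (enum_rank (threshold t u)))//= enum_rankK eqxx mul1r big1 ?addr0// => j.
  by have [->|_ _] := eqVneq (threshold t u) (enum_val j); rewrite ?enum_valK ?eqxx// mul0r.
exists p.
  split=> [j||j pj|j l pj pl].
  - by rewrite mxE level_sum_ge0//; apply: sub_path spath => x y /ltW.
  - under eq_bigr do rewrite mxE.
    rewrite level_sum_sum (@eq_level_sum _ _ (fun=> 1)) ?level_sum1 ?s1 ?subr0// => t _.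
    rewrite -[RHS](sumE (fun=> 1) t); apply: eq_bigr => j _; by rewrite mulr1.
  - by have [t ts <-] := pne j pj; apply: threshold_cellular Cu; exact: s01.
  - have [t ts <-] := pne j pj; have [t' ts' <-] := pne l pl.
    apply/str_comparableP; case: (leP t t') => tt; first by left; exact: threshold_refines.
    by right; apply: threshold_refines; exact: ltW.
apply/rowP => i; rewrite mxE.
under eq_bigr do rewrite mxE -level_sumZ.
rewrite level_sum_sum (@eq_level_sum _ _ (fun t : R => (t <= `|u 0 i|)%R%:R * Num.sg (u 0 i))) => [|t ts].
  rewrite level_sumZ level_sum_le//; first by rewrite subr0 mulrC -numEsg.
  rewrite in_cons sP; have [->|ui] := eqVneq (u 0 i) 0; first by rewrite normr0 eqxx.
  by rewrite normr_gt0 ui; apply/orP; right; apply/existsP; exists i.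
rewrite (sumE (fun a => sym_val R (tnth a i))) tnth_mktuple.
have /andP[t0 _] := s01 t ts; case: ifPn => tu; last by rewrite /sym_val mul0r.
rewrite mul1r; have : u 0 i != 0 by rewrite -normr_gt0 (lt_le_trans t0).
by rewrite /sym_val; case: ltgtP => // ui _; [rewrite ltr0_sg|rewrite gtr0_sg].
Qed.

(** * Curves and the realization as quotients of compact sets *)

Lemma curve_set_image (R : realType) (n m r : nat) (c : int -> R) :
  (0 < m)%N -> (0 < r)%N -> (forall k, c (k + m%:Z) = c k) ->
  (forall k, c (k + (2 * r)%N%:Z) = c k) ->
  @curve_set R (n + m) m c = @cyl_map R n m r c @` cylinder m.
Proof.
move=> m0 r0 cm cr; apply/seteqP; split=> [w /(cyl_map_surj m0 r0 cm cr)[k Kk <-]|w [k Kk <-]].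
  by exists k.
exact: cyl_map_curve.
Qed.

(** [cyl_map_fibre] describes the fibres without reference to the word, so both curves are the same
    quotient of the cylinder. *)
Lemma curve_set_homeomorphic (R : realType) (n m r r' : nat) (c c' : int -> R) :
  (0 < m)%N -> (0 < r)%N -> (0 < r')%N -> alternating c -> alternating c' ->
  (forall k, c (k + m%:Z) = c k) -> (forall k, c' (k + m%:Z) = c' k) ->
  (forall k, c (k + (2 * r)%N%:Z) = c k) -> (forall k, c' (k + (2 * r')%N%:Z) = c' k) ->
  (forall j : int, (forall l, c (l + 2 * j) = c l) -> (r%:Z %| j)%Z) ->
  (forall j : int, (forall l, c' (l + 2 * j) = c' l) -> (r'%:Z %| j)%Z) ->
  homeomorphic (@curve_set R (n + m) m c) (@curve_set R (n + m) m c').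
Proof.
move=> m0 r0 r0' ac ac' cm cm' cr cr' crP crP'.
rewrite (curve_set_image _ m0 r0 cm cr) (curve_set_image _ m0 r0' cm' cr').
refine (homeomorphic_quotients ((0, 0) : 'rV[R]_n.+1 * R) (K := cylinder m)
  (p := cyl_map m r c) (q := cyl_map m r' c') _ _ _ _ _ _).
- exact: norm_hausdorff.
- exact: norm_hausdorff.
- exact: cylinder_compact.
- exact: cyl_map_continuous.
- exact: cyl_map_continuous.
move=> k k' Kk Kk'; apply: iff_trans (cyl_map_fibre m0 r0 ac cm cr crP Kk Kk') _.
exact: iff_sym (cyl_map_fibre m0 r0' ac' cm' cr' crP' Kk Kk').
Qed.

Lemma curve_set_compact (R : realType) (n m : nat) (c : int -> R) : (0 < m)%N -> ~~ odd m ->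
  (forall k, c (k + m%:Z) = c k) -> compact (@curve_set R (n + m) m c).
Proof.
move=> m0 m2 cm; have mE : (2 * m./2)%N = m by rewrite mul2n even_halfK.
have r0 : (0 < m./2)%N by case: (m) m0 m2 => [|[]].
rewrite (@curve_set_image _ _ _ m./2) ?mE//; apply: continuous_compact (@cylinder_compact _ _ _).
exact: cyl_map_continuous.
Qed.

Lemma curve_set_connected (R : realType) (n m : nat) (c : int -> R) : (0 < m)%N -> ~~ odd m ->
  (forall k, c (k + m%:Z) = c k) -> connected (@curve_set R (n + m) m c).
Proof.
move=> m0 m2 cm; have mE : (2 * m./2)%N = m by rewrite mul2n even_halfK.
have r0 : (0 < m./2)%N by case: (m) m0 m2 => [|[]].
rewrite (@curve_set_image _ _ _ m./2) ?mE//.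
apply: connected_continuous_connected (@cylinder_connected _ _ _) _.
exact: cyl_map_continuous.
Qed.

Lemma str_realization_compact (R : realType) (N M : nat) : compact (@str_realization R N M).
Proof.
apply: bounded_closed_compact.
  exists 1; split; first exact: num_real.
  move=> b b1 p [p0 p1 _ _] /=; rewrite [leLHS]/Num.norm /= mx_normrE; apply: bigmax_le.
    by rewrite ltW// (lt_trans ltr01).
  move=> [i j] _ /=; rewrite ord1 ger0_norm// (le_trans _ (ltW b1))// -p1.
  by rewrite (bigD1 j)//= lerDl sumr_ge0.
set n := #|_|; have coord (j : 'I_n) : continuous (fun p : 'rV[R]_n => p 0 j) by exact: coord_continuous.
(* The conditions on the support become closed ones: weights of other strings vanish, and so do the
   products of weights of incomparable strings. *)
have -> : @str_realization R N M =
    \bigcap_(j in [set: 'I_n]) (fun p : 'rV[R]_n => p 0 j) @^-1` [set x | 0 <= x] `&`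
    (fun p : 'rV[R]_n => \sum_j p 0 j) @^-1` [set 1] `&`
    \bigcap_(j in [set j : 'I_n | ~~ cellular M (enum_val j : N.-tuple sym)])
      (fun p : 'rV[R]_n => p 0 j) @^-1` [set 0] `&`
    \bigcap_(j in [set jl : 'I_n * 'I_n | ~~ str_comparable (enum_val jl.1 : N.-tuple sym) (enum_val jl.2)])
      (fun p : 'rV[R]_n => p 0 j.1 * p 0 j.2) @^-1` [set 0].
  apply/seteqP; split=> [p [p0 p1 pc pp]|p [[[p0 p1] pc] pp]].
    split; [split; [split|]|] => //; first by move=> j _; exact: p0.
      by move=> j /= /negP nj; apply: contrapT => /eqP pj; apply: nj; exact: pc.
    move=> [j l] /= /negP njl; apply: contrapT => /eqP.
    by rewrite mulf_eq0 negb_or => /andP[pj pl]; apply: njl; exact: pp.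
  split=> [j||j pj|j l pj pl] //; first exact: p0.
    by apply: contraT => nj; move: pj; rewrite (pc j nj) eqxx.
  apply: contraT => njl; have /eqP := pp (j, l) njl.
  by rewrite mulf_eq0 (negbTE pj) (negbTE pl).
apply: closedI; last first.
  apply: closed_bigI => -[j l] _; apply: preimage_closed; last exact: closed_eq.
  by move=> p _; exact: cvgM (coord j p) (coord l p).
apply: closedI; last first.
  apply: closed_bigI => j _; apply: preimage_closed; last exact: closed_eq.
  by move=> p _; exact: (coord j p).
apply: closedI; last first.
  apply: preimage_closed; last exact: closed_eq.
  by move=> p _; apply: sum_continuous => j; exact: (coord j p).
apply: closed_bigI => j _; apply: preimage_closed; last exact: closed_ge.
by move=> p _; exact: (coord j p).
Qed.

Lemma realization_homeomorphic (R : realType) (N M : nat) : (0 < M)%N ->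
  homeomorphic (@str_realization R N.+1 M) (@curve_set R N (2 * M) (@alt R)).
Proof.
move=> M0.
have -> : @curve_set R N (2 * M) (@alt R) = @str_point R N @` str_realization M.
  apply/seteqP; split=> [u /str_point_surj[p B <-]|_ [p B <-]]; first by exists p.
  exact: str_point_curve.
rewrite -[X in homeomorphic X _]image_id.
refine (homeomorphic_quotients (0 : 'rV[R]_#|{: N.+1.-tuple sym}|) (K := str_realization M)
  (p := id) (q := @str_point R N) _ _ _ _ _ _).
- exact: norm_hausdorff.
- exact: norm_hausdorff.
- exact: str_realization_compact.
- by apply: continuous_subspaceT => x; exact: cvg_id.
- apply: continuous_subspaceT => p; apply: rV_continuous => j.
  rewrite (_ : (fun _ => _) = fun q : 'rV[R]_#|{: N.+1.-tuple sym}| =>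
    \sum_l q 0 l * sym_val R (tnth (enum_val l) j)); last by apply/funext => q; rewrite mxE.
  apply: sum_continuous => l.
  have coordl : {for p, continuous (fun q : 'rV[R]_#|{: N.+1.-tuple sym}| => q 0 l)}.
    exact: coord_continuous.
  exact: cvgMr_tmp coordl.
by move=> p p' B B'; split=> [/= ->//|E]; exact: str_point_inj B B' E.
Qed.

(** * Ranks in the filtration of the polygon *)

Definition vtx (N : nat) (i : 'I_N) : 'rV[rat]_N := delta_mx 0 i.

(** Covers the closed and the open sublevels at once, as both occur in the formula for
    multiplicities. *)
Definition down_closed (R : realType) (P : R -> bool) : Prop :=
  forall x y, x <= y -> P y -> P x.

Lemma down_closed_max (R : realType) (P : R -> bool) (x y : R) : down_closed P ->
  P (Num.max x y) = P x && P y.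
Proof.
move=> dP; case: leP => [xy|/ltW yx]; apply/idP/andP => [Py|[]//].
  by split=> //; exact: dP Py.
by split=> //; exact: dP Py.
Qed.

Lemma lev_le_down (R : realType) (r : R) : down_closed (lev_le r).
Proof. by move=> x y xy; exact: le_trans. Qed.

Lemma lev_lt_down (R : realType) (r : R) : down_closed (lev_lt r).
Proof. by move=> x y xy; exact: le_lt_trans. Qed.

Lemma vsel_sub (R : realType) (N p : nat) (P : R -> bool) (w : 'rV[R]_N) (X : 'M[rat]_(p, N)) :
  (vsel P w <= X)%MS <-> forall i, P (w 0 i) -> (vtx i <= X)%MS.
Proof.
split=> [/row_subP VX i Pi|H].
  by have := VX i; rewrite row_diag_mx mxE /vval Pi scale1r.
apply/row_subP => i; rewrite row_diag_mx mxE /vval.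
by case Pi : (P (w 0 i)); [rewrite scale1r; exact: H|rewrite scale0r sub0mx].
Qed.

Lemma row_ngon_bd (N : nat) (e : 'I_N) : row e (ngon_bd N) = vtx (ordS e) - vtx e.
Proof. by apply/rowP => j; rewrite /vtx !mxE !eqxx /=. Qed.

Lemma row_bounds (R : realType) (N : nat) (Q : R -> bool) (w : 'rV[R]_N) (e : 'I_N) :
  row e (bounds 0%N Q w) = (Q (eval_edge w e))%:R *: (vtx (ordS e) - vtx e).
Proof. by rewrite row_mul row_diag_mx -scalemxAl -(rowE e (ngon_bd N)) row_ngon_bd mxE. Qed.

Lemma bounds_sub (R : realType) (N p : nat) (Q : R -> bool) (w : 'rV[R]_N) (X : 'M[rat]_(p, N)) :
  (bounds 0%N Q w <= X)%MS <-> forall e, Q (eval_edge w e) -> (vtx (ordS e) - vtx e <= X)%MS.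
Proof.
split=> [/row_subP BX e Qe|H]; first by have := BX e; rewrite row_bounds Qe scale1r.
apply/row_subP => e; rewrite row_bounds.
by case Qe : (Q _); [rewrite scale1r; exact: H|rewrite scale0r sub0mx].
Qed.

Lemma delta_vsel (R : realType) (N : nat) (P : R -> bool) (w : 'rV[R]_N) (i : 'I_N) :
  P (w 0 i) -> (vtx i <= vsel P w)%MS.
Proof. exact: (vsel_sub P w (vsel P w)).1. Qed.

Lemma edge_bounds (R : realType) (N : nat) (Q : R -> bool) (w : 'rV[R]_N) (e : 'I_N) :
  Q (eval_edge w e) -> (vtx (ordS e) - vtx e <= bounds 0%N Q w)%MS.
Proof. exact: (bounds_sub Q w (bounds 0%N Q w)).1. Qed.

Lemma edge_cyc (R : realType) (N : nat) (w : 'rV[R]_N.+1) (i : int) :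
  eval_edge w (cyc N i) = Num.max (unroll w i) (unroll w (i + 1)).
Proof. by rewrite /eval_edge -cyc_succ. Qed.

Lemma path_bounds (R : realType) (N : nat) (Q : R -> bool) (w : 'rV[R]_N.+1) (a b : int) :
  down_closed Q -> a <= b -> (forall i, a <= i -> i <= b -> Q (unroll w i)) ->
  (vtx (cyc N b) - vtx (cyc N a) <= bounds 0%N Q w)%MS.
Proof.
move=> dQ ab; apply: (@int_up_ind (fun b => (forall i, a <= i -> i <= b -> Q (unroll w i)) ->
  (vtx (cyc N b) - vtx (cyc N a) <= bounds 0%N Q w)%MS) a _ _ b ab).
  by rewrite subrr sub0mx.
move=> i ai IH Qi; rewrite -[X in (X <= _)%MS](subrKA (vtx (cyc N i))) addmx_sub ?IH//.
  by rewrite cyc_succ edge_bounds// edge_cyc down_closed_max// !Qi//; lia.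
by move=> j aj ji; apply: Qi => //; lia.
Qed.

(** The subspaces [B + C] and [A + C'] together span at least [B + C'] and meet in at least [A + C].
    Applied to sublevels, this says that multiplicities are not negative. *)
Lemma rank_submodular (N : nat) (A B C C' : 'M[rat]_N) : (A <= B)%MS -> (C <= C')%MS ->
  (\rank (B + C') + \rank (A + C) <= \rank (B + C) + \rank (A + C'))%N.
Proof.
move=> AB CC; rewrite -[X in (_ <= X)%N]mxrank_sum_cap; apply: leq_add; apply: mxrankS.
  rewrite addsmx_sub (submx_trans (addsmxSl B C) (addsmxSl _ _)).
  exact: submx_trans (addsmxSr A C') (addsmxSr _ _).
by rewrite sub_capmx !addsmxS.
Qed.

(** The indicator cochain of an arc. It vanishes on the boundary of every edge that does not leave
    the arc, and so detects chains that are not boundaries. *)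
Definition arc (N : nat) (p q : int) : 'cV[rat]_N.+1 :=
  \col_j (`[< exists2 i : int, p <= i <= q & cyc N i = j >] : nat)%:R.

Lemma delta_arc (N : nat) (p q : int) (j : 'I_N.+1) :
  vtx j *m arc N p q = (`[< exists2 i : int, p <= i <= q & cyc N i = j >] : nat)%:R%:M.
Proof. by rewrite -rowE; apply/rowP => k; rewrite !mxE !ord1 eqxx mulr1n. Qed.

Lemma arc_edge (N : nat) (p q : int) (e : 'I_N.+1) :
  e <> cyc N (p - 1) -> e <> cyc N q -> (vtx (ordS e) - vtx e) *m arc N p q = 0.
Proof.
move=> ep eq; rewrite mulmxBl !delta_arc; apply/eqP; rewrite subr_eq0; apply/eqP; congr (_%:R%:M).
congr nat_of_bool; apply: asbool_equiv_eq; split=> -[i /andP[pi iq] ie].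
  have [ip|ip] := eqVneq i p.
    case: ep; rewrite -(ordSK e) -ie -(ordSK (cyc N (p - 1))) -cyc_succ subrK ip //.
  exists (i - 1); first lia.
  by apply: ordS_inj; rewrite -cyc_succ subrK.
have [iqe|iq'] := eqVneq i q; first by case: eq; rewrite -ie iqe.
by exists (i + 1); [lia|rewrite cyc_succ ie].
Qed.

(** * Diagrams as multiplicity functions; degree 1 *)

Lemma eval_edge_crit (R : realType) (N : nat) (w : 'rV[R]_N) (e : 'I_N) :
  exists i, eval_edge w e = w 0 i.
Proof. by rewrite /eval_edge; case: leP => _; [exists (ordS e)|exists e]. Qed.

Lemma crit_valsP (R : realType) (N : nat) (w : 'rV[R]_N) (x : R) :
  reflect (exists i, w 0 i = x) (x \in crit_vals w).
Proof.
rewrite mem_undup; apply: (iffP mapP) => [[i _ ->]|[i <-]]; first by exists i.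
by exists i; rewrite ?mem_enum.
Qed.

Lemma vsel_ext (R : realType) (N : nat) (w : 'rV[R]_N) (P P' : R -> bool) :
  (forall i, P (w 0 i) = P' (w 0 i)) -> vsel P w = vsel P' w.
Proof. by move=> PP; congr diag_mx; apply/rowP => i; rewrite !mxE /vval PP. Qed.

Lemma esel_ext (R : realType) (N : nat) (w : 'rV[R]_N) (P P' : R -> bool) :
  (forall i, P (w 0 i) = P' (w 0 i)) -> esel P w = esel P' w.
Proof.
move=> PP; congr diag_mx; apply/rowP => e; rewrite !mxE.
by have [i ->] := eval_edge_crit w e; rewrite PP.
Qed.

Lemma pers_rank_ext (R : realType) (N k : nat) (w : 'rV[R]_N) (P P' Q Q' : R -> bool) :
  (forall i, P (w 0 i) = P' (w 0 i)) -> (forall i, Q (w 0 i) = Q' (w 0 i)) ->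
  pers_rank k w P Q = pers_rank k w P' Q'.
Proof.
move=> PP QQ; rewrite /pers_rank.
have -> : cycles k P w = cycles k P' w.
  by case: k => [|[|k]] //=; [exact: vsel_ext|rewrite (esel_ext PP)].
by have -> : bounds k Q w = bounds k Q' w by case: k => [|[|k]] //=; rewrite (esel_ext QQ).
Qed.

Lemma lev_le_lt (R : realType) (x r : R) : x != r -> lev_le r x = lev_lt r x.
Proof. by move=> xr; rewrite /lev_le /lev_lt lt_neqAle xr. Qed.

(** At a number that is not a value of [w] the open and the closed sublevel agree, so the
    inclusion-exclusion formula cancels. *)
Lemma ph_mult_crit (R : realType) (N k : nat) (w : 'rV[R]_N) (b : R) (d : \bar R) :
  ph_mult k w b d != 0%N ->
  b \in crit_vals w /\ d \in [seq x%:E | x <- crit_vals w] ++ [:: +oo%E].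
Proof.
have ext x : x \notin crit_vals w -> forall i, lev_le x (w 0 i) = lev_lt x (w 0 i).
  move=> xw i; apply: lev_le_lt; apply: contraNneq xw => <-.
  by apply/crit_valsP; exists i.
move=> m0; split; apply: contraNT m0; [case: d => [d||]// bw|case: d => [d||]// dw].
- rewrite /=; case: ifP => // _.
  rewrite !(@pers_rank_ext _ _ k w (lev_le b) (lev_lt b) (lev_lt d) (lev_lt d))//; last exact: ext.
  rewrite !(@pers_rank_ext _ _ k w (lev_le b) (lev_lt b) (lev_le d) (lev_le d))//; last exact: ext.
  by rewrite addnC subnn.
- by rewrite /= (@pers_rank_ext _ _ k w (lev_le b) (lev_lt b) predT predT) ?subnn//; exact: ext.
- have {}dw : d \notin crit_vals w.
    by apply: contra dw => dw; rewrite mem_cat map_f.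
  rewrite /=; case: ifP => // _.
  rewrite (@pers_rank_ext _ _ k w (lev_lt b) (lev_lt b) (lev_le d) (lev_lt d))//; last exact: ext.
  rewrite (@pers_rank_ext _ _ k w (lev_le b) (lev_le b) (lev_le d) (lev_lt d))//; last exact: ext.
  by rewrite addnC subnn.
- by rewrite mem_cat mem_seq1 eqxx orbT in dw.
Qed.

Lemma sum_seq_pick (T : eqType) (s : seq T) (x : T) (F : T -> nat) :
  uniq s -> (x \notin s -> F x = 0%N) -> (\sum_(y <- s) (y == x) * F y)%N = F x.
Proof.
move=> us Fx; have [xs|xs] := boolP (x \in s).
  rewrite (bigD1_seq x)//= eqxx mul1n big1 ?addn0// => y /negPf ->.
  by rewrite mul0n.
rewrite Fx// big_seq big1// => y ys; case: eqP => [yx|]; last by rewrite mul0n.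
by rewrite -yx ys in xs.
Qed.

Lemma uniq_deaths (R : realType) (N : nat) (w : 'rV[R]_N) :
  uniq ([seq x%:E | x <- crit_vals w] ++ [:: +oo%E]).
Proof.
rewrite cat_uniq map_inj_uniq ?undup_uniq//=; last by move=> x y [].
by rewrite orbF andbT; apply/mapP => -[].
Qed.

Lemma count_PH (R : realType) (N k : nat) (w : 'rV[R]_N) (b : R) (d : \bar R) :
  count_mem (b, d) (PH k w) = ph_mult k w b d.
Proof.
rewrite /PH count_flatten sumnE big_map big_allpairs_dep /=.
transitivity (\sum_(b' <- crit_vals w) (b' == b) * ph_mult k w b' d)%N.
  apply: eq_bigr => b' _.
  rewrite -(@sum_seq_pick _ _ d (fun d' => (b' == b) * ph_mult k w b' d')%N (uniq_deaths w)).
    by apply: eq_bigr => d' _; rewrite count_nseq /= xpair_eqE mulnA mulnb andbC.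
  by move=> dw; apply/eqP; rewrite muln_eq0; case: eqP => //= _; apply: contraNT dw => /ph_mult_crit[].
apply: sum_seq_pick; first exact: undup_uniq.
by move=> bw; apply/eqP; apply: contraNT bw => /ph_mult_crit[].
Qed.

Lemma perm_PH (R : realType) (N k : nat) (w z : 'rV[R]_N) :
  perm_eq (PH k w) (PH k z) <-> forall b d, ph_mult k w b d = ph_mult k z b d.
Proof.
split=> [/permP e b d|e]; first by rewrite -!count_PH; exact: e.
by apply/allP => -[b d] _ /=; rewrite !count_PH e.
Qed.

Lemma ngon_bd_mul (N : nat) (x : 'rV[rat]_N) (v : 'I_N) :
  (x *m ngon_bd N) 0 (ordS v) = x 0 v - x 0 (ordS v).
Proof.
rewrite mxE; under eq_bigr do rewrite mxE mulrBr.
rewrite big_split /= sumrN (bigD1 v)//= eqxx mulr1 big1 ?addr0; last first.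
  move=> e ev; rewrite [ordS v == _]eq_sym (inj_eq (@ordS_inj _)).
  by rewrite (negPf ev) mulr0.
rewrite (bigD1 (ordS v))//= eqxx mulr1 big1 ?addr0// => e ev.
by rewrite eq_sym (negPf ev) mulr0.
Qed.

Lemma kermx_ngon (N : nat) (x : 'rV[rat]_N.+1) : (x <= kermx (ngon_bd N.+1))%MS ->
  x = const_mx (x 0 0).
Proof.
move=> /sub_kermxP x0; apply/rowP => j; rewrite mxE.
suff H i : x 0 (cyc N i%:Z) = x 0 0 by rewrite -(H j) cyc_ord.
elim: i => [|i IH]; first by congr (x 0 _); exact: (cyc_ord (ord0 : 'I_N.+1)).
rewrite -IH intS addrC cyc_succ; apply/esym/eqP; rewrite -subr_eq0.
by rewrite -ngon_bd_mul x0 mxE.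
Qed.

Lemma rank_ngon_gt0 (N : nat) : (0 < \rank (kermx (ngon_bd N.+1)))%N.
Proof.
rewrite lt0n mxrank_eq0; apply/eqP => K0.
have /submxP[D] : ((const_mx 1 : 'rV[rat]_N.+1) <= kermx (ngon_bd N.+1))%MS.
  apply/sub_kermxP/rowP => j; rewrite -(cyc_ord j) -(subrK 1 j%:Z) cyc_succ ngon_bd_mul.
  by rewrite !mxE subrr.
by rewrite K0 mulmx0 => /rowP/(_ 0)/eqP; rewrite !mxE oner_eq0.
Qed.

Lemma esel_down (R : realType) (N : nat) (w : 'rV[R]_N) (P : R -> bool) :
  down_closed P -> esel P w = diag_mx (\row_e ((P (w 0 e) && P (w 0 (ordS e)) : nat)%:R)).
Proof. by move=> dP; congr diag_mx; apply/rowP => e; rewrite !mxE -down_closed_max. Qed.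

(** All coefficients of a cycle on the polygon are equal, so a nonzero cycle uses every edge and
    hence every vertex. *)
Lemma pers_rank1 (R : realType) (N : nat) (w : 'rV[R]_N.+1) (P Q : R -> bool) :
  down_closed P -> pers_rank 1 w P Q =
  if [forall i, P (w 0 i)] then \rank (kermx (ngon_bd N.+1)) else 0%N.
Proof.
move=> dP; rewrite /pers_rank /= mxrank0 subn0 addsmx0 esel_down//.
case: forallP => [allP|/forallP/forallPn[i /negPf Pi]].
  rewrite [X in diag_mx X](_ : _ = const_mx 1); last by apply/rowP => e; rewrite !mxE !allP.
  by apply/eqP; rewrite diag_const_mx eqn_leq !mxrankS ?capmxSr// sub_capmx submx1 submx_refl.
apply/eqP; rewrite mxrank_eq0 -submx0; apply/rV_subP => x.
rewrite sub_capmx => /andP[/submxP[D xD] /kermx_ngon xK].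
have xi : x 0 i = 0 by rewrite xD mul_mx_diag !mxE Pi mulr0.
have x0 : x 0 0 = 0 by rewrite -xi xK !mxE.
by rewrite submx0; apply/eqP; rewrite xK x0; apply/rowP => k; rewrite !mxE.
Qed.

Definition is_max (R : realType) (N : nat) (w : 'rV[R]_N) (b : R) : Prop :=
  (forall i, w 0 i <= b) /\ exists i, w 0 i = b.

Lemma ph_mult1_max (R : realType) (N : nat) (w : 'rV[R]_N.+1) (b : R) :
  is_max w b <-> ph_mult 1 w b +oo%E != 0%N.
Proof.
rewrite /= !pers_rank1; [|exact: lev_lt_down|exact: lev_le_down].
case: forallP => [le_b|le_b]; case: forallP => [lt_b|lt_b]; rewrite ?subnn ?sub0n ?subn0.
- by split=> // -[_ [i ib]]; have := lt_b i; rewrite /lev_lt ib ltxx.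
- rewrite -lt0n rank_ngon_gt0; split=> // _; split; first exact: le_b.
  apply: contrapT => H; case: lt_b => i; rewrite /lev_lt lt_neqAle (le_b i : w 0 i <= b) andbT.
  by apply/eqP => ib; apply: H; exists i.
- by split=> // -[le_b' _]; case: le_b.
- by split=> // -[le_b' _]; case: le_b.
Qed.

(* [2 * basin x] is the local minimum of [zeta c] to which one descends from [x]. *)
Definition basin (R : realType) (x : R) : int := ((Num.floor x + 1) %/ 2)%Z.

Lemma basinP (R : realType) (x : R) :
  (2 * basin x - 1)%:~R <= x < (2 * basin x + 1)%:~R.
Proof.
have /andP[fx xf] := floor_itv x; rewrite /basin.
move: (Num.floor x) fx xf => a ax xa; apply/andP; split.
  by apply: le_trans ax; rewrite ler_int; lia.
by apply: lt_le_trans xa _; rewrite ler_int; lia.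
Qed.

Lemma basin_eq (R : realType) (x : R) (j : int) :
  (2 * j - 1)%:~R <= x < (2 * j + 1)%:~R -> basin x = j.
Proof.
move=> /andP[jx xj]; have /andP[bx xb] := basinP x; move: (basin x) bx xb => b bx xb.
have : (2 * j - 1 < 2 * b + 1) by rewrite -(ltr_int R); exact: le_lt_trans xb.
have : (2 * b - 1 < 2 * j + 1) by rewrite -(ltr_int R); exact: le_lt_trans xj.
lia.
Qed.

Lemma basin_shift (R : realType) (x : R) (L : nat) : basin (x + (2 * L)%N%:R) = basin x + L%:Z.
Proof.
apply: basin_eq; have := basinP x; move: (basin x) => b.
have -> : 2 * (b + L%:Z) - 1 = 2 * b - 1 + (2 * L)%N%:Z by lia.
have -> : 2 * (b + L%:Z) + 1 = 2 * b + 1 + (2 * L)%N%:Z by lia.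
by rewrite !(intrD _ _ (2 * L)%N%:Z) !lerD2r !ltrD2r.
Qed.

Lemma zeta_basin (R : realType) (c : int -> R) (j : int) (x y : R) : alternating c ->
  (2 * j - 1)%:~R <= x < (2 * j + 1)%:~R ->
  x <= y <= (2 * j)%:~R \/ (2 * j)%:~R <= y <= x -> zeta c y <= zeta c x.
Proof.
move=> ac /andP[jx xj] [/andP[xy yj]|/andP[jy yx]].
  have [->//|nxy] := eqVneq x y; apply/ltW/(zeta_decr (k := j) ac jx) => //.
  by rewrite lt_neqAle nxy.
have [->//|nxy] := eqVneq y x; apply/ltW/(zeta_incr (k := j) ac jy); last exact: ltW.
by rewrite lt_neqAle nxy.
Qed.

Lemma zeta_le_max (R : realType) (c : int -> R) (j : int) (x : R) : alternating c ->
  (2 * j)%:~R <= x <= (2 * (j + 1))%:~R -> zeta c x <= c (2 * j + 1).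
Proof.
move=> ac /andP[jx xj]; rewrite -zeta_int.
have [->//|nx] := eqVneq x (2 * j + 1)%:~R.
have [xl|xl] := leP x (2 * j + 1)%:~R.
  by apply/ltW/(zeta_incr (k := j) ac jx) => //; rewrite lt_neqAle nx.
have e : 2 * (j + 1) - 1 = 2 * j + 1 :> int by lia.
by apply/ltW/(zeta_decr (k := j + 1) ac); rewrite ?e.
Qed.

Lemma lift_first_inj (R : realType) (N m : nat) (phi : int -> R) (i j : int) (x : R) :
  lift N m phi -> phi i = x -> phi (i - 1) < x -> phi j = x -> phi (j - 1) < x -> i = j.
Proof.
move=> lp; wlog ij : i j / i <= j => [H pi pi1 pj pj1|pi _ _ pj1].
  have [ij|ij] := leP i j; first exact: H.
  by apply/esym/H => //; exact: ltW.
apply/eqP; rewrite eq_le ij leNgt; apply/negP => ji.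
by move: pj1; rewrite ltNge -pi (lift_mono lp)//; lia.
Qed.

Lemma lift_firsts (R : realType) (N m : nat) (phi : int -> R) : lift N m phi ->
  exists2 iota : int -> int, (forall k, phi (iota k) = k%:~R) &
    (forall k, iota (k + m%:Z) = iota k + N%:Z).
Proof.
move=> lp; have first k : exists i, phi i = k%:~R /\ phi (i - 1) < k%:~R.
  by have [i ik ik1] := lift_first lp k; exists i.
have [iota iP] := choice first.
exists iota => k; first by case: (iP k).
have [_ pN _] := lp; have [pk pk1] := iP k; have [pm pm1] := iP (k + m%:Z).
apply: (lift_first_inj lp pm pm1); first by rewrite pN pk intrD.
by rewrite addrAC pN intrD ltrD2r.
Qed.

Lemma path_bounds_sym (R : realType) (N : nat) (Q : R -> bool) (w : 'rV[R]_N.+1) (a b : int) :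
  down_closed Q -> (forall i, a <= i <= b \/ b <= i <= a -> Q (unroll w i)) ->
  (vtx (cyc N b) - vtx (cyc N a) <= bounds 0%N Q w)%MS.
Proof.
move=> dQ Qi; have [ab|/ltW ab] := leP a b.
  by apply: path_bounds => // i ai ib; apply: Qi; left; rewrite ai.
rewrite -opprB eqmx_opp; apply: path_bounds => // i ai ib.
by apply: Qi; right; rewrite ai.
Qed.

(* Walking from any position [i] to the bottom of its basin only meets values below [w i]. *)
Lemma descent_bounds (R : realType) (N m : nat) (c phi : int -> R) (w : 'rV[R]_N.+1)
  (Q : R -> bool) (i i' : int) :
  lift N.+1 m phi -> alternating c -> (forall i, unroll w i = zeta c (phi i)) ->
  down_closed Q -> Q (unroll w i) -> phi i' = (2 * basin (phi i))%:~R ->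
  (vtx (cyc N i') - vtx (cyc N i) <= bounds 0%N Q w)%MS.
Proof.
move=> lp ac wE dQ Qi pi'; apply: path_bounds_sym => // j ij; apply: dQ Qi.
rewrite !wE; apply: (zeta_basin ac (basinP _)).
by case: ij => /andP[ij ji]; [left|right]; rewrite -pi' !(lift_mono lp).
Qed.

(** Each side is the dimension of the space of cycles modulo boundaries; [F] descends to the
    quotients, and its image covers the classes of [V']. *)
Lemma rank_descent (N N' : nat) (V B : 'M[rat]_N) (V' B' : 'M[rat]_N') (F : 'M[rat]_(N, N')) :
  (V' <= V *m F + B')%MS -> (B *m F <= B')%MS ->
  (\rank (V' + B') - \rank B' <= \rank (V + B) - \rank B)%N.
Proof.
move=> V'F BF; set X := (V + B)%MS.
have XB : \rank X = (\rank B + \rank (X :\: B))%N.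
  by rewrite -(mxrank_cap_compl X B); congr addn; rewrite (capmx_idPr _)// addsmxSr.
rewrite XB addKn leq_subLR.
suff /mxrankS/leq_trans : (V' + B' <= (X :\: B) *m F + B')%MS.
  apply; apply: leq_trans (mxrank_adds_leqif _ _) _.
  by rewrite addnC leq_add2l mxrankM_maxl.
rewrite addsmx_sub addsmxSr andbT (submx_trans V'F)// addsmx_sub addsmxSr andbT.
have : (V <= X :\: B + X :&: B)%MS by rewrite addsmx_diff_cap_eq addsmxSl.
move=> /(submxMr F)/submx_trans; apply; rewrite addsmxMr addsmx_sub addsmxSl/=.
apply: submx_trans (addsmxSr _ _); apply: submx_trans BF.
by rewrite submxMr// capmxSr.
Qed.

(** Points of one curve have the same basins with the same bottoms, so sending each vertex to the
    bottom of its basin relates the components at every level. One inequality suffices, because the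
    two points can be exchanged. *)
Lemma curve_set_pers0 (R : realType) (N L : nat) (c : int -> R) (w w' : 'rV[R]_N.+1)
  (P Q : R -> bool) : alternating c ->
  @curve_set R N (2 * L) c w -> @curve_set R N (2 * L) c w' ->
  down_closed P -> down_closed Q -> (forall x, P x -> Q x) ->
  (pers_rank 0 w' P Q <= pers_rank 0 w P Q)%N.
Proof.
move=> ac [phi lp wE] [phi' lp' wE'] dP dQ PQ.
have [iota iotaP iotaN] := lift_firsts lp.
have [iota' iotaP' iotaN'] := lift_firsts lp'.
(* Each vertex is sent to the vertex of w' at the bottom of its basin; this is
   a chain map up to boundaries. *)
pose e i := cyc N (iota' (2 * basin (phi i))).
have eN i : e (i + N.+1%:Z) = e i.
  have [_ pN _] := lp; rewrite /e pN basin_shift.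
  have -> : 2 * (basin (phi i) + L%:Z) = 2 * basin (phi i) + (2 * L)%N%:Z by lia.
  by rewrite iotaN' cyc_addN.
pose F : 'M[rat]_N.+1 := \matrix_(j < N.+1) vtx (e j%:Z).
have vF i : vtx (cyc N i) *m F = vtx (e i).
  by rewrite /vtx -rowE rowK /=; congr (delta_mx 0 _); exact: periodic_cyc.
apply: (@rank_descent _ _ (vsel P w) (bounds 0%N Q w) _ _ F).
(* A vertex of [w'] is homologous to the bottom of its basin, which is the image of a vertex of [w]
   at the same minimum and therefore no higher. *)
- apply: (vsel_sub P w' _).2 => i Pi; rewrite -(cyc_ord i).
  have dB : (vtx (cyc N (iota' (2 * basin (phi' i%:Z))%R)) - vtx (cyc N i%:Z) <= bounds 0%N Q w')%MS.
    apply: (descent_bounds lp' ac wE' dQ) => //; first by rewrite unroll_ord; exact: PQ.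
  set k := basin (phi' i%:Z) in dB *.
  have Pk : P (w 0 (cyc N (iota (2 * k)))).
    apply: dP Pi; rewrite -[w' 0 i]unroll_ord -[w 0 _]/(unroll w _) wE wE' iotaP.
    apply: (zeta_basin (j := k) ac (basinP _)).
    have [pk|/ltW pk] := leP (phi' i%:Z) (2 * k)%:~R; [left|right]; apply/andP; split=> //.
  have ek : e (iota (2 * k)) = cyc N (iota' (2 * k)).
    rewrite /e iotaP; congr (cyc N (iota' _)); congr (2 * _); apply: basin_eq.
    by rewrite ler_int ltr_int; lia.
  rewrite -[vtx (cyc N i%:Z)](subKr (vtx (cyc N (iota' (2 * k))))).
  rewrite addmx_sub ?eqmx_opp//; last exact: submx_trans dB (addsmxSr _ _).
  rewrite -ek -vF; apply: submx_trans (addsmxSl _ _).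
  by rewrite submxMr// delta_vsel.
(* An edge between different basins has its end [i + 1] exactly at the separating maximum, so its
   level suffices to join the two bottoms in [w']. *)
have edgeF i : Q (unroll w i) -> Q (unroll w (i + 1)) ->
    (vtx (e (i + 1)%R) - vtx (e i) <= bounds 0%N Q w')%MS.
  move=> Qi Qi1; rewrite /e.
  have /andP[b0 b0'] := basinP (phi i); have /andP[b1 b1'] := basinP (phi (i + 1)).
  move: (basin (phi i)) (basin (phi (i + 1))) b0 b0' b1 b1' => j j' b0 b0' b1 b1'.
  have [->|jj] := eqVneq j' j; first by rewrite subrr sub0mx.
  have pj : phi (i + 1) <= (2 * j + 1)%:~R by exact: (lift_skip lp).
  have jle : j <= j'.
    have p1 : phi i <= phi (i + 1) by case: lp.
    have : 2 * j - 1 < 2 * j' + 1 by rewrite -(ltr_int R); exact: le_lt_trans (le_trans b0 p1) b1'.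
    lia.
  have j'E : j' = j + 1.
    have : 2 * j' - 1 <= 2 * j + 1 by rewrite -(ler_int R); exact: le_trans b1 pj.
    lia.
  have p1E : phi (i + 1) = (2 * j + 1)%:~R.
    by apply/eqP; rewrite eq_le pj; apply: le_trans b1; rewrite ler_int j'E; lia.
  apply: path_bounds_sym => // k kij; apply: dQ Qi1; rewrite wE wE' p1E zeta_int.
  apply: zeta_le_max => //; case: kij => /andP[k1 k2].
    by rewrite -!iotaP' -j'E !(lift_mono lp').
  have := lift_mono lp' (le_trans k1 k2); rewrite !iotaP' j'E ler_int; lia.
apply/row_subP => e0; rewrite row_mul row_bounds -scalemxAl mulmxBl.
case Qe : (Q _); last by rewrite scale0r sub0mx.
rewrite scale1r -(cyc_ord e0) -cyc_succ !vF; move: Qe; rewrite -{1}(cyc_ord e0) edge_cyc.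
by rewrite down_closed_max// => /andP[]; exact: edgeF.
Qed.

Lemma zeta_down (R : realType) (c : int -> R) (P : R -> bool) (x : R) :
  down_closed P -> (forall k, P (c k)) -> P (zeta c x).
Proof.
move=> dP Pc; have /andP[fx xf] := floor_itv x; move: (Num.floor x) fx xf => k kx xk.
have xkS : x - k%:~R <= 1 by move: xk; rewrite intrD; lra.
have x0 : 0 <= x - k%:~R by rewrite subr_ge0.
have zE : zeta c x = c k + (x - k%:~R) * (c (k + 1) - c k) by apply: zeta_itv; rewrite kx ltW.
move: (x - k%:~R) x0 xkS zE => t t0 t1 ->; have [cc|/ltW cc] := leP (c k) (c (k + 1)).
  by apply: dP (Pc (k + 1)); rewrite -lerBrDl ler_piMl// subr_ge0//.
by apply: dP (Pc k); rewrite gerDl mulr_ge0_le0// subr_le0//.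
Qed.

Lemma curve_set_all (R : realType) (N m : nat) (c : int -> R) (w : 'rV[R]_N.+1) (P : R -> bool) :
  down_closed P -> @curve_set R N m c w -> (forall i, P (w 0 i)) <-> (forall k, P (c k)).
Proof.
move=> dP [phi lp wE]; split=> [Pw k|Pc i].
  by have [i ik _] := lift_first lp k; rewrite -zeta_int -ik -wE; exact: Pw.
by rewrite -[w 0 i]unroll_ord wE; exact: zeta_down.
Qed.

Lemma curve_set_dataP (R : realType) (N L : nat) (c : int -> R) (z w : 'rV[R]_N.+1) :
  alternating c -> @curve_set R N (2 * L) c z -> @curve_set R N (2 * L) c w -> dataP z w.
Proof.
move=> ac cz cw; split; apply/perm_PH => b d.
  have pE P Q : down_closed P -> down_closed Q -> (forall x, P x -> Q x) ->
      pers_rank 0 w P Q = pers_rank 0 z P Q.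
    by move=> dP dQ PQ; apply/eqP; rewrite eqn_leq; rewrite (curve_set_pers0 ac cz cw)// (curve_set_pers0 ac cw cz).
  have le_down := @lev_le_down R; have lt_down := @lev_lt_down R.
  case: d => [d||] //=; last by rewrite !pE.
  case: ifP => // bd; rewrite !pE // => x; rewrite /lev_le /lev_lt => xb.
  - exact: le_trans xb (ltW bd).
  - exact: lt_trans xb bd.
  - exact: ltW (lt_trans xb bd).
  - exact: le_lt_trans xb bd.
have pE P Q : down_closed P -> pers_rank 1 w P Q = pers_rank 1 z P Q.
  move=> dP; rewrite !pers_rank1//; have [wc zc] := (curve_set_all dP cw, curve_set_all dP cz).
  by congr (if _ then _ else _); apply/forallP/forallP => H i; [apply: zc.2|apply: wc.2] => //;
    [apply/wc.1|apply/zc.1].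
have le_down := @lev_le_down R; have lt_down := @lev_lt_down R.
by case: d => [d||] //=; rewrite !pE.
Qed.

(** * Births and deaths on a curve *)

Definition level_rank (R : realType) (N : nat) (w : 'rV[R]_N) (P Q : R -> bool) : nat :=
  \rank (vsel P w + bounds 0%N Q w)%MS.

Lemma level_rank_ext (R : realType) (N : nat) (w : 'rV[R]_N) (P P' Q Q' : R -> bool) :
  (forall i, P (w 0 i) = P' (w 0 i)) -> (forall i, Q (w 0 i) = Q' (w 0 i)) ->
  level_rank w P Q = level_rank w P' Q'.
Proof. by move=> PP QQ; rewrite /level_rank (vsel_ext PP) /= (esel_ext QQ). Qed.

Lemma vsel_mono (R : realType) (N : nat) (w : 'rV[R]_N) (P P' : R -> bool) :
  (forall x, P x -> P' x) -> (vsel P w <= vsel P' w)%MS.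
Proof. by move=> PP; apply: (vsel_sub P w _).2 => i Pi; apply/delta_vsel/PP. Qed.

Lemma bounds_mono (R : realType) (N : nat) (w : 'rV[R]_N) (P P' : R -> bool) :
  (forall x, P x -> P' x) -> (bounds 0%N P w <= bounds 0%N P' w)%MS.
Proof. by move=> PP; apply: (bounds_sub P w _).2 => i Pi; apply/edge_bounds/PP. Qed.

(** The ranks of the boundaries cancel, and [rank_submodular] makes the truncated subtraction in
    [ph_mult] exact. *)
Lemma ph_mult0_fin (R : realType) (N : nat) (w : 'rV[R]_N) (b d : R) : b < d ->
  (ph_mult 0 w b d%:E + (level_rank w (lev_lt b) (lev_lt d) + level_rank w (lev_le b) (lev_le d)) =
   level_rank w (lev_le b) (lev_lt d) + level_rank w (lev_lt b) (lev_le d))%N.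
Proof.
move=> bd; have lt_le (x : R) : forall y, lev_lt x y -> lev_le x y by move=> y; exact: ltW.
have := rank_submodular (vsel_mono w (lt_le b)) (bounds_mono w (lt_le d)).
have rS P Q : (\rank (bounds 0%N Q w) <= level_rank w P Q)%N by rewrite mxrankS// addsmxSr.
move: (rS (lev_le b) (lev_le d)) (rS (lev_lt b) (lev_le d)).
move: (rS (lev_le b) (lev_lt d)) (rS (lev_lt b) (lev_lt d)).
rewrite /ph_mult bd /pers_rank.
rewrite /level_rank /cycles.
move: (\rank (bounds 0 (lev_le d) w)) (\rank (bounds 0 (lev_lt d) w)).
move: (\rank (vsel (lev_le b) w + bounds 0 (lev_lt d) w)%MS).
move: (\rank (vsel (lev_le b) w + bounds 0 (lev_le d) w)%MS).
move: (\rank (vsel (lev_lt b) w + bounds 0 (lev_lt d) w)%MS).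
move: (\rank (vsel (lev_lt b) w + bounds 0 (lev_le d) w)%MS).
lia.
Qed.

Lemma ph_mult0_inf (R : realType) (N : nat) (w : 'rV[R]_N) (b : R) :
  (ph_mult 0 w b +oo%E + level_rank w (lev_lt b) predT = level_rank w (lev_le b) predT)%N.
Proof.
have rS P Q : (\rank (bounds 0%N Q w) <= level_rank w P Q)%N by rewrite mxrankS// addsmxSr.
have := rS (lev_lt b) predT.
have : (level_rank w (lev_lt b) predT <= level_rank w (lev_le b) predT)%N.
  by rewrite mxrankS// addsmxS//; apply: vsel_mono => x; exact: ltW.
rewrite /= /pers_rank /level_rank /cycles.
move: (\rank (bounds 0 predT w)) (\rank (vsel (lev_le b) w + _)%MS).
move: (\rank (vsel (lev_lt b) w + _)%MS); lia.
Qed.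

(** Induction on the number of vertices above [t]: raising [t] to the next value [d0] splits off the
    summand of [d0], which is the drop of the rank difference. What remains at the end is the
    multiplicity of essential classes. *)
Lemma births_sum (R : realType) (N : nat) (w : 'rV[R]_N) (b t : R) : b <= t ->
  (\sum_(d <- crit_vals w | (t < d)%R) ph_mult 0 w b d%:E + ph_mult 0 w b +oo%E +
   level_rank w (lev_lt b) (lev_le t) = level_rank w (lev_le b) (lev_le t))%N.
Proof.
move: {2}#|_| (leqnn #|[pred i | t < w 0 i]|) => n; elim: n t => [|n IH] t.
  rewrite leqn0 => /eqP/card0_eq t0 bt.
  have wt i : w 0 i <= t by rewrite leNgt; apply/negPn/negPn; have := t0 i; rewrite inE => ->.
  rewrite big_seq_cond big1 ?add0n; last first.
    by move=> d /andP[/crit_valsP[i <-]]; rewrite ltNge wt.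
  have tE P : level_rank w P (lev_le t) = level_rank w P predT.
    by apply: level_rank_ext => // i; exact: wt.
  by rewrite !tE ph_mult0_inf.
have [[i0 ti0]|noi] := pselect (exists i, t < w 0 i); last first.
  by move=> _; apply: IH; rewrite (_ : #|_| = 0%N)//; apply: eq_card0 => i; rewrite inE;
    apply/negP => ti; apply: noi; exists i.
move=> cn bt; have [i1 ti1 i1min] := @arg_minP _ _ _ i0 (fun i => t < w 0 i) (fun i => w 0 i) ti0.
set d0 := w 0 i1 in i1min *.
rewrite big_mkcond (bigD1_seq d0) ?undup_uniq//; last by apply/crit_valsP; exists i1.
rewrite (ti1 : (t < d0) = true).
have -> : (\sum_(d <- crit_vals w | d != d0) (if (t < d)%R then ph_mult 0 w b d%:E else 0) =
    \sum_(d <- crit_vals w | (d0 < d)%R) ph_mult 0 w b d%:E)%N.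
  rewrite [LHS]big_mkcond [RHS]big_mkcond; apply: eq_big_seq => _ /crit_valsP[i <-].
  case: (ltgtP d0 (w 0 i)) => // [di|id]; first by rewrite (lt_trans ti1 di).
  by case: ifP => // /i1min; rewrite leNgt id.
have {IH}IH : (\sum_(d <- crit_vals w | (d0 < d)%R) ph_mult 0 w b d%:E + ph_mult 0 w b +oo%E +
   level_rank w (lev_lt b) (lev_le d0) = level_rank w (lev_le b) (lev_le d0))%N.
  apply: IH; last exact: le_trans bt (ltW ti1).
  rewrite -ltnS; apply: leq_trans cn; apply: proper_card; apply/properP; split.
    by apply/fintype.subsetP => i; rewrite !inE; exact: lt_trans.
  by exists i1; rewrite !inE ?ti1// -/d0 ltxx.
have tE P : level_rank w P (lev_lt d0) = level_rank w P (lev_le t).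
  apply: level_rank_ext => // i; rewrite /lev_lt /lev_le; case: (leP (w 0 i) t) => [it|/i1min].
    exact: le_lt_trans it ti1.
  by rewrite leNgt => /negPf.
have := ph_mult0_fin w (le_lt_trans bt ti1 : b < d0); rewrite !tE.
move: IH; set S := bigop _ _ _; move: S (ph_mult 0 w b d0%:E) (ph_mult 0 w b +oo) => S x y.
move: (level_rank w _ _) (level_rank w _ _) (level_rank w _ _) (level_rank w _ _).
rewrite /=; lia.
Qed.

Lemma ph_mult_le (R : realType) (N k : nat) (w : 'rV[R]_N) (b d : R) : d <= b ->
  ph_mult k w b d%:E = 0%N.
Proof. by rewrite /ph_mult ltNge => ->. Qed.

Lemma size_PH0 (R : realType) (N : nat) (w : 'rV[R]_N) :
  size (PH 0 w) = (\sum_(b <- crit_vals w)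
    (level_rank w (lev_le b) (lev_le b) - level_rank w (lev_lt b) (lev_le b)))%N.
Proof.
rewrite /PH size_flatten sumnE /shape big_map big_allpairs_dep /=; apply: eq_bigr => b _.
under eq_bigr do rewrite size_nseq.
rewrite -(births_sum w (lexx b)) addnK big_cat big_map big_seq1 [X in _ = (X + _)%N]big_mkcond /=.
by congr addn; apply: eq_bigr => d _; case: ltP => // /ph_mult_le ->.
Qed.

Lemma birth_mult (R : realType) (N : nat) (w : 'rV[R]_N) (b : R) :
  (level_rank w (lev_lt b) (lev_le b) < level_rank w (lev_le b) (lev_le b))%N ->
  exists d, ph_mult 0 w b d != 0%N.
Proof.
move=> lev; apply: contrapT => nod; move: lev; rewrite -(births_sum w (lexx b)).
have m0 d : ph_mult 0 w b d = 0%N.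
  by apply/eqP/negPn/negP => md; apply: nod; exists d.
by rewrite m0 addn0 big1 ?add0n ?ltnn.
Qed.

(** If no class dies at [d], lowering the bound on births value by value preserves the balance of
    ranks across [d]; at the empty sublevel only boundaries are left and the balance is an
    equality. *)
Lemma death_mult (R : realType) (N : nat) (w : 'rV[R]_N) (d : R) :
  (level_rank w (lev_lt d) (lev_le d) + \rank (bounds 0%N (lev_lt d) w) <
   level_rank w (lev_lt d) (lev_lt d) + \rank (bounds 0%N (lev_le d) w))%N ->
  exists b, ph_mult 0 w b d%:E != 0%N.
Proof.
move=> lev; apply: contrapT => nob.
have m0 b : ph_mult 0 w b d%:E = 0%N by apply/eqP/negPn/negP => mb; apply: nob; exists b.
suff H b : b <= d -> (level_rank w (lev_lt b) (lev_le d) + \rank (bounds 0%N (lev_lt d) w) =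
   level_rank w (lev_lt b) (lev_lt d) + \rank (bounds 0%N (lev_le d) w))%N.
  by move: lev; rewrite H// ltnn.
move: {2}#|_| (leqnn #|[pred i | w 0 i < b]|) => n; elim: n b => [|n IH] b.
  rewrite leqn0 => /eqP/card0_eq b0 _.
  have v0 : vsel (lev_lt b) w = 0.
    by apply/eqP; rewrite -submx0; apply: (vsel_sub _ w _).2 => i bi; have := b0 i; rewrite inE (bi : (w 0 i < b) = true).
  by rewrite /level_rank v0 !adds0mx addnC.
have [[i0 bi0]|noi] := pselect (exists i, w 0 i < b); last first.
  by move=> _; apply: IH; rewrite (_ : #|_| = 0%N)//; apply: eq_card0 => i; rewrite inE;
    apply/negP => bi; apply: noi; exists i.
move=> cn bd; have [i1 bi1 i1max] := @arg_maxP _ _ _ i0 (fun i => w 0 i < b) (fun i => w 0 i) bi0.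
have bE Q : level_rank w (lev_lt b) Q = level_rank w (lev_le (w 0 i1)) Q.
  apply: level_rank_ext => // i; rewrite /lev_lt /lev_le.
  by case: (ltP (w 0 i) b) => [/i1max|bi]; last by rewrite leNgt (lt_le_trans bi1 bi).
have {IH}IH := IH (w 0 i1) _ (ltW (lt_le_trans bi1 bd)).
have := ph_mult0_fin w (lt_le_trans bi1 bd); rewrite m0 !bE.
have cn1 : (#|[pred i | (w 0%R i < w 0%R i1)%R]| <= n)%N.
  rewrite -ltnS; apply: leq_trans cn; apply: proper_card; apply/properP; split.
    by apply/fintype.subsetP => i; rewrite !inE => /lt_trans; apply.
  by exists i1; rewrite !inE ?bi1// ltxx.
move: (IH cn1).
move: (level_rank w _ _) (level_rank w _ _) (level_rank w _ _) (level_rank w _ _).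
move: (\rank _) (\rank _); lia.
Qed.

Lemma plateau (R : realType) (N m : nat) (phi : int -> R) (k : int) : lift N m phi ->
  exists a b, [/\ a < b, forall i, a <= i < b -> phi i = k%:~R,
    (k - 1)%:~R <= phi (a - 1) < k%:~R & k%:~R < phi b <= (k + 1)%:~R].
Proof.
move=> lp; have [a ak a1k] := lift_first lp k.
have [| | |b kb /negP] := @int_least (fun i => k%:~R < phi i).
- by move=> i ki; apply: lt_le_trans ki _; case: lp.
- by have [_ _ /(_ (k + 1)) [i ik]] := lp; exists i; rewrite ik ltr_int; lia.
- by exists a; rewrite ak ltxx.
rewrite -leNgt => b1k; have ab : a < b.
  by rewrite ltNge; apply/negP => ba; move: kb; rewrite ltNge -ak (lift_mono lp).
exists a, b; split=> // [i /andP[ai ib]||].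
- apply/eqP; rewrite eq_le -{2}ak (lift_mono lp ai) andbT.
  by apply: le_trans b1k; apply: (lift_mono lp); lia.
- rewrite a1k andbT leNgt; apply/negP => /(lift_skip lp).
  by rewrite subrK ak ler_int; lia.
- rewrite kb -(subrK 1 b) (lift_skip lp)//.
  by apply: le_lt_trans b1k _; rewrite ltr_int; lia.
Qed.

Lemma plateau_min (R : realType) (N m : nat) (c phi w : int -> R) (l : int) :
  lift N m phi -> alternating c -> (forall i, w i = zeta c (phi i)) ->
  exists a b, [/\ a < b, forall i, a <= i < b -> w i = c (2 * l),
    c (2 * l) < w (a - 1) & c (2 * l) < w b].
Proof.
move=> lp ac wE; have [a [b [ab pE /andP[pa pa'] /andP[pb pb']]]] := plateau (2 * l) lp.
exists a, b; split=> // [i /pE pi||]; first by rewrite wE pi zeta_int.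
  by rewrite wE -(zeta_int c); apply: (zeta_decr (k := l) ac).
by rewrite wE -(zeta_int c); apply: (zeta_incr (k := l) ac).
Qed.

Lemma plateau_max (R : realType) (N m : nat) (c phi w : int -> R) (l : int) :
  lift N m phi -> alternating c -> (forall i, w i = zeta c (phi i)) ->
  exists a b, [/\ a < b, forall i, a <= i < b -> w i = c (2 * l + 1),
    w (a - 1) < c (2 * l + 1) & w b < c (2 * l + 1)].
Proof.
move=> lp ac wE; have [a [b [ab pE /andP[pa pa'] /andP[pb pb']]]] := plateau (2 * l + 1) lp.
exists a, b; split=> // [i /pE pi||]; first by rewrite wE pi zeta_int.
  by rewrite wE -(zeta_int c); apply: (zeta_incr (k := l) ac) => //; move: pa; rewrite addrK.
rewrite wE -(zeta_int c); have e1 : 2 * l + 1 = 2 * (l + 1) - 1 :> int by lia.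
have e2 : 2 * l + 1 + 1 = 2 * (l + 1) :> int by lia.
by rewrite e1 in pb *; rewrite e2 in pb'; apply: (zeta_decr (k := l + 1) ac).
Qed.

Lemma cyc_inj_mod (N : nat) (i j : int) : cyc N i = cyc N j -> (i = j %[mod N.+1%:Z])%Z.
Proof. by move=> ij; rewrite -!cycE ij. Qed.

Lemma rank_kernel (p q N : nat) (X : 'M[rat]_(p, N)) (Y : 'M[rat]_(q, N)) (f : 'cV[rat]_N) :
  (X <= Y)%MS -> (X <= kermx f)%MS -> ~~ (Y <= kermx f)%MS -> (\rank X < \rank Y)%N.
Proof.
move=> XY Xf Yf; rewrite ltn_neqAle mxrankS// andbT; apply: contraNN Yf => /eqP rXY.
have /andP[_ YX] : (X == Y)%MS by rewrite -(mxrank_leqif_eq XY) rXY.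
exact: submx_trans YX Xf.
Qed.

Lemma vtx_arc (N : nat) (p q : int) (j : 'I_N.+1) :
  (vtx j <= kermx (arc N p q))%MS <-> ~ exists2 i : int, p <= i <= q & cyc N i = j.
Proof.
split=> [/sub_kermxP|nj]; last first.
  by apply/sub_kermxP; rewrite delta_arc asboolF//; apply/rowP => k; rewrite !mxE ord1.
by rewrite delta_arc => /rowP/(_ 0); rewrite !mxE eqxx mulr1n; case: asboolP => // _ /eqP.
Qed.

(** The indicator of the plateau at the minimum kills all older vertices and, the neighbours being
    higher, all boundaries at this level; it does not kill the plateau itself. *)
Lemma curve_birth (R : realType) (N m : nat) (c phi : int -> R) (w : 'rV[R]_N.+1) (l : int) :
  lift N.+1 m phi -> alternating c -> (forall i, unroll w i = zeta c (phi i)) ->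
  (level_rank w (lev_lt (c (2 * l)%R)) (lev_le (c (2 * l)%R)) <
   level_rank w (lev_le (c (2 * l)%R)) (lev_le (c (2 * l)%R)))%N.
Proof.
move=> lp ac wE; have [a [b [ab wab wa wb]]] := plateau_min l lp ac wE.
set d := c _ in wab wa wb *; apply: (@rank_kernel _ _ _ _ _ (arc N a (b - 1))).
- by rewrite addsmxS//; apply: vsel_mono => x; exact: ltW.
- rewrite addsmx_sub; apply/andP; split.
    apply: (vsel_sub _ w _).2 => j jd; apply/vtx_arc => -[i ai ij].
    by move: jd; rewrite /lev_lt -ij -[w 0 _]/(unroll w i) wab ?ltxx//; lia.
  apply: (bounds_sub _ w _).2 => e ed; apply/sub_kermxP/arc_edge => eE; move: ed;
    rewrite eE edge_cyc down_closed_max; try exact: lev_le_down.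
    by rewrite /lev_le leNgt wa.
  by rewrite subrK /lev_le andbC leNgt wb.
- apply/negP; rewrite addsmx_sub => /andP[/(vsel_sub _ w _).1 V _].
  have /vtx_arc[] : (vtx (cyc N a) <= kermx (arc N a (b - 1)))%MS.
    by apply: V; rewrite -[w 0 _]/(unroll w a) wab ?lexx// /lev_le lexx.
  by exists a => //; rewrite lexx; lia.
Qed.

(** By the dimension formula the inequality says that more chains of older vertices become
    boundaries at level [d]. The vertex above [d] keeps the polygon open: at the global maximum,
    closing the last gap creates a cycle instead of joining two components. *)
Lemma curve_death (R : realType) (N m : nat) (c phi : int -> R) (w : 'rV[R]_N.+1) (l : int) :
  lift N.+1 m phi -> alternating c -> (forall i, unroll w i = zeta c (phi i)) ->
  (exists j, c (2 * l + 1)%R < w 0 j) ->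
  let d := c (2 * l + 1)%R in
  (level_rank w (lev_lt d) (lev_le d) + \rank (bounds 0%N (lev_lt d) w) <
   level_rank w (lev_lt d) (lev_lt d) + \rank (bounds 0%N (lev_le d) w))%N.
Proof.
move=> lp ac wE [j dj]; have [a [b [ab wab wa wb]]] := plateau_max l lp ac wE.
set d := c _ in dj wab wa wb *.
(* [x] is the representative of [j] in the turn that starts at [a - 1]; it lies beyond [b] since the
   values up to there are at most [d]. *)
have [x [ax xb xj]] : exists x, [/\ a - 1 <= x, x < a - 1 + N.+1%:Z & cyc N x = j].
  exists (a - 1 + ((j%:Z - (a - 1)) %% N.+1%:Z)%Z); split.
  - by rewrite lerDl modz_ge0.
  - by rewrite ltrD2l ltz_pmod.
  - by rewrite -[RHS]cyc_ord; apply: cyc_eq; rewrite modzDmr addrC subrK.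
have wx : d < unroll w x by rewrite /unroll xj.
have bx : b < x.
  rewrite ltNge; apply/negP => xleb; have [xa|xa] := eqVneq x (a - 1).
    by move: wx; rewrite xa ltNge (ltW wa).
  have [xe|xe] := eqVneq x b; first by move: wx; rewrite xe ltNge (ltW wb).
  by move: wx; rewrite wab ?ltxx//; lia.
(* The arc from b to a vertex x above d shows that the difference of the end
   points of the plateau becomes a boundary exactly at level d. *)
pose V := vsel (lev_lt d) w; pose B1 := bounds 0%N (lev_lt d) w; pose B2 := bounds 0%N (lev_le d) w.
have cap : (\rank (V :&: B1)%MS < \rank (V :&: B2)%MS)%N.
  apply: (@rank_kernel _ _ _ _ _ (arc N b (x - 1))).
  - by rewrite capmxS//; apply: bounds_mono => y; exact: ltW.
  - apply: submx_trans (capmxSr _ _) _; apply: (bounds_sub _ w _).2 => e ed.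
    apply/sub_kermxP/arc_edge => eE; move: ed;
      rewrite eE edge_cyc down_closed_max; try exact: lev_lt_down.
      by rewrite /lev_lt (wab (b - 1)) ?ltxx//; lia.
    by rewrite subrK /lev_lt andbC ltNge (ltW wx).
  - apply/negP => capf.
    have yV : (vtx (cyc N b) - vtx (cyc N (a - 1)%R) <= V)%MS.
      by rewrite addmx_sub ?eqmx_opp ?delta_vsel.
    have yB : (vtx (cyc N b) - vtx (cyc N (a - 1)%R) <= B2)%MS.
      apply: path_bounds; [exact: lev_le_down|lia|move=> i ai ib].
      have [->|ia] := eqVneq i (a - 1); first exact: ltW.
      have [->|ib'] := eqVneq i b; first exact: ltW.
      by rewrite /lev_le wab//; lia.
    have : (vtx (cyc N b) - vtx (cyc N (a - 1)%R) <= kermx (arc N b (x - 1)))%MS.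
      by apply: submx_trans capf; rewrite sub_capmx yV.
    (* The arc ends before one full turn from [a - 1] is completed, so it does not return to that
       vertex. *)
    have /vtx_arc aK : ~ exists2 i : int, b <= i <= x - 1 & cyc N i = cyc N (a - 1).
      move=> [i /andP[bi ix] /cyc_inj_mod/eqP]; rewrite eqz_mod_dvd => /dvdzP[q qE].
      have q1 : 0 < q by rewrite -(@pmulr_lgt0 _ N.+1%:Z)// -qE; lia.
      have : N.+1%:Z <= q * N.+1%:Z by rewrite ler_peMl//; lia.
      by rewrite -qE; lia.
    move=> /addmx_sub/(_ aK); rewrite subrK => /vtx_arc[]; exists b => //; lia.
have := mxrank_sum_cap V B1; have := mxrank_sum_cap V B2.
rewrite /level_rank -/V -/B1 -/B2; move: cap.
move: (\rank (V + B1)%MS) (\rank (V + B2)%MS) (\rank (V :&: B1)%MS) (\rank (V :&: B2)%MS).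
move: (\rank V) (\rank B1) (\rank B2); lia.
Qed.

(** The size counts the vertices at which a class is born, one each as the values are distinct. A
    vertex with a lower neighbour is joined to it at once, so births occur exactly at local minima,
    the first arrivals at even integers, and a turn contains [L] of them. *)
Lemma typical_size_PH0 (R : realType) (N L : nat) (c phi : int -> R) (z : 'rV[R]_N.+1) :
  (1 < N)%N -> typical z -> lift N.+1 (2 * L) phi -> alternating c ->
  (forall i, unroll z i = zeta c (phi i)) -> size (PH 0 z) = L.
Proof.
move=> N1 tz lp ac zE.
pose P i := (level_rank z (lev_lt (z 0%R i)) (lev_le (z 0%R i)) <
  level_rank z (lev_le (z 0%R i)) (lev_le (z 0%R i)))%N.
have DP i : (level_rank z (lev_le (z 0%R i)) (lev_le (z 0%R i)) -
    level_rank z (lev_lt (z 0%R i)) (lev_le (z 0%R i)))%N = P i.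
  have : (level_rank z (lev_le (z 0%R i)) (lev_le (z 0%R i)) <=
      (level_rank z (lev_lt (z 0%R i)) (lev_le (z 0%R i))).+1)%N.
    have r1 : \rank (vtx i) = 1%N by rewrite mxrank_delta.
    apply: (@leq_trans (level_rank z (lev_lt (z 0%R i)) (lev_le (z 0%R i)) + \rank (vtx i))%N);
      last by rewrite r1 addn1.
    apply: leq_trans (mxrank_adds_leqif _ _); apply: mxrankS.
    rewrite addsmx_sub; apply/andP; split; last first.
      by apply: submx_trans (addsmxSl _ _); exact: addsmxSr.
    apply: (vsel_sub _ z _).2 => j; rewrite /lev_le le_eqVlt => /orP[/eqP/tz ->|ji].
      exact: addsmxSr.
    by apply: submx_trans (addsmxSl _ _); apply: submx_trans (addsmxSl _ _); exact: delta_vsel.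
  rewrite /P; case: ltnP => /= [|H _]; first lia.
  by apply/eqP; rewrite subn_eq0.
have ne i : unroll z i != unroll z (i + 1).
  apply/eqP => /tz /cyc_inj_mod/eqP; rewrite eqz_mod_dvd opprD addrA subrr add0r.
  by rewrite dvdzE abszN dvdn1 => /eqP; move: N1; clear; lia.
have low i k : k = i + 1 \/ k = i - 1 -> unroll z k < unroll z i -> ~~ P (cyc N i).
  move=> ki zki; rewrite -leqNgt; apply: mxrankS; rewrite addsmx_sub addsmxSr andbT.
  apply: (vsel_sub _ z _).2 => j; rewrite /lev_le le_eqVlt => /orP[/eqP/tz ->|ji]; last first.
    by apply: submx_trans (addsmxSl _ _); exact: delta_vsel.
  rewrite -[vtx (cyc N i)](subrK (vtx (cyc N k))) addmx_sub//.
    apply: submx_trans (addsmxSr _ _); apply: path_bounds_sym; first exact: lev_le_down.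
    move=> l lik; have [->|->] : l = i \/ l = k by lia.
      exact: (lexx (z 0 _)).
    exact: ltW.
  by apply: submx_trans (addsmxSl _ _); exact: delta_vsel.
rewrite size_PH0 /crit_vals undup_id; last by rewrite map_inj_uniq ?enum_uniq.
rewrite big_map; under eq_bigr do rewrite DP.
rewrite -(@lift_count_even _ _ _ phi P lp).
  rewrite -sum1_card [RHS]big_mkcond big_enum; apply: eq_bigr => i _; exact: erefl.
move=> i; split=> [Pi|[_ [k ik]]]; last first.
  have zi : z 0 i = c (2 * k) by rewrite -unroll_ord zE ik zeta_int.
  by rewrite /P zi; exact: (curve_birth k lp ac zE).
have nlow k : k = i%:Z + 1 \/ k = i%:Z - 1 -> ~ unroll z k < unroll z i%:Z.
  by move=> ki /(low _ _ ki); rewrite cyc_ord Pi.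
have pne k : phi k < phi (k + 1).
  rewrite lt_neqAle (lift_mono lp) ?andbT; last by lia.
  by apply: contraNneq (ne k) => pk; rewrite !zE pk.
have p1 : phi (i%:Z - 1) < phi i%:Z by have := pne (i%:Z - 1); rewrite subrK.
split=> //; have /andP[ji ij] := basinP (phi i%:Z); move: (basin _) ji ij => j ji ij.
exists j; have [ij0|ji0|->//] := ltgtP (phi i%:Z) (2 * j)%:~R.
  case: (nlow (i%:Z + 1)); first by left.
  by rewrite !zE; apply: (zeta_decr (k := j) ac) => //; exact: (lift_skip lp).
case: (nlow (i%:Z - 1)); first by right.
rewrite !zE; apply: (zeta_incr (k := j) ac) => //; last exact: ltW.
rewrite leNgt; apply/negP => /(lift_skip lp).
by rewrite subrK leNgt ji0.
Qed.

(** * The connected component *)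

Lemma lift_firsts_step (R : realType) (N m : nat) (phi : int -> R) (iota : int -> int) (k : int) :
  lift N m phi -> (forall k, phi (iota k) = k%:~R) ->
  iota k - k <= iota (k + 1) - (k + 1).
Proof.
move=> lp iotaP; have : iota k < iota (k + 1); last lia.
rewrite ltNge; apply/negP => /(lift_mono lp); rewrite !iotaP ler_int; lia.
Qed.

(** First arrivals at consecutive integers are different vertices. *)
Lemma lift_size (R : realType) (N m : nat) (phi : int -> R) : lift N m phi -> (m <= N)%N.
Proof.
move=> lp; have [iota iotaP iotaN] := lift_firsts lp.
have := @int_mono R (fun k => (iota k - k)%:~R) _ 0 m%:Z (le0z_nat m).
rewrite !ler_int -{1}[m%:Z]add0r iotaN => H.
suff : iota 0 - 0 <= iota 0 + N%:Z - m%:Z by lia.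
by apply: H => k; rewrite ler_int; exact: lift_firsts_step lp iotaP.
Qed.

(** With as many vertices as integers in a turn, [iota k - k] is monotone and periodic, hence
    constant: the chosen arrivals exhaust the vertices. *)
Lemma lift_full (R : realType) (N : nat) (phi : int -> R) : (0 < N)%N -> lift N N phi ->
  forall i, exists k : int, phi i = k%:~R.
Proof.
move=> N0 lp; have [iota iotaP iotaN] := lift_firsts lp.
have fE k : iota (k + 1) - (k + 1) = iota k - k.
  apply/eqP; rewrite -(eqr_int R); apply/eqP.
  apply: (@periodic_mono_const R (fun k => (iota k - k)%:~R) N N0) => [i|i].
    by rewrite iotaN; congr (_%:~R); lia.
  by rewrite ler_int; exact: lift_firsts_step lp iotaP.
have fS k : iota (k + 1) = iota k + 1 by have := fE k; move: (iota _) (iota _) => x y; lia.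
have H i : iota (i - iota 0) = i; last by move=> i; exists (i - iota 0); rewrite -iotaP H.
suff K k : iota k = iota 0 + k by rewrite K; lia.
apply: (@int_step_ind (fun k => iota k = iota 0 + k) 0); first by rewrite addr0.
  by move=> j /= jE; rewrite fS jE addrA.
by move=> j /=; rewrite fS addrA => /addIr.
Qed.

Lemma dataP_mult (R : realType) (N k : nat) (z w : 'rV[R]_N) (b : R) (d : \bar R) :
  (k < 2)%N -> dataP z w -> ph_mult k w b d = ph_mult k z b d.
Proof. by case: k => [|[|//]] _ [/perm_PH H0 /perm_PH H1]. Qed.

(** A minimum is a birth in degree 0. A maximum is a death in degree 0 unless it is global, when it
    is the birth of the class in degree 1. The diagrams of [z] contain the same numbers, and these
    are values of [z]. *)
Lemma dataP_values (R : realType) (N m : nat) (c phi : int -> R) (z w : 'rV[R]_N.+1) (k : int) :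
  dataP z w -> lift N.+1 m phi -> alternating c -> (forall i, unroll w i = zeta c (phi i)) ->
  c k \in crit_vals z.
Proof.
move=> zw lp ac wE; have [l [->|->]] : exists l, k = 2 * l \/ k = 2 * l + 1.
- by exists (k %/ 2)%Z; lia.
- have [d] := birth_mult (curve_birth l lp ac wE).
  by rewrite (dataP_mult _ _ _ zw)// => /ph_mult_crit[].
have [dl|dmax] := pselect (exists j, c (2 * l + 1) < w 0 j).
  have [b] := death_mult (curve_death lp ac wE dl).
  rewrite (dataP_mult _ _ _ zw)// => /ph_mult_crit[_].
  by rewrite mem_cat mem_seq1 orbF => /mapP[x xz [->]].
suff /ph_mult1_max : is_max w (c (2 * l + 1)).
  by rewrite (dataP_mult _ _ _ zw)// => /ph_mult_crit[].
split=> [j|]; first by rewrite leNgt; apply/negP => wj; apply: dmax; exists j.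
have [i ik _] := lift_first lp (2 * l + 1); exists (cyc N i).
by rewrite -[w 0 _]/(unroll w i) wE ik zeta_int.
Qed.

(** For constant [w] the only birth value in degree 0 is also the maximum; with the diagrams of [z],
    the minimum [c 0] would be the maximum of [z]. *)
Lemma dataP_nonconstant (R : realType) (N m : nat) (c phi : int -> R) (z w : 'rV[R]_N.+1) :
  dataP z w -> lift N.+1 m phi -> alternating c -> (forall i, unroll z i = zeta c (phi i)) ->
  exists i, unroll w i != unroll w (i + 1).
Proof.
move=> zw lp ac zE; apply: contrapT => wconst.
have wE i : w 0 i = unroll w 0.
  rewrite -(cyc_ord i); elim: (nat_of_ord i) => [//|n IH].
  rewrite -[LHS]/(unroll w _) intS addrC -{}IH -[RHS]/(unroll w _).
  by apply/esym/eqP/negPn/negP => H; apply: wconst; exists n%:Z.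
have [d] := birth_mult (curve_birth 0 lp ac zE).
rewrite -(dataP_mult _ _ _ zw)// mulr0 => /ph_mult_crit[/crit_valsP[i wi] _].
have /ph_mult1_max : is_max w (c 0) by split=> [j|]; [rewrite -wi !wE|exists i].
rewrite (dataP_mult _ _ _ zw)// => /ph_mult1_max[zle _].
have [j jk _] := lift_first lp (2 * 0 + 1); have := zle (cyc N j).
by rewrite -[z 0 _]/(unroll z j) zE jk zeta_int leNgt; have [-> _] := ac 0.
Qed.

(** By [lift_unique] a common point determines the word up to an even shift, so curves that meet
    coincide. *)
Lemma curve_set_meet (R : realType) (N m m' : nat) (c c' : int -> R) (w w' : 'rV[R]_N.+1) :
  alternating c -> alternating c' ->
  @curve_set R N m c w -> @curve_set R N m' c' w -> @curve_set R N m' c' w' -> @curve_set R N m c w'.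
Proof.
move=> ac ac' [phi lp wE] [phi' lp' wE'] [psi lpsi w'E].
have [k [pk ck]] : exists k : int, (forall i, phi' i = phi i + (2 * k)%:~R) /\
    forall l, c' (l + 2 * k) = c l.
  by apply: (lift_unique lp lp' ac ac') => i; rewrite -wE -wE'.
have mE : m = m'.
  have [[_ pN _] [_ pN' _]] := (lp, lp').
  apply/eqP; rewrite -(eqr_nat R); apply/eqP.
  by have := pN' 0; rewrite !pk pN; lra.
exists (fun i => psi i + (- (2 * k))%:~R); first by rewrite mE; exact: lift_shift.
move=> i; rewrite w'E; set x := psi i + _.
have -> : psi i = x + (2 * k)%:~R by rewrite /x mulrNz subrK.
rewrite zeta_translate.
by congr (zeta _ _); apply/funext => l; exact: ck.
Qed.

(** Encoded by functions between finite types, so that the words of period [m] with letters in [V]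
    form a finite family. *)
Definition value_knots (R : realType) (N m : nat) (V : seq R) (g : {ffun 'I_N.+1 -> 'I_(size V)})
  (k : int) : R := V`_(g (inord `|(k %% m%:Z)%Z|%N)).

Lemma value_knots_periodic (R : realType) (N m : nat) (V : seq R)
  (g : {ffun 'I_N.+1 -> 'I_(size V)}) (k : int) :
  value_knots m g (k + m%:Z) = value_knots m g k.
Proof. by rewrite /value_knots modzDr. Qed.

Lemma value_knotsP (R : realType) (N m : nat) (V : seq R) (c : int -> R) :
  (0 < m)%N -> (m <= N.+1)%N -> (forall k, c (k + m%:Z) = c k) -> (forall k, c k \in V) ->
  exists g : {ffun 'I_N.+1 -> 'I_(size V)}, c = value_knots m g.
Proof.
case: m => // m _ mN cm cV.
have ixV (i : 'I_N.+1) : (index (c i%:Z) V < size V)%N by rewrite index_mem.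
exists [ffun i => Ordinal (ixV i)]; apply/funext => k.
have kE : (`|(k %% m.+1%:Z)%Z|%N)%:Z = cyc m k by rewrite cycE gez0_abs// modz_ge0.
rewrite /value_knots ffunE /= inordK; first by rewrite nth_index// kE periodic_cyc.
by apply: leq_trans mN; rewrite -ltz_nat kE ltz_nat ltn_ord.
Qed.

Lemma curve_set_closed (R : realType) (N m : nat) (c : int -> R) : (0 < m)%N -> (m <= N)%N ->
  ~~ odd m -> (forall k, c (k + m%:Z) = c k) -> closed (@curve_set R N m c).
Proof.
move=> m0 mN m2 cm; rewrite -(subnK mN); apply: compact_closed; first exact: norm_hausdorff.
exact: curve_set_compact.
Qed.

(* Only finitely many curves have their extremal values among the values of z. *)
Lemma dataP_separation (R : realType) (N M : nat) (c phi : int -> R) (z : 'rV[R]_N.+1) :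
  lift N.+1 (2 * M) phi -> alternating c -> (forall i, unroll z i = zeta c (phi i)) ->
  exists U : set 'rV[R]_N.+1, [/\ closed U, U `&` @curve_set R N (2 * M) c = set0
    & dataP z `<=` @curve_set R N (2 * M) c `|` U].
Proof.
move=> lp ac zE; set A := @curve_set R N (2 * M) c; set V := crit_vals z.
pose I : finType := ('I_N.+1 * {ffun 'I_N.+1 -> 'I_(size V)})%type.
pose C (t : I) : set 'rV[R]_N.+1 := @curve_set R N (2 * t.1) (value_knots (2 * t.1) t.2).
(* The bound [2 * t.1 <= N] leaves a free vertex, on which the compactness of these curves relies;
   curves that meet [A] coincide with it and are left out. *)
pose J : set I := [set t : I | [/\ (0 < t.1)%N, (2 * t.1 <= N)%N & C t `&` A = set0]].
pose F : set 'rV[R]_N.+1 := [set w : 'rV[R]_N.+1 | (forall i, w 0 i \in V) /\ ~ A w].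
exists (\bigcup_(t in J) C t `|` F); split.
- apply: closedU.
    apply: closed_bigcup => [|t [t0 tN _]]; first exact: finite_finset.
    apply: curve_set_closed => //; [by rewrite muln_gt0|by rewrite oddM|].
    by move=> k; exact: value_knots_periodic.
  have /accessible_finite_set_closed finC : accessible_space 'rV[R]_N.+1.
    exact/hausdorff_accessible/norm_hausdorff.
  apply: finC.
  pose row_of (g : {ffun 'I_N.+1 -> 'I_(size V)}) : 'rV[R]_N.+1 := \row_i V`_(g i).
  apply: (@sub_finite_set _ _ (row_of @` setT)); last exact: finite_image.
  move=> w [wV _]; have ixV i : (index (w 0%R i) V < size V)%N by rewrite index_mem.
  exists [ffun i => Ordinal (ixV i)] => //; apply/rowP => i.
  by rewrite mxE ffunE /= nth_index.
- rewrite -subset0 => w [[[t [_ _ tA] Ct]|[_ nA]] Aw] //.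
  by rewrite -tA; split.
move=> w zw; have [Aw|nAw] := pselect (A w); [by left|right].
have [L [c' [psi [L0 lpsi ac' wE]]]] := lift_exists (ltn0Sn N) (@unroll_periodic R N w)
  (dataP_nonconstant zw lp ac zE).
have cV k : c' k \in V by exact: dataP_values zw lpsi ac' wE.
have cm := lift_knots_periodic lpsi (@unroll_periodic R N w) wE.
have LN := lift_size lpsi.
(* A lift without room to move takes integer values only. *)
move: LN; rewrite leq_eqVlt => /orP[/eqP LE|LN].
  right; split=> // i; rewrite LE in lpsi.
  have [k ik] := lift_full (ltn0Sn N) lpsi i%:Z.
  by rewrite -unroll_ord wE ik zeta_int.
have m0 : (0 < 2 * L)%N by rewrite muln_gt0.
have [g gE] := value_knotsP m0 (ltnW LN) cm cV.
have LI : (L < N.+1)%N by apply: leq_ltn_trans LN; rewrite leq_pmull.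
have CE : C (Ordinal LI, g) = @curve_set R N (2 * L) c' by rewrite gE.
have Cw : C (Ordinal LI, g) w by rewrite CE; exists psi.
left; exists (Ordinal LI, g) => //; split=> //.
rewrite -subset0 => w' [Cw' Aw']; apply: nAw; rewrite CE in Cw Cw'.
exact: curve_set_meet ac ac' Aw' Cw' Cw.
Qed.

(** The component meets [A] in a closed subset that is also open in it, because within [D] the
    complement of [A] is cut out by the closed set [U]. *)
Lemma component_separated (T : topologicalType) (D A U : set T) (x : T) :
  closed A -> closed U -> U `&` A = set0 -> connected A -> A x -> A `<=` D -> D `<=` A `|` U ->
  connected_component D x = A.
Proof.
move=> cA cU UA conA Ax AD DAU; apply/seteqP; split; last exact: connected_component_max.
have KD := @connected_component_sub _ D x.
suff <- : connected_component D x `&` A = connected_component D x by exact: subIsetr.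
apply: (@component_connected _ D x); last by exists A.
  by exists x; split=> //; exact/connected_component_refl/AD.
exists (~` U); first exact: closed_openC.
apply/seteqP; split=> y [Ky yA]; split=> //.
  by move=> Uy; rewrite -[False]/(set0 y) -UA.
by case: (DAU y (KD _ Ky)).
Qed.

Unset Implicit Arguments.

Theorem theorem4p1 (R : realType) (N M : nat) (z : 'rV[R]_N) :
  (2 <= 2 * M)%N -> (2 * M < N)%N ->
  typical z ->
  size (PH 0 z) = M ->
  homeomorphic (connected_component (dataP z) z) (@str_realization R N M).
Proof.
move=> M1 MN tz zM; have M0 : (0 < M)%N by lia.
case: N => [//|N] in z MN tz zM *.
have cyc_ne i j : (i < j)%R -> j < i + N.+1%:Z -> unroll z i != unroll z j.
  move=> ij jN; apply/eqP => /tz /cyc_inj_mod/esym/eqP; rewrite eqz_mod_dvd => /dvdzP[q qE].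
  have q1 : 0 < q by rewrite -(@pmulr_lgt0 _ N.+1%:Z)// -qE; lia.
  have : N.+1%:Z <= q * N.+1%:Z by rewrite ler_peMl//; lia.
  by rewrite -qE; lia.
have [L [c [phi [L0 lp ac zE]]]] : exists L c phi, [/\ (0 < L)%N, lift N.+1 (2 * L) phi,
    alternating c & forall i, unroll z i = zeta c (phi i)].
  by apply: lift_exists (@unroll_periodic R N z) _ => //; exists 0; apply: cyc_ne; lia.
have LM : L = M by rewrite -zM; apply/esym/(typical_size_PH0 _ tz lp ac zE); lia.
rewrite {L0}LM in lp.
have cm := lift_knots_periodic lp (@unroll_periodic R N z) zE.
have Az : @curve_set R N (2 * M) c z by exists phi.
have m0 : (0 < 2 * M)%N by lia.
have m2 : ~~ odd (2 * M) by rewrite oddM.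
have mN : (2 * M <= N)%N by [].
have [U [cU UA DAU]] := dataP_separation lp ac zE.
have -> : connected_component (dataP z) z = @curve_set R N (2 * M) c.
  apply: (component_separated _ cU UA _ Az _ DAU); first exact: curve_set_closed.
    by rewrite -(subnK mN); exact: curve_set_connected.
  by move=> w Aw; exact: curve_set_dataP ac Az Aw.
apply: homeomorphic_trans (homeomorphic_sym (realization_homeomorphic R N M0)).
(* The even shifts that preserve the word of [z] are the multiples of [2 * M], those of the
   alternating word all even integers; hence the parameters [M] and 1. *)
rewrite -(subnK mN); apply: (@curve_set_homeomorphic R _ _ M 1 c (@alt R)) => //.
- exact: alt_alternating.
- by move=> k; rewrite PoszM alt_periodic.
- by move=> k; rewrite PoszM alt_periodic.
(* An even shift that preserves [c] equates the values at the first arrivals at 0 and [2 * j].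
   Typicality makes these the same vertex, a whole number [q] of turns apart, so [2 * j] is [q]
   times [2 * M]. *)
- move=> j cj; have [i0 i0E _] := lift_first lp 0; have [i1 i1E _] := lift_first lp (2 * j).
  have : unroll z i1 = unroll z i0 by rewrite !zE i1E i0E !zeta_int -[2 * j]add0r cj.
  move=> /tz /cyc_inj_mod/eqP; rewrite eqz_mod_dvd => /dvdzP[q qE].
  have [_ pN _] := lp; have pE := periodic_mul pN.
  suff : 2 * j = q * (2 * M)%N%:Z by move=> e; apply/dvdzP; exists q; lia.
  apply/eqP; rewrite -(eqr_int R) -i1E; apply/eqP.
  have [q0|q0] := leP 0 q.
    have {}qE : i1 = i0 + (absz q)%:Z * N.+1%:Z by lia.
    rewrite qE pE i0E add0r -[q in RHS]gez0_abs// intrM -[_ *+ _]mulr_natr mulrC; congr (_ * _).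
  have {}qE : i0 = i1 + (absz q)%:Z * N.+1%:Z by lia.
  move: i0E; rewrite qE pE i1E => e.
  have -> : q = - (absz q)%:Z by lia.
  rewrite mulNr rmorphN /= [(_ * (2 * M)%N%:Z)%:~R]intrM; apply/eqP; rewrite -subr_eq0 opprK; apply/eqP.
  by move: e; rewrite -(mulr_natr (2 * M)%:R) (mulrC (2 * M)%:R).
Qed.
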